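(* Consider the linear regression model with known noise variance $\sigma^2=1$ described in the context, and assume that the $X_{ij}$, $1\le i\le n$, $1\le j\le p$, are i.i.d. standard Gaussian. Let $a>0$ be a constant and let $\psi^{HC}$ be the Higher Criticism test defined in the context. (i) The type I error satisfies $\alpha(\psi^{HC})=o(1)$. (ii) Let $k=p^{1-\beta}$ with $\beta\in(1/2,1)$ and assume $k\log(p)=o(n)$. Let $r_{np}=x_{np}\sqrt{k\log(p)/n}$ be such that $\liminf(x_{np}-\varphi(\beta))>0$, where $$\varphi(\beta)=\begin{cases}\sqrt{2\beta-1},&1/2<\beta\le 3/4,\\ \sqrt2\,(1-\sqrt{1-\beta}),&3/4<\beta<1.\end{cases}$$ Then $\beta(\psi^{HC},\Theta_k(r_{np}))\to 0$.
   Context: All limits and $o$ symbols are taken as $n\to\infty$ and $p\to\infty$ jointly. Model: one observes $Z=(X,Y)$ with $X=(X_{ij})_{1\le i\le n,1\le j\le p}$, $Y=(Y_1,\dots,Y_n)$ and $Y_i=\sum_{j=1}^p\theta_jX_{ij}+\xi_i$, where $\theta\in\mathbb{R}^p$ is unknown, the $\xi_i$ are i.i.d. $\mathcal{N}(0,1)$ and independent of $X$. $P_\theta$, $E_\theta$ denote the law of $Z$ and its expectation. $X_j\in\mathbb{R}^n$ is the $j$th column of $X$, $(\cdot,\cdot)$ and $\|\cdot\|$ the Euclidean inner product and norm. Higher Criticism test: for $1\le i\le p$ put $y_i=(Y,X_i)/\|Y\|$ and $q_i=P(|\mathcal{N}(0,1)|>|y_i|)$ (the probability that a standard Gaussian exceeds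 $|y_i|$ in absolute value, evaluated at the observed $y_i$). Let $q_{(1)}\le\dots\le q_{(p)}$ be the $q_i$ sorted in increasing order and $$t_{HC}=\max_{i:\ q_{(i)}\le 1/2}\frac{\sqrt p\,(i/p-q_{(i)})}{\sqrt{q_{(i)}(1-q_{(i)})}}.$$ The test $\psi^{HC}$ is the indicator of $\{t_{HC}>(1+a)\sqrt{2\log\log p}\}$ (with $\psi^{HC}=0$ if no $q_{(i)}\le1/2$). $\mathbb{R}^p_k$ is the set of $\theta\in\mathbb{R}^p$ with at most $k$ nonzero coordinates; $\Theta_k(r)=\{\theta\in\mathbb{R}^p_k:\|\theta\|\ge r\}$. For a test $\psi$, $\alpha(\psi)=E_0(\psi)$ and $\beta(\psi,\Theta)=\sup_{\theta\in\Theta}E_\theta(1-\psi)$. *)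

(* Defs.v *)
From HB Require Import structures.
From mathcomp Require Import all_boot all_order all_algebra.
From mathcomp Require Import all_classical all_reals all_analysis.
Set Implicit Arguments.
Unset Strict Implicit.
Unset Printing Implicit Defensive.
Import Order.TTheory GRing.Theory Num.Theory.
Import numFieldNormedType.Exports.
Local Open Scope classical_set_scope.
Local Open Scope ring_scope.

(** ** Independence and i.i.d. standard Gaussian families *)

Section independence.
Context {R : realType} {d : measure_display} {T : measurableType d}.
Variable P : probability T R.

Definition mutually_independent (I : finType) (X : I -> {RV P >-> R}) : Prop :=
  forall (J : {set I}) (B : I -> set R), (forall i, measurable (B i)) ->
    P (\bigcap_(i in [set` J]) (X i @^-1` B i)) =
    (\prod_(i in J) P (X i @^-1` B i))%E.

Definition iid_std_gaussian (I : finType) (X : I -> {RV P >-> R}) : Prop :=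
  (forall (i : I) (B : set R), measurable B ->
     distribution P (X i) B = normal_prob 0 1 B) /\
  mutually_independent X.

Definition sigma_generated (I : finType) (X : I -> {RV P >-> R}) :
    set (set T) :=
  <<s [set X i @^-1` B | i in [set: I] & B in measurable] >>.

Definition independent_families (I J : finType) (X : I -> {RV P >-> R})
    (Y : J -> {RV P >-> R}) : Prop :=
  forall A B, sigma_generated X A -> sigma_generated Y B ->
    P (A `&` B) = (P A * P B)%E.

End independence.

(** ** Euclidean structure, sparse alternatives *)

(* The library norm on matrices is the sup norm, so the Euclidean one is
   spelled out. *)
Definition dotp {R : realType} (n : nat) (u v : 'cV[R]_n) : R :=
  \sum_i u i 0 * v i 0.

Definition norm2 {R : realType} (n : nat) (u : 'cV[R]_n) : R :=
  Num.sqrt (dotp u u).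

(* The sparsity level [k] is a real number, since it is later [p ^ (1 - beta)],
   which need not be an integer. *)
Definition sparse {R : realType} (p : nat) (k : R) : set 'cV[R]_p :=
  [set theta | #|[pred j | theta j 0 != 0]|%:R <= k].

Definition Theta {R : realType} (p : nat) (k r : R) : set 'cV[R]_p :=
  [set theta | sparse k theta /\ r <= norm2 theta].

(** ** Linear regression with random design *)

(* A test is a function of the data [(X, Y)]. *)
Definition test (R : realType) (n p : nat) := 'M[R]_(n, p) -> 'cV[R]_n -> R.

Section model.
Context {R : realType} {d : measure_display} {T : measurableType d}.
Variables (P : probability T R) (n p : nat).
Variables (X : 'I_n -> 'I_p -> {RV P >-> R}) (xi : 'I_n -> {RV P >-> R}).

Definition gaussian_design : Prop :=
  iid_std_gaussian (fun ij : 'I_n * 'I_p => X ij.1 ij.2).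

Definition gaussian_noise : Prop :=
  iid_std_gaussian xi /\
  independent_families xi (fun ij : 'I_n * 'I_p => X ij.1 ij.2).

Definition design (w : T) : 'M[R]_(n, p) := \matrix_(i, j) X i j w.

Definition response (theta : 'cV[R]_p) (w : T) : 'cV[R]_n :=
  \col_i (\sum_j theta j 0 * X i j w + xi i w).

(* [E_theta (f (X, Y))], [P_theta] being the law under [P] of
   [(design, response theta)]. *)
Definition Etheta (theta : 'cV[R]_p) (f : 'M[R]_(n, p) -> 'cV[R]_n -> R) :
    \bar R :=
  'E_P[fun w => f (design w) (response theta w)]%E.

Definition type1_error (psi : test R n p) : \bar R := Etheta 0 psi.

Definition type2_error (psi : test R n p) (A : set 'cV[R]_p) : \bar R :=
  ereal_sup [set Etheta theta (fun x y => 1 - psi x y) | theta in A].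

End model.

(** ** The Higher Criticism test *)

Section higher_criticism.
Context {R : realType} {n p : nat}.
Variables (X : 'M[R]_(n, p)) (Y : 'cV[R]_n).

Definition ystat (j : 'I_p) : R := dotp Y (col j X) / norm2 Y.

Definition pvalue (j : 'I_p) : R :=
  fine (normal_prob 0 1 [set z : R | `|ystat j| < `|z|]).

(* [pvalue_order i] is [q_(i+1)]: ordinals start at 0. *)
Definition pvalue_order (i : 'I_p) : R :=
  nth 0 (sort <=%R [seq pvalue j | j : 'I_p]) i.

(* The maximum is taken in the extended reals, hence equal to [-oo] when no
   p-value is at most 1/2; the test below then accepts. *)
Definition t_HC : \bar R :=
  \big[maxe/-oo%E]_(i < p | pvalue_order i <= 2^-1)
    (Num.sqrt p%:R * (i.+1%:R / p%:R - pvalue_order i) /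
     Num.sqrt (pvalue_order i * (1 - pvalue_order i)))%:E.

End higher_criticism.

Definition psi_HC {R : realType} (a : R) {n p : nat} : test R n p :=
  fun X Y =>
    (((1 + a) * Num.sqrt (2 * ln (ln p%:R)))%:E < t_HC X Y)%E%:R.

Definition phi {R : realType} (beta : R) : R :=
  if beta <= 3 / 4 then Num.sqrt (2 * beta - 1)
  else Num.sqrt 2 * (1 - Num.sqrt (1 - beta)).

(* Main.v *)
From HB Require Import structures.
Require Import Defs.
From mathcomp Require Import all_boot all_order all_algebra.
From mathcomp Require Import all_classical all_reals all_analysis.
From mathcomp Require Import measurable_realfun ring lra.
Import Order.TTheory GRing.Theory Num.Theory.
Import numFieldNormedType.Exports.
Local Open Scope classical_set_scope.
Local Open Scope ring_scope.
Set Implicit Arguments.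
Unset Strict Implicit.
Unset Printing Implicit Defensive.
(* (i) Under the null hypothesis, given the noise, the statistics y_j are i.i.d.
   standard Gaussian, so N(q), the number of p-values at most q, is a binomial
   process. The statistic exceeds the threshold t only if
   N(q) > p q + t sqrt(p q (1 - q)) for some q <= 1/2. Doob's inequality for the
   reverse martingale N(q)/q, with an exponential moment, controls this over a
   block q in [s, rho s]. Below a small multiple of 1/p a union bound suffices;
   above it there are O(log p) geometric blocks, each of probability about
   exp(- t^2 / 2) = (log p)^(-(1+a)^2), up to constants arbitrarily close to 1 in
   the exponent, whence a vanishing total.

   (ii) Let tau = |theta| and u = theta / tau. The reflection of R^(p+1)
   exchanging the noise coordinate with the direction of the response turns each
   row of (X, xi) into independent Gaussians, the first one being the normalized
   response zeta. Consequently
     y_j = z_j + u_j (tau / sqrt(1 + tau^2) |zeta| - (1 + 1 / sqrt(1 + tau^2)) (u, z))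
   with z i.i.d. standard Gaussian. On a likely event y_j has drift at least
   |u_j| A in the direction of u_j, with A slightly above phi(beta) sqrt(k log p).
   If some |u_j| A is at least 3 sqrt(log p), that single p-value is significant.
   Otherwise, since |u| = 1, a positive fraction of k coordinates has drift above
   v sqrt(log p) with v > phi(beta), and a Chernoff bound for the number of
   exceedances of a threshold w sqrt(log p) concludes. *)

(** * Gaussian integrals and tails *)

(** All distributional facts rest on one invariance: an i.i.d. standard Gaussian family is preserved
    by a rotation of two coordinates, hence by reflections. Unit combinations, projections on a
    random direction and the representation under the alternative are read off suitable reflections,
    without constructing conditional laws. The sample sizes, the probability space and [theta] all
    vary along the limit, so each asymptotic estimate is uniform: its constants are fixed before the
    space, the family and the vector. The test scans a continuum of levels, and bad events are
    therefore only enclosed in measurable events of small probability ([pbound]). Doob's inequality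
    is a finite sum identity for p-values rounded to a grid; refining the grid costs a factor 2. On
    the null side the threshold is written [tau ^+ 2]. Outside the moderate range there are only
    O(log tau) blocks, so exp(- tau / 16) is good enough there, and the sharp constant matters for
    the O(log p) moderate blocks alone. On the alternative side [s = sqrt (ln p)] is the unit of
    length, and every power of [p] is the exponential of a multiple of [s ^+ 2]. *)

Section gaussian_integral.
Context {R : realType}.
Notation mu := (@lebesgue_measure R).
Local Open Scope ereal_scope.

Lemma ge0_integral_normal_prob (m s : R) (f : R -> \bar R) :
  measurable_fun [set: R] f -> (forall x, 0 <= f x) ->
  \int[normal_prob m s]_x f x = \int[mu]_x (f x * (normal_pdf m s x)%:E).
Proof.
move=> mf f0.
have dom := normal_prob_dominates m s.
rewrite -(@Radon_Nikodym_SigmaFinite.change_of_variables _ _ _ _ mu dom)//.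
apply: ae_eq_integral => //.
- apply: emeasurable_funM => //.
  exact: measurable_int (Radon_Nikodym_SigmaFinite.f_integrable dom).
- by apply: emeasurable_funM => //; apply/measurable_EFinP; exact: measurable_normal_pdf.
- apply: ae_eqe_mul2l; apply: integral_ae_eq => //.
  + exact: Radon_Nikodym_SigmaFinite.f_integrable.
  + by apply/measurable_EFinP; exact: measurable_normal_pdf.
  + by move=> E _ mE; rewrite -Radon_Nikodym_SigmaFinite.f_integral.
Qed.

Lemma ge0_integral_translation (c : R) (f : R -> \bar R) :
  measurable_fun [set: R] f -> (forall x, 0 <= f x) ->
  \int[mu]_x f (x + c)%R = \int[mu]_x f x.
Proof.
move=> mf f0.
have mc : measurable_fun [set: measurableTypeR R] (fun x : R => (x + c)%R : measurableTypeR R).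
  by apply: measurable_funD.
rewrite -(@ge0_integral_pushforward _ _ _ _ _ _ mc mu setT f)//=.
apply: eq_measure_integral => A mA _; apply/esym.
pose phiM := isMeasurableFun.Build _ _ (measurableTypeR R) (measurableTypeR R) _ mc.
pose phi : {mfun measurableTypeR R >-> measurableTypeR R} := HB.pack (fun x : R => (x + c)%R) phiM.
apply: (@lebesgue_measure_unique _ (pushforward mu phi)) => //= _ [[a b]/= _ <-].
rewrite /pushforward /=.
have -> : phi @^-1` `]a, b]%classic = `](a - c)%R, (b - c)%R]%classic.
  by apply/seteqP; split => x /=; rewrite !in_itv/= lerBrDr ltrBlDr.
rewrite !lebesgue_measure_itv/= !lte_fin ltrD2r; case: ifPn => // _.
by congr EFin; lra.
Qed.

(** For fixed [y] the shear is a translation in [x]; Tonelli brings the [x] integral inside and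
    back. *)
Lemma iterated_integral_shear1 (a : R) (f : R * R -> \bar R) :
  measurable_fun [set: R * R] f -> (forall z, 0 <= f z) ->
  \int[mu]_x \int[mu]_y f (x + a * y, y)%R = \int[mu]_x \int[mu]_y f (x, y).
Proof.
move=> mf f0.
have ms : measurable_fun [set: R * R] (fun z : R * R => f (z.1 + a * z.2, z.2)%R).
  apply: measurableT_comp => //; apply/measurable_fun_pair => //=.
  by apply: measurable_funD => //; exact: measurable_funM.
apply: etrans (@fubini_tonelli _ _ _ _ R mu mu _ ms (fun=> f0 _)) _.
apply/esym; apply: etrans (@fubini_tonelli _ _ _ _ R mu mu _ mf f0) _; apply/esym.
apply: eq_integral => y _ /=.
rewrite (@ge0_integral_translation (a * y)%R (fun x => f (x, y)))//.
by apply: measurableT_comp => //; exact: pair2_measurable.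
Qed.

Lemma iterated_integral_shear2 (b : R) (f : R * R -> \bar R) :
  measurable_fun [set: R * R] f -> (forall z, 0 <= f z) ->
  \int[mu]_x \int[mu]_y f (x, y + b * x)%R = \int[mu]_x \int[mu]_y f (x, y).
Proof.
move=> mf f0; apply: eq_integral => x _.
rewrite (@ge0_integral_translation (b * x)%R (fun y => f (x, y)))//.
by apply: measurableT_comp => //; exact: pair1_measurable.
Qed.

(* A rotation that is not plus or minus the identity is a product of three shears. *)
Lemma iterated_integral_rotation (c s : R) (f : R * R -> \bar R) :
  (c ^+ 2 + s ^+ 2 = 1)%R -> s != 0%R ->
  measurable_fun [set: R * R] f -> (forall z, 0 <= f z) ->
  \int[mu]_x \int[mu]_y f (c * x + s * y, - s * x + c * y)%R =
  \int[mu]_x \int[mu]_y f (x, y).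
Proof.
move=> cs s0 mf f0; pose a := ((1 - c) / s)%R.
pose f1 z := f (z.1 + a * z.2, z.2)%R.
have mf1 : measurable_fun setT f1.
  apply: measurableT_comp => //; apply/measurable_fun_pair => //=.
  by apply: measurable_funD => //; exact: measurable_funM.
pose f2 z := f1 (z.1, z.2 + (- s) * z.1)%R.
have mf2 : measurable_fun setT f2.
  apply: measurableT_comp => //; apply/measurable_fun_pair => //=.
  by apply: measurable_funD => //; exact: measurable_funM.
have e1 := iterated_integral_shear1 a mf2 (fun=> f0 _).
have e2 := iterated_integral_shear2 (- s) mf1 (fun=> f0 _).
apply: etrans (etrans e1 (etrans e2 (iterated_integral_shear1 a mf f0))).
apply: eq_integral => x _; apply: eq_integral => y _; rewrite /f2 /f1 /= /a.
have c2 : (1 - c ^+ 2 = s ^+ 2)%R by rewrite -cs addrAC subrr add0r.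
congr (f (_, _)); last by field.
have -> : (x + (1 - c) / s * y + (1 - c) / s * (y + - s * (x + (1 - c) / s * y)) =
  c * x + (1 - c ^+ 2) / s * y)%R by field.
by rewrite c2 expr2 mulfK.
Qed.

Notation gauss := (@normal_prob R 0 1).

Lemma normal_pdf01 (x : R) : normal_pdf 0 1 x = (normal_peak 1 * expR (- (x ^+ 2) / 2))%R.
Proof. by rewrite normal_pdfE ?oner_eq0// /normal_fun subr0 expr1n. Qed.

Lemma gauss_prod_density (E : set (R * R)) : measurable E ->
  (gauss \x gauss) E =
  \int[mu]_x \int[mu]_y ((\1_E (x, y))%:E * (normal_pdf 0 1 x * normal_pdf 0 1 y)%:E).
Proof.
move=> mE; rewrite /product_measure1.
have mpdf := measurable_normal_pdf (0 : R) 1.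
rewrite ge0_integral_normal_prob//; last first.
  by apply: measurable_fun_xsection.
apply: eq_integral => x _ /=.
rewrite -[X in gauss X]setIT -integral_indic//; last exact: measurable_xsection.
have mx : measurable (xsection E x) by exact: measurable_xsection.
rewrite ge0_integral_normal_prob//; last by apply/measurable_EFinP/measurable_indic.
rewrite -ge0_integralZr//.
- apply: eq_integral => y _; rewrite -!EFinM; congr EFin.
  by rewrite !indicE mem_xsection -mulrA [(normal_pdf 0 1 y * _)%R]mulrC.
- by apply: emeasurable_funM; apply/measurable_EFinP => //; exact: measurable_indic.
- by move=> y _; rewrite -EFinM lee_fin mulr_ge0// normal_pdf_ge0.
- by rewrite lee_fin normal_pdf_ge0.
Qed.

(** The product density depends only on [x ^+ 2 + y ^+ 2], so invariance of Lebesgue measure is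
    enough. *)
Lemma gauss_prod_rotation (c s : R) (E : set (R * R)) :
  (c ^+ 2 + s ^+ 2 = 1)%R -> s != 0%R -> measurable E ->
  (gauss \x gauss) [set z | E (c * z.1 + s * z.2, - s * z.1 + c * z.2)%R] =
  (gauss \x gauss) E.
Proof.
move=> cs s0 mE.
have mrot : measurable_fun [set: R * R]
    (fun z : R * R => (c * z.1 + s * z.2, - s * z.1 + c * z.2)%R).
  by apply/measurable_fun_pair => //=; apply: measurable_funD => //; exact: measurable_funM.
have mpdf := measurable_normal_pdf (0 : R) 1.
set E' := [set z : R * R | _].
have mE' : measurable E' by rewrite -[E']setTI; exact: mrot.
pose g z : \bar R := (\1_E z)%:E * (normal_pdf 0 1 z.1 * normal_pdf 0 1 z.2)%:E.
have mg : measurable_fun setT g.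
  apply: emeasurable_funM; apply/measurable_EFinP; first exact: measurable_indic.
  by apply: measurable_funM; exact: (measurableT_comp mpdf).
have g0 z : 0 <= g z by rewrite /g -EFinM lee_fin !mulr_ge0// normal_pdf_ge0.
apply: etrans (gauss_prod_density mE') _.
apply/esym; apply: etrans (gauss_prod_density mE) _.
apply/esym; apply: etrans (iterated_integral_rotation cs s0 mg g0).
apply: eq_integral => x _; apply: eq_integral => y _; rewrite /g/=.
congr (_ * _%:E); rewrite !normal_pdf01 mulrACA [RHS]mulrACA -!expRD.
congr (_ * expR _)%R.
have -> : (- (c * x + s * y) ^+ 2 / 2 + - (- s * x + c * y) ^+ 2 / 2 =
  - ((c ^+ 2 + s ^+ 2) * (x ^+ 2 + y ^+ 2)) / 2)%R by field.
by rewrite cs; field.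
Qed.

End gaussian_integral.

Section gaussian_tail.
Context {R : realType}.
Notation mu := (@lebesgue_measure R).
Notation gauss := (@normal_prob R 0 1).
Local Open Scope ereal_scope.

Lemma ge0_integral_opp (f : R -> \bar R) :
  measurable_fun [set: R] f -> (forall x, 0 <= f x) ->
  \int[mu]_x f (- x)%R = \int[mu]_x f x.
Proof.
move=> mf f0.
have mN : measurable_fun [set: measurableTypeR R] (-%R : R -> measurableTypeR R).
  exact: oppr_measurable.
rewrite -(@ge0_integral_pushforward _ _ _ _ _ _ mN mu setT f)//=.
by apply: eq_measure_integral => A mA _; exact: lebesgue_measureN.
Qed.

Lemma gauss_opp (A : set R) : measurable A -> gauss [set x | A (- x)%R] = gauss A.
Proof.
move=> mA.
have mN : measurable [set x | A (- x)%R].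
  by rewrite -[X in measurable X]setTI; exact: (@oppr_measurable R setT).
have mpdf := measurable_normal_pdf (0 : R) 1.
have E (B : set R) : measurable B -> gauss B =
    \int[mu]_x ((\1_B x)%:E * (normal_pdf 0 1 x)%:E).
  move=> mB; rewrite -ge0_integral_normal_prob ?integral_indic ?setIT//.
  by apply/measurable_EFinP/measurable_indic.
rewrite (E _ mN) (E _ mA).
rewrite -(@ge0_integral_opp (fun x => (\1_A x)%:E * (normal_pdf 0 1 x)%:E)).
- by apply: eq_integral => x _; rewrite !normal_pdf01 sqrrN !indicE.
- by apply: emeasurable_funM; apply/measurable_EFinP => //; exact: measurable_indic.
- by move=> x; rewrite mule_ge0// lee_fin normal_pdf_ge0.
Qed.

(** Up to the factor [sg], the integrand times the density is the density of a centered Gaussian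
    with standard deviation [sg]. This is the Laplace transform behind the chi-square bound. *)
Lemma gauss_expR_sqr (l : R) : (0 <= l)%R ->
  \int[gauss]_x (expR (- (l * x ^+ 2)))%:E = ((Num.sqrt (1 + 2 * l))^-1)%:E.
Proof.
move=> l0; have l1 : (0 < 1 + 2 * l)%R by lra.
pose sg := (Num.sqrt (1 + 2 * l))^-1%R.
have sg0 : (0 < sg)%R by rewrite invr_gt0 sqrtr_gt0.
have sg2 : (sg ^+ 2 = (1 + 2 * l)^-1)%R by rewrite exprVn sqr_sqrtr// ltW.
have mf : measurable_fun [set: R] (fun x : R => expR (- (l * x ^+ 2))).
  apply: measurableT_comp => //; apply: measurableT_comp => //.
  by apply: measurable_funM => //; exact: measurable_funX.
rewrite ge0_integral_normal_prob//; last by apply/measurable_EFinP.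
transitivity (\int[mu]_x (sg%:E * (normal_pdf 0 sg x)%:E)).
  apply: eq_integral => x _; rewrite -!EFinM; congr EFin.
  rewrite normal_pdf01 normal_pdfE ?gt_eqF// /normal_fun subr0 mulrCA -expRD.
  rewrite [RHS]mulrA; congr (_ * expR _)%R.
    rewrite /normal_peak expr1n mul1r -mulrnAr sqrtrM ?sqr_ge0// sqrtr_sqr gtr0_norm//.
    by rewrite invfM mulrA divff ?gt_eqF// mul1r.
  by rewrite sg2; field; lra.
rewrite ge0_integralZl ?integral_normal_pdf ?mule1//.
- by apply/measurable_EFinP; exact: measurable_normal_pdf.
- by move=> x _; rewrite lee_fin normal_pdf_ge0.
- by rewrite lee_fin ltW.
Qed.

(** Beyond [y] the standard density is at most exp(- y^2 / 2) times the density centered at [y],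
    because [y * (x - y) >= 0] there. *)
Lemma gauss_upper_tail_le (y : R) : (0 <= y)%R ->
  gauss [set z | (y < z)%R] <= (expR (- (y ^+ 2 / 2)))%:E.
Proof.
move=> y0.
have <- : \int[mu]_x ((expR (- (y ^+ 2 / 2)))%:E * (normal_pdf y 1 x)%:E) =
    (expR (- (y ^+ 2 / 2)))%:E.
  rewrite ge0_integralZl ?integral_normal_pdf ?mule1//.
  - by apply/measurable_EFinP; exact: measurable_normal_pdf.
  - by move=> x _; rewrite lee_fin normal_pdf_ge0.
have mD : measurable [set z : R | (y < z)%R].
  by have -> : [set z : R | (y < z)%R] = `]y, +oo[%classic by apply/seteqP; split => x /=; rewrite in_itv/= andbT.
have mg : measurable_fun [set: R] (fun x => (expR (- (y ^+ 2 / 2)))%:E * (normal_pdf y 1 x)%:E).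
  by apply: emeasurable_funM; apply/measurable_EFinP => //; exact: measurable_normal_pdf.
apply: (@le_trans _ _ (\int[mu]_(x in [set z | (y < z)%R]) ((expR (- (y ^+ 2 / 2)))%:E * (normal_pdf y 1 x)%:E))).
  apply: ge0_le_integral => //.
  - by move=> x _; rewrite lee_fin normal_pdf_ge0.
  - by apply/measurable_EFinP/measurable_funTS; exact: measurable_normal_pdf.
  - exact: measurable_funTS.
  - move=> x /= yx; rewrite -EFinM lee_fin normal_pdf01 normal_pdfE ?oner_eq0//.
    rewrite mulrCA ler_wpM2l ?normal_peak_ge0// /normal_fun -expRD ler_expR expr1n.
    have : (0 <= y * (x - y))%R by rewrite mulr_ge0// subr_ge0 ltW.
    by nra.
apply: ge0_subset_integral => // x _.
by rewrite mule_ge0// lee_fin ?expR_ge0 ?normal_pdf_ge0.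
Qed.

Lemma gauss_itv_ge (a b : R) : (0 <= a <= b)%R ->
  ((normal_peak 1 * expR (- (b ^+ 2 / 2)) * (b - a))%R%:E <= gauss `]a, b]%classic).
Proof.
move=> /andP[a0 ab].
have -> : (normal_peak 1 * expR (- (b ^+ 2 / 2)) * (b - a))%R%:E =
    \int[mu]_(x in `]a, b]%classic) (normal_peak 1 * expR (- (b ^+ 2 / 2)))%:E.
  rewrite integral_cst//= lebesgue_measure_itv/= lte_fin EFinM; congr (_ * _).
  by move: ab; rewrite le_eqVlt => /predU1P[->|->//]; rewrite ltxx subrr.
apply: ge0_le_integral => //.
- by move=> x _; rewrite lee_fin mulr_ge0 ?normal_peak_ge0 ?expR_ge0.
- by apply/measurable_EFinP/measurable_funTS; exact: measurable_normal_pdf.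
- move=> x /=; rewrite in_itv/= => /andP[ax xb].
  rewrite lee_fin normal_pdf01 ler_wpM2l ?normal_peak_ge0// ler_expR.
  have : (x * x <= b * b)%R by rewrite ler_pM//; lra.
  by lra.
Qed.

Lemma gauss_itv_le (a b : R) : (a <= b)%R ->
  gauss `[a, b]%classic <= (normal_peak 1 * (b - a))%R%:E.
Proof.
move=> ab.
have -> : (normal_peak 1 * (b - a))%R%:E = \int[mu]_(x in `[a, b]%classic) (normal_peak 1 : R)%:E.
  rewrite integral_cst//= lebesgue_measure_itv/= lte_fin EFinM; congr (_ * _).
  by move: ab; rewrite le_eqVlt => /predU1P[->|->//]; rewrite ltxx subrr.
apply: ge0_le_integral => //.
- by move=> x _; rewrite lee_fin normal_pdf_ge0.
- by apply/measurable_EFinP/measurable_funTS; exact: measurable_normal_pdf.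
- by move=> x _; rewrite lee_fin normal_pdf_ub// oner_eq0.
Qed.

End gaussian_tail.

(** * The two-sided Gaussian tail and its inverse *)

Section gaussian_two_sided_tail.
Context {R : realType}.
Notation gauss := (@normal_prob R 0 1).
Implicit Types t x y : R.

(** [pvalue] is convertible to [gtail] of the absolute value of [ystat]. *)
Definition gtail t : R := fine (gauss [set z | t < `|z|]).

Lemma measurable_abs_gt t : measurable [set z : R | t < `|z|].
Proof.
have := @normr_measurable R setT measurableT `]t, +oo[%classic (measurable_itv _).
rewrite setTI; congr measurable.
by apply/seteqP; split => z /=; rewrite in_itv/= andbT.
Qed.

Lemma measurable_abs_ge t : measurable [set z : R | t <= `|z|].
Proof.
have := @normr_measurable R setT measurableT `[t, +oo[%classic (measurable_itv _).
rewrite setTI; congr measurable.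
by apply/seteqP; split => z /=; rewrite in_itv/= andbT.
Qed.
Hint Extern 0 (measurable [set z | is_true (_ < `|z|)]) =>
  solve [apply: measurable_abs_gt] : core.
Hint Extern 0 (measurable [set z | is_true (_ <= `|z|)]) =>
  solve [apply: measurable_abs_ge] : core.

Lemma gtailE t : gauss [set z | t < `|z|] = (gtail t)%:E.
Proof. by rewrite fineK// fin_num_measure. Qed.

Lemma gtail_ge0 t : 0 <= gtail t. Proof. by rewrite fine_ge0. Qed.

Lemma gtail_le1 t : gtail t <= 1.
Proof. by rewrite -lee_fin -gtailE probability_le1. Qed.

Lemma gtail_le_expR t : 0 <= t -> gtail t <= 2 * expR (- (t ^+ 2 / 2)).
Proof.
move=> t0; rewrite -lee_fin -gtailE.
have mD : measurable [set z : R | t < z].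
  by have -> : [set z : R | t < z] = `]t, +oo[%classic by apply/seteqP; split => x /=; rewrite in_itv/= andbT.
have mDN : measurable [set z : R | t < - z].
  by rewrite -[X in measurable X]setTI; exact: (@oppr_measurable R setT measurableT _ mD).
have -> : [set z : R | t < `|z|] = [set z | t < z] `|` [set z | t < - z].
  by apply/seteqP; split => z /=; rewrite ltr_normr => /orP.
apply: le_trans (measureU2 _ _ _) _ => //.
have e : gauss [set z | t < - z] = gauss [set z | t < z] := gauss_opp mD.
rewrite mulr_natl mulr2n EFinD; apply: leeD; first exact: gauss_upper_tail_le.
by apply: le_trans (gauss_upper_tail_le t0); rewrite -e.
Qed.

(** Lowering the threshold from [y] to [x] adds at most two intervals of length [y - x], on which
    the density is at most its peak. Both the absence of atoms and the continuity of [gtail]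
    follow. *)
Lemma gtail_lipschitz x y : x <= y -> gtail x <= gtail y + 2 * normal_peak 1 * (y - x).
Proof.
move=> xy; rewrite -lee_fin EFinD -!gtailE.
apply: (@le_trans _ _ (gauss ([set z | y < `|z|] `|` (`[x, y]%classic `|` `[- y, - x]%classic)))).
  apply: le_measure; rewrite ?inE//; first by apply: measurableU => //; exact: measurableU.
  move=> z /= xz; have [yz|zy] := ltP y `|z|; [by left|right].
  have [z0|z0] := leP 0 z.
    by left; rewrite in_itv/= -(ger0_norm z0) zy ltW.
  right; rewrite in_itv/= lerNl lerNr.
  by move: xz zy; rewrite ltr0_norm// => /ltW -> ->.
apply: le_trans (measureU2 _ _ _) _ => //; first exact: measurableU.
rewrite leeD2l//; apply: le_trans (measureU2 _ _ _) _ => //.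
have -> : 2 * normal_peak 1 * (y - x) = normal_peak 1 * (y - x) + normal_peak 1 * (- x - - y).
  by ring.
by rewrite EFinD leeD// gauss_itv_le// lerN2.
Qed.

Lemma gtail_decr x y : 0 <= x -> x < y -> gtail y < gtail x.
Proof.
move=> x0 xy; rewrite -lte_fin -!gtailE.
apply: (@lt_le_trans _ _ (gauss ([set z | y < `|z|] `|` `]x, y]%classic))); last first.
  apply: le_measure; rewrite ?inE//; first exact: measurableU.
  move=> z [/=|]; first by move=> /(lt_trans xy).
  by rewrite /= in_itv/= => /andP[xz _]; rewrite (lt_le_trans xz)// ler_norm.
have -> : gauss ([set z | y < `|z|] `|` `]x, y]%classic) =
    (gauss [set z | (y < `|z|)%R] + gauss `]x, y]%classic)%E.
  apply: measureU => //; apply/seteqP; split => // z [/= yz].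
  rewrite in_itv/= => /andP[xz zy].
  by move: yz; rewrite ger0_norm ?ltNge ?zy// ltW// (le_lt_trans x0).
rewrite gtailE lteDl//.
apply: (lt_le_trans _ (gauss_itv_ge _)); last by rewrite x0 ltW.
by rewrite lte_fin mulr_gt0 ?subr_gt0// mulr_gt0 ?expR_gt0// normal_peak_gt0// oner_eq0.
Qed.

Lemma gtail_le x y : x <= y -> gtail y <= gtail x.
Proof.
move=> xy; rewrite -lee_fin -!gtailE; apply: le_measure; rewrite ?inE//.
by move=> z /=; exact: le_lt_trans.
Qed.

Lemma gtail_mono x y : 0 <= x -> 0 <= y -> (gtail x <= gtail y) = (y <= x).
Proof.
move=> x0 y0; have [yx|xy] := leP y x; first by rewrite gtail_le.
by apply/negbTE; rewrite -ltNge gtail_decr.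
Qed.

Lemma gauss_abs_ge t : gauss [set z | t <= `|z|] = (gtail t)%:E.
Proof.
rewrite -gtailE; apply/eqP; rewrite eq_le; apply/andP; split; last first.
  by apply: le_measure; rewrite ?inE// => z /=; exact: ltW.
rewrite gtailE; apply/lee_addgt0Pr => e e0.
pose d := e / (2 * normal_peak 1).
have pk : 0 < normal_peak 1 :> R by rewrite normal_peak_gt0// oner_eq0.
have d0 : 0 < d by rewrite divr_gt0// mulr_gt0.
apply: (@le_trans _ _ (gauss [set z | t - d < `|z|])).
  apply: le_measure; rewrite ?inE// => z /=; apply: lt_le_trans.
  by rewrite ltrBlDr ltrDl.
rewrite gtailE -EFinD lee_fin (le_trans (@gtail_lipschitz (t - d) t _))//.
  by rewrite lerBlDr lerDl ltW.
by rewrite lerD2l opprB addrC subrK /d mulrC divfK// mulf_neq0// gt_eqF.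
Qed.

Lemma gtail0 : gtail 0 = 1.
Proof.
apply: EFin_inj; rewrite -gauss_abs_ge -(@probability_setT _ _ _ gauss).
by congr (gauss _); apply/seteqP; split => z /=.
Qed.

Lemma gtail_gt0 t : 0 < gtail t.
Proof.
apply: (le_lt_trans (gtail_ge0 (`|t| + 1))).
apply: (lt_le_trans (@gtail_decr `|t| _ _ _)) => //; first by rewrite ltrDl.
by rewrite gtail_le// ler_norm.
Qed.

Lemma gtail_surj g : 0 < g -> g <= 1 -> exists2 t, 0 <= t & gtail t = g.
Proof.
(* A crude right end for the intermediate value theorem: [gtail b] is at most 2 / (1 + b^2 / 2), and
   g (1 + b^2 / 2) = g + 2 / g is at least 2. *)
move=> g0 g1; pose b := 2 / g.
have b0 : 0 <= b by rewrite divr_ge0// ltW.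
have pk : 0 < normal_peak 1 :> R by rewrite normal_peak_gt0// oner_eq0.
have gb : gtail b <= g.
  apply: (le_trans (gtail_le_expR b0)).
  rewrite expRN ler_pdivrMr ?expR_gt0//.
  apply: (@le_trans _ _ (g * (1 + b ^+ 2 / 2))); last by rewrite ler_wpM2l ?expR_ge1Dx// ltW.
  have -> : g * (1 + b ^+ 2 / 2) = g + 2 / g by rewrite /b; field; rewrite gt_eqF.
  have : 2 <= 2 / g by rewrite ler_pdivlMr// ler_piMr.
  by lra.
have cont : {within `[0, b], continuous gtail}.
  apply: continuous_subspaceT => x.
  apply/cvgrPdist_lt => e e0; near=> y.
  have : `|x - y| < e / (2 * normal_peak 1).
    by near: y; apply: cvgr_dist_lt; [exact: cvg_id|rewrite divr_gt0// mulr_gt0].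
  rewrite ltr_pdivlMr ?mulr_gt0//; apply: le_lt_trans.
  have [xy|yx] := leP x y.
    have h1 := gtail_le xy; have h2 := gtail_lipschitz xy.
    by rewrite ger0_norm ?subr_ge0// ler0_norm ?subr_le0//; lra.
  have h1 := gtail_le (ltW yx); have h2 := gtail_lipschitz (ltW yx).
  by rewrite ler0_norm ?subr_le0// gtr0_norm ?subr_gt0//; lra.
have [|t + tg] := IVT b0 cont (v := g).
  by rewrite gtail0 ge_min le_max g1 gb orbT.
by rewrite in_itv/= => /andP[t0 _]; exists t.
Unshelve. all: by end_near. Qed.

End gaussian_two_sided_tail.
#[global] Hint Extern 0 (measurable [set z | is_true (_ < `|z|)]) =>
  solve [apply: measurable_abs_gt] : core.
#[global] Hint Extern 0 (measurable [set z | is_true (_ <= `|z|)]) =>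
  solve [apply: measurable_abs_ge] : core.

(** * Families of independent standard Gaussians *)

Section iid_gaussian.
Context {R : realType} {d : measure_display} {T : measurableType d}.
Variable P : probability T R.
Notation gauss := (@normal_prob R 0 1).

(** Plain functions instead of bundled random variables, so that rotated, reflected and projected
    families need no repackaging. The product formula over all of [I] contains the one for
    subfamilies, by taking the full line at the other indices. *)
Definition iidN (I : finType) (X : I -> T -> R) : Prop :=
  (forall i, measurable_fun [set: T] (X i)) /\
  forall B : I -> set R, (forall i, measurable (B i)) ->
    P [set w | forall i, B i (X i w)] = (\prod_i gauss (B i))%E.

Lemma iid_std_gaussian_iidN (I : finType) (X : I -> {RV P >-> R}) :
  iid_std_gaussian X -> iidN (fun i => X i : T -> R).
Proof.
move=> [dX iX]; split=> [i|B mB]; first exact: measurable_funP.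
have := iX [set: I]%SET B mB.
have -> : \bigcap_(i in [set` [set: I]%SET]) (X i @^-1` B i) =
    [set w | forall i, B i (X i w)].
  apply/seteqP; split => w /= h i; last by move=> _; exact: h.
  by apply: (h i) => /=; rewrite inE.
move=> ->; apply: eq_big => [i|i _]; first by rewrite inE.
exact: dX.
Qed.

Lemma measurable_forall_fin (I : finType) (X : I -> T -> R) (B : I -> set R) (Q : pred I) :
  (forall i, measurable_fun [set: T] (X i)) -> (forall i, measurable (B i)) ->
  measurable [set w | forall i, Q i -> B i (X i w)].
Proof.
move=> mX mB.
have -> : [set w | forall i, Q i -> B i (X i w)] =
    \bigcap_(i in [set i | Q i]) (X i @^-1` B i).
  by apply/seteqP; split => w /= h i; exact: h.
apply: fin_bigcap_measurable; first exact: finite_finset.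
by move=> i _; rewrite -[X in measurable X]setTI; exact: mX.
Qed.

Lemma iidN_pred (I : finType) (X : I -> T -> R) (B : I -> set R) (Q : pred I) :
  iidN X -> (forall i, measurable (B i)) ->
  P [set w | forall i, Q i -> B i (X i w)] = (\prod_(i | Q i) gauss (B i))%E.
Proof.
move=> [mX iX] mB.
have := iX (fun i => if Q i then B i else setT).
have -> : [set w | forall i, (if Q i then B i else setT) (X i w)] =
    [set w | forall i, Q i -> B i (X i w)].
  apply/seteqP; split => w /= h i; last by case: ifPn => // Qi; exact: h.
  by move=> Qi; move: (h i); rewrite Qi.
move=> -> => [|i]; last by case: ifP.
rewrite [RHS]big_mkcond; apply: eq_bigr => i _; case: ifP => // _.
exact: probability_setT.
Qed.

Lemma iidN_marginal (I : finType) (X : I -> T -> R) (i : I) (B : set R) :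
  iidN X -> measurable B -> P [set w | B (X i w)] = gauss B.
Proof.
move=> iX mB; have := @iidN_pred _ _ (fun=> B) (pred1 i) iX (fun=> mB).
rewrite big_pred1_eq => <-; congr (P _).
by apply/seteqP; split => w /= => [h j /eqP-> //|]; apply.
Qed.

Lemma iidN_reindex (I J : finType) (f : J -> I) (X : I -> T -> R) :
  injective f -> iidN X -> iidN (X \o f).
Proof.
move=> inj iX; have [mX _] := iX; split=> [j|B mB]; first exact: mX.
pose B' i := if [pick j | f j == i] is Some j then B j else setT.
have B'f j : B' (f j) = B j.
  by rewrite /B'; case: pickP => [k /eqP/inj ->//|/(_ j)]; rewrite eqxx.
have mB' i : measurable (B' i) by rewrite /B'; case: pickP.
have := @iidN_pred _ _ B' (mem (f @: [set: J]%SET)) iX mB'.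
have -> : [set w | forall i, i \in f @: [set: J]%SET -> B' i (X i w)] =
    [set w | forall j, B j ((X \o f) j w)].
  apply/seteqP; split => w /= h; first by move=> j; rewrite -B'f; apply: h; exact: imset_f.
  by move=> i /imsetP[j _ ->]; rewrite B'f; exact: h.
move=> ->; rewrite big_imset/=; last by move=> ? ? _ _; exact: inj.
by apply: eq_big => [j|j _]; rewrite ?inE// B'f.
Qed.

Lemma eq_iidN (I : finType) (X Y : I -> T -> R) :
  (forall i w, X i w = Y i w) -> iidN X -> iidN Y.
Proof.
by move=> XY; suff -> : X = Y by []; apply/funext => i; apply/funext => w.
Qed.

Definition rotate2 (I : finType) (a b : I) (c s : R) (X : I -> T -> R) : I -> T -> R :=
  fun i w => if i == a then c * X a w + s * X b w
             else if i == b then - s * X a w + c * X b w else X i w.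

(** Both sides are finite measures in [E] that agree on rectangles; the event on the remaining
    coordinates is carried along as a restriction of [P]. *)
Lemma iidN_pair_law (I : finType) (X : I -> T -> R) (a b : I) (B : I -> set R)
    (E : set (R * R)) :
  iidN X -> a != b -> (forall i, measurable (B i)) -> measurable E ->
  P ([set w | E (X a w, X b w)] `&`
     [set w | forall i, (i != a) && (i != b) -> B i (X i w)]) =
  ((\prod_(i | (i != a) && (i != b)) gauss (B i)) * (gauss \x gauss)%E E)%E.
Proof.
move=> iX ab mB; have [mX _] := iX.
set C := [set w | forall i, _ -> _].
have mC : measurable C by exact: measurable_forall_fin.
have PC : P C = (\prod_(i | (i != a) && (i != b)) gauss (B i))%E by exact: iidN_pred.
rewrite -PC.
pose R2 := (measurableTypeR R * measurableTypeR R)%type.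
pose phi : T -> R2 := fun w => (X a w, X b w).
have mphi : measurable_fun [set: T] phi.
  by apply: measurable_fun_pair; [exact: (mX a)|exact: (mX b)].
pose m1' := (pushforward (mrestr P mC) phi : {measure set R2 -> \bar R}).
pose m1 := m1' mphi.
have PC0 : 0 <= fine (P C) by rewrite fine_ge0.
pose m2 : {measure set R2 -> \bar R} := mscale (NngNum PC0) (gauss \x gauss)%E.
have key : forall E : set R2, measurable E -> m1 E = m2 E.
  apply: (measure_unique [set A `*` B | A in measurable & B in measurable] (fun=> setT)).
  - by rewrite measurable_prod_measurableType.
  - move=> _ _ [A1 mA1 [B1 mB1 <-]] [A2 mA2 [B2 mB2 <-]].
    exists (A1 `&` A2); first exact: measurableI.
    by exists (B1 `&` B2); [exact: measurableI|rewrite setXI].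
  - by move=> _; exists setT => //; exists setT => //; rewrite setXTT.
  - by rewrite bigcup_const//; exists 0%N.
  - move=> _ [A mA [B' mB' <-]].
    rewrite /m1 /m1' /m2 /= /mscale/= /pushforward/= /mrestr /=.
    rewrite product_measure1E//= fineK ?fin_num_measure// PC.
    pose D i := if i == a then A else if i == b then B' else B i.
    have -> : phi @^-1` (A `*` B') `&` C = [set w | forall i, D i (X i w)].
      apply/seteqP; split => w /=.
        move=> [[wA wB] wC] i; rewrite /D; case: eqP => [->//|/eqP ia].
        by case: eqP => [->//|/eqP ib]; apply: wC; rewrite ia ib.
      move=> wD; split; first by have := wD a; have := wD b; rewrite /D !eqxx eq_sym (negbTE ab).
      by move=> i /andP[ia ib]; have := wD i; rewrite /D (negbTE ia) (negbTE ib).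
    rewrite iX.2; last by move=> i; rewrite /D; case: ifP => // _; case: ifP.
    rewrite (bigD1 a)//= (bigD1 b) 1?eq_sym//= {1 2}/D !eqxx eq_sym (negbTE ab).
    rewrite muleA muleC; congr (_ * _)%E.
    by apply: eq_bigr => i /andP[ia ib]; rewrite /D (negbTE ia) (negbTE ib).
  - move=> _; apply: (@le_lt_trans _ _ 1%E); last exact: ltry.
    rewrite /m1 /m1'/= /pushforward/= /mrestr.
    by apply: probability_le1; rewrite preimage_setT setTI.
move=> mE; have := key E mE.
by rewrite /m1 /m1' /m2 /= /mscale/= /pushforward/= /mrestr fineK ?fin_num_measure.
Qed.

Lemma iidN_rotate2 (I : finType) (X : I -> T -> R) (a b : I) (c s : R) :
  iidN X -> a != b -> c ^+ 2 + s ^+ 2 = 1 -> s != 0 -> iidN (rotate2 a b c s X).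
Proof.
move=> iX ab cs s0; have [mX _] := iX; split=> [i|B mB].
  rewrite /rotate2; case: eqP => _.
    by apply: measurable_funD; exact: measurable_funM.
  by case: eqP => // _; apply: measurable_funD; exact: measurable_funM.
pose E := [set z : R * R | (B a `*` B b) (c * z.1 + s * z.2, - s * z.1 + c * z.2)].
have mE : measurable E.
  have mrot : measurable_fun [set: R * R]
      (fun z : R * R => (c * z.1 + s * z.2, - s * z.1 + c * z.2)).
    by apply/measurable_fun_pair => //=; apply: measurable_funD => //; exact: measurable_funM.
  by rewrite -[E]setTI; apply: mrot => //; exact: measurableX.
have := iidN_pair_law iX ab mB mE.
have -> : [set w | E (X a w, X b w)] `&`
     [set w | forall i, (i != a) && (i != b) -> B i (X i w)] =
    [set w | forall i, B i (rotate2 a b c s X i w)].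
  apply/seteqP; split => w /=; rewrite /rotate2.
    move=> [[/= wA wB] wC] i; case: eqP => [->//|/eqP ia].
    by case: eqP => [->//|/eqP ib]; apply: wC; rewrite ia ib.
  move=> wB; split; first by have := wB a; have := wB b; rewrite !eqxx eq_sym (negbTE ab).
  by move=> i /andP[ia ib]; have := wB i; rewrite (negbTE ia) (negbTE ib).
move=> ->; rewrite (gauss_prod_rotation cs s0)//; last exact: measurableX.
rewrite product_measure1E; [|exact: mB|exact: mB].
by rewrite [RHS](bigD1 a)//= [in RHS](bigD1 b) 1?eq_sym//= [in RHS]muleA muleC.
Qed.

Lemma iidN_opp (I : finType) (X : I -> T -> R) (a : I) :
  iidN X -> iidN (fun i w => if i == a then - X a w else X i w).
Proof.
move=> [mX iX]; split=> [i|B mB].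
  by case: eqP => _; [exact: measurableT_comp|exact: mX].
pose D i := if i == a then [set x | B a (- x)] else B i.
have mD i : measurable (D i).
  rewrite /D; case: eqP => // _.
  by rewrite -[X in measurable X]setTI; exact: (@oppr_measurable R setT).
have := iX D mD.
have -> : [set w | forall i, D i (X i w)] =
    [set w | forall i, B i (if i == a then - X a w else X i w)].
  apply/seteqP; split => w /= h i; have := h i; rewrite /D.
    by case: eqP => // ->.
  by case: eqP => // ->.
move=> ->; apply: eq_bigr => i _; rewrite /D; case: eqP => [->|//].
exact: gauss_opp.
Qed.

End iid_gaussian.

(** * Reflections of Gaussian families *)

Section reflections.
Context {R : realType} {d : measure_display} {T : measurableType d}.
Variable P : probability T R.

(* For [h = 0] the quotient is [0] and the reflection is the identity. *)
Definition reflect_along (I : finType) (h : I -> R) (X : I -> T -> R) : I -> T -> R :=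
  fun i w => X i w - 2 * (\sum_m h m * X m w) / (\sum_m h m ^+ 2) * h i.

(** The rotation takes [(h a, h b)] to [(r, 0)]. A reflection depends on its vector only through the
    inner product with [X] and the squared length, which the rotation preserves. *)
Lemma reflect_along_conj (I : finType) (h : I -> R) (X : I -> T -> R) (a b : I) :
  a != b -> h a != 0 ->
  let r := Num.sqrt (h a ^+ 2 + h b ^+ 2) in
  let h' i := if i == a then r else if i == b then 0 else h i in
  forall i w, reflect_along h X i w =
    rotate2 a b (h a / r) (- (h b / r)) (reflect_along h' (rotate2 a b (h a / r) (h b / r) X)) i w.
Proof.
move=> ab ha0 r h' i w.
have r2 : r ^+ 2 = h a ^+ 2 + h b ^+ 2 by rewrite sqr_sqrtr// addr_ge0// sqr_ge0.
have r0 : r != 0.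
  by rewrite gt_eqF// sqrtr_gt0 ltr_pwDl ?sqr_ge0// exprn_even_gt0.
have ba : b != a by rewrite eq_sym.
have cs : (h a / r) ^+ 2 + (h b / r) ^+ 2 = 1.
  by rewrite !expr_div_n -mulrDl r2 divff// -r2 expf_neq0.
have sumE (f g : I -> R) : (forall j, j != a -> j != b -> f j = g j) ->
    f a + f b = g a + g b -> \sum_j f j = \sum_j g j.
  move=> fg fgab; rewrite (bigD1 a)//= (bigD1 b)//= [RHS](bigD1 a)//= [in RHS](bigD1 b)//=.
  rewrite !addrA fgab; congr (_ + _); apply: eq_bigr => j /andP[]; exact: fg.
have S1 : \sum_m h' m * rotate2 a b (h a / r) (h b / r) X m w = \sum_m h m * X m w.
  apply: sumE => [j ja jb|]; rewrite /h' /rotate2.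
    by rewrite (negbTE ja) (negbTE jb).
  by rewrite !eqxx (negbTE ba); field.
have S2 : \sum_m h' m ^+ 2 = \sum_m h m ^+ 2.
  apply: sumE => [j ja jb|]; rewrite /h'.
    by rewrite (negbTE ja) (negbTE jb).
  by rewrite !eqxx (negbTE ba) r2; ring.
rewrite {1}/rotate2 /reflect_along S1 S2.
set k := 2 * _ / _.
rewrite /h' /rotate2 !eqxx (negbTE ba).
case: eqP => [->|_].
  transitivity (((h a / r) ^+ 2 + (h b / r) ^+ 2) * X a w - k * h a); last by field.
  by rewrite cs mul1r.
case: eqP => [->|//].
transitivity (((h a / r) ^+ 2 + (h b / r) ^+ 2) * X b w - k * h b); last by field.
by rewrite cs mul1r.
Qed.

(* Conjugating by a plane rotation shrinks the support of [h]; once a single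
   coordinate is left, the reflection is a change of sign. *)
Lemma iidN_reflect_along (I : finType) (h : I -> R) (X : I -> T -> R) :
  iidN P X -> iidN P (reflect_along h X).
Proof.
have [n] := ubnP #|[pred i | h i != 0]|.
elim: n h X => // n IHn h X; rewrite ltnS => hn iX.
have [/existsP[a ha0]|] := boolP [exists a, h a != 0]; last first.
  rewrite negb_exists => /forallP h0; apply: eq_iidN iX => i w.
  by have /negPn/eqP hi := h0 i; rewrite /reflect_along hi mulr0 subr0.
have [/existsP[b /andP[ba hb0]]|] := boolP [exists b, (b != a) && (h b != 0)].
  have ab : a != b by rewrite eq_sym.
  have hab : 0 < h a ^+ 2 + h b ^+ 2 by rewrite ltr_pwDl ?sqr_ge0// exprn_even_gt0.
  set r := Num.sqrt (h a ^+ 2 + h b ^+ 2).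
  have r0 : r != 0 by rewrite gt_eqF// sqrtr_gt0.
  have cs : (h a / r) ^+ 2 + (h b / r) ^+ 2 = 1.
    by rewrite !expr_div_n -mulrDl sqr_sqrtr ?divff ?gt_eqF// ltW.
  apply: (eq_iidN (fun i w => esym (reflect_along_conj X ab ha0 i w))).
  apply: iidN_rotate2 => //; [|by rewrite sqrrN|by rewrite oppr_eq0 mulf_neq0// invr_eq0].
  apply: IHn; last by apply: iidN_rotate2 => //; rewrite mulf_neq0// invr_eq0.
  apply: leq_trans hn; apply: proper_card; apply/properP; split.
    apply/fintype.subsetP => i; rewrite !inE.
    have [->//|ia] := eqVneq i a; have [_|//] := eqVneq i b; by rewrite eqxx.
  by exists b; rewrite !inE//= (negbTE ba) !eqxx.
rewrite negb_exists => /forallP h0.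
apply: eq_iidN (iidN_opp a iX) => i w; rewrite /reflect_along.
have h00 j : j != a -> h j = 0.
  by move=> ja; have := h0 j; rewrite ja /= negbK => /eqP.
rewrite (bigD1 a)//= big1 ?addr0; last by move=> j ja; rewrite h00// mul0r.
rewrite (bigD1 a)//= big1 ?addr0; last by move=> j ja; rewrite h00// expr0n.
case: eqP => [->|/eqP ia]; first by field.
by rewrite (h00 _ ia) mulr0 subr0.
Qed.

(** Reflecting one block amounts to reflecting the whole family along [h] placed in that block and
    extended by 0. The induction runs over the list of blocks already reflected. *)
Lemma iidN_reflect_blocks (K I : finType) (h : I -> R) (X : K * I -> T -> R) :
  iidN P X ->
  iidN P (fun ki w => reflect_along h (fun i => X (ki.1, i)) ki.2 w).
Proof.
move=> iX.
suff H (s : seq K) : uniq s -> iidN P (fun ki w => if ki.1 \in s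
    then reflect_along h (fun i => X (ki.1, i)) ki.2 w else X ki w).
  by apply: eq_iidN (H (enum K) (enum_uniq K)) => -[k i] w; rewrite mem_enum.
elim: s => [_|k0 s IHs /= /andP[k0s us]]; first by apply: eq_iidN iX.
pose h0 (ki : K * I) := if ki.1 == k0 then h ki.2 else 0.
apply: eq_iidN (iidN_reflect_along h0 (IHs us)) => -[k i] w /=.
have sumE (F : I -> R) (G : K * I -> R) : (forall i, G (k0, i) = F i) ->
    (forall ki, ki.1 != k0 -> G ki = 0) -> \sum_ki G ki = \sum_i F i.
  move=> GF G0; rewrite (eq_bigr (fun ki : K * I => G (ki.1, ki.2))); last by case.
  rewrite -(pair_bigA _ (fun k i => G (k, i)))/= (bigD1 k0)//= [X in _ + X]big1 ?addr0.
    exact: eq_bigr.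
  by move=> k' k'0; apply: big1 => j _; exact: G0.
rewrite {1}/reflect_along.
rewrite (sumE (fun m => h m * X (k0, m) w)); first last.
- by move=> [k' m] /= k'0; rewrite /h0 (negbTE k'0) mul0r.
- by move=> m; rewrite /h0 /= eqxx (negbTE k0s).
rewrite (sumE (fun m => h m ^+ 2)); first last.
- by move=> [k' m] /= k'0; rewrite /h0 (negbTE k'0) expr0n.
- by move=> m; rewrite /h0 /= eqxx.
rewrite /h0 /= in_cons; case: eqP => [->|_] /=; first by rewrite (negbTE k0s).
by rewrite mulr0 subr0.
Qed.

(* The reflection exchanging the unit vector [e] with the basis vector [i0]
   sends the coordinate [i0] to the combination with coefficients [e]. *)
Lemma reflect_along_unit (I : finType) (e : I -> R) (i0 : I) (X : I -> T -> R) w :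
  \sum_i e i ^+ 2 = 1 ->
  reflect_along (fun i => e i - (i == i0)%:R) X i0 w = \sum_i e i * X i w.
Proof.
move=> e1; pose h i := e i - (i == i0)%:R; rewrite /reflect_along -/h.
have Q : \sum_m h m ^+ 2 = 2 - 2 * e i0.
  rewrite (eq_bigr (fun m => e m ^+ 2 + (m == i0)%:R * (1 - 2 * e m))).
    rewrite big_split/= e1 (bigD1 i0)//= eqxx mul1r big1 ?addr0; first by ring.
    by move=> i /negbTE->; rewrite mul0r.
  by move=> i _; rewrite /h; case: (i == i0); rewrite ?(mulr1n, mulr0n); ring.
have S : \sum_m h m * X m w = \sum_m e m * X m w - X i0 w.
  rewrite (eq_bigr (fun m => e m * X m w - (m == i0)%:R * X m w)); last first.
    by move=> i _; rewrite mulrBl.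
  rewrite sumrB [X in _ - X](bigD1 i0)//= eqxx mul1r [X in _ - (_ + X)]big1 ?addr0//.
  by move=> i /negbTE->; rewrite mul0r.
have [Q0|Q0] := eqVneq (\sum_m h m ^+ 2) 0.
  have h0 m : h m = 0.
    have /eqP := Q0; rewrite psumr_eq0; last by move=> *; exact: sqr_ge0.
    by move=> /allP/(_ m); rewrite mem_index_enum => /(_ isT); rewrite sqrf_eq0 => /eqP.
  rewrite -/(h i0) h0 mulr0 subr0; apply/esym/eqP; rewrite -subr_eq0 -S.
  by apply/eqP; apply: big1 => m _; rewrite h0 mul0r.
have Q1 : 2 - 2 * e i0 != 0 by rewrite -Q.
by rewrite -/(h i0) -/(\sum_m h m * X m w) -/(\sum_m h m ^+ 2) S Q /h eqxx mulr1n; field.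
Qed.

(** A reflection makes each combination the coordinate [i0] of its block, and a subfamily of an
    i.i.d. family is i.i.d. *)
Lemma iidN_unit_comb (I K : finType) (e : I -> R) (X : K * I -> T -> R) :
  \sum_i e i ^+ 2 = 1 -> iidN P X ->
  iidN P (fun k w => \sum_i e i * X (k, i) w).
Proof.
move=> e1 iX.
(* An empty sum is 0, so the unit length of [e] provides an index. *)
have [i0] : exists i0 : I, true.
  apply: contrapT => noI; move: e1; rewrite big1 => [/eqP|i _].
    by rewrite eq_sym oner_eq0.
  by case: noI; exists i.
move=> _; pose h i := e i - (i == i0)%:R.
have inj : injective (fun k : K => (k, i0)) by move=> k k' [].
apply: eq_iidN (iidN_reindex inj (iidN_reflect_blocks h iX)) => k w /=.
exact: reflect_along_unit.
Qed.

End reflections.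

(** * Independence of disjoint subfamilies and Fubini's theorem *)

Section independence_and_fubini.
Context {R : realType} {d : measure_display} {T : measurableType d}.
Variable P : probability T R.
Notation gauss := (@normal_prob R 0 1).

(** A pi-system generating the sigma-algebra of the coordinates selected by [Q]; the values of [B]
    outside [Q] do not constrain anything. *)
Definition boxes (I : finType) (X : I -> T -> R) (Q : pred I) : set (set T) :=
  [set A | exists2 B : I -> set R, (forall i, measurable (B i)) &
     A = [set w | forall i, Q i -> B i (X i w)]].

Lemma boxes_setI (I : finType) (X : I -> T -> R) Q : setI_closed (boxes X Q).
Proof.
move=> _ _ [B mB ->] [C mC ->]; exists (fun i => B i `&` C i).
  by move=> i; exact: measurableI.
apply/seteqP; split => w /=.
  by move=> [wB wC] i Qi; split; [exact: wB|exact: wC].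
by move=> h; split => i Qi; have [] := h i Qi.
Qed.

Lemma boxes_setT (I : finType) (X : I -> T -> R) Q : boxes X Q setT.
Proof. by exists (fun=> setT) => //; apply/seteqP; split. Qed.

Lemma boxes_measurable (I : finType) (X : I -> T -> R) Q :
  (forall i, measurable_fun [set: T] (X i)) -> boxes X Q `<=` measurable.
Proof. by move=> mX _ [B mB ->]; exact: measurable_forall_fin. Qed.

Lemma sigma_boxes_measurable (I : finType) (X : I -> T -> R) Q :
  (forall i, measurable_fun [set: T] (X i)) -> <<s boxes X Q >> `<=` measurable.
Proof.
move=> mX; apply: smallest_sub; last exact: boxes_measurable.
exact: sigma_algebra_measurable.
Qed.

Lemma measurable_fun_boxes (I : finType) (X : I -> T -> R) (Q : pred I) i : Q i ->
  measurable_fun [set: g_sigma_algebraType (boxes X Q)] (X i).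
Proof.
move=> Qi _ B mB; rewrite setTI; apply: sub_sigma_algebra.
exists (fun j => if j == i then B else setT); first by move=> j; case: ifP.
apply/seteqP; split => w /=; first by move=> wB j Qj; case: eqP => [->|].
by move=> /(_ i Qi); rewrite eqxx.
Qed.

(* The pi-lambda theorem, once in each variable. *)
Lemma indep_sigma (G1 G2 : set (set T)) :
  G1 `<=` measurable -> G2 `<=` measurable -> setI_closed G1 -> setI_closed G2 ->
  G1 setT -> G2 setT ->
  (forall A B, G1 A -> G2 B -> P (A `&` B) = (P A * P B)%E) ->
  forall A B, <<s G1 >> A -> <<s G2 >> B -> P (A `&` B) = (P A * P B)%E.
Proof.
move=> m1 m2 I1 I2 T1 T2 H.
have key (G : set (set T)) (B : set T) : G `<=` measurable -> setI_closed G -> G setT ->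
    measurable B -> (forall A, G A -> P (A `&` B) = (P A * P B)%E) ->
    forall A, <<s G >> A -> P (A `&` B) = (P A * P B)%E.
  move=> mG IG TG mB GB A sA.
  have PB0 : 0 <= fine (P B) by rewrite fine_ge0.
  pose n1 : {measure set T -> \bar R} := mrestr P mB.
  pose n2 : {measure set T -> \bar R} := mscale (NngNum PB0) P.
  have -> : (P A * P B)%E = n2 A.
    by rewrite /n2 /= /mscale /= fineK ?fin_num_measure// muleC.
  apply: (@g_sigma_algebra_measure_unique _ _ _ G mG (fun=> setT) _ _ n1 n2) => //.
  - by rewrite bigcup_const//; exists 0%N.
  - by move=> C GC; rewrite /n1 /n2 /= /mrestr /mscale /= fineK ?fin_num_measure// GB// muleC.
  - move=> _; rewrite /n1 /= /mrestr setTI; apply: le_lt_trans (ltry 1).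
    exact: probability_le1.
have sm (G : set (set T)) : G `<=` measurable -> <<s G >> `<=` measurable.
  by move=> mG; apply: smallest_sub => //; exact: sigma_algebra_measurable.
move=> A B sA sB.
apply: (key G1 B) => //; first exact: (sm _ m2).
move=> A' GA'; rewrite setIC [RHS]muleC.
apply: (key G2 A') => //; first exact: m1.
by move=> B' GB'; rewrite setIC [RHS]muleC; exact: H.
Qed.

Lemma iidN_indep (I : finType) (X : I -> T -> R) (Q : pred I) A B : iidN P X ->
  <<s boxes X Q >> A -> <<s boxes X (predC Q) >> B -> P (A `&` B) = (P A * P B)%E.
Proof.
move=> iX; have [mX _] := iX.
apply: indep_sigma; try exact: boxes_measurable; try exact: boxes_setI; try exact: boxes_setT.
move=> _ _ [B1 mB1 ->] [B2 mB2 ->].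
pose C i := if Q i then B1 i else B2 i.
have mC i : measurable (C i) by rewrite /C; case: ifP.
rewrite !(iidN_pred _ iX)//.
have -> : [set w | forall i, Q i -> B1 i (X i w)] `&`
    [set w | forall i, predC Q i -> B2 i (X i w)] = [set w | forall i, C i (X i w)].
  apply/seteqP; split => w /=.
    by move=> [h1 h2] i; rewrite /C; case: ifPn; [exact: h1|exact: h2].
  by move=> h; split => i Qi; have := h i; rewrite /C; [rewrite Qi|rewrite (negbTE Qi)].
rewrite iX.2// (bigID Q)/=; congr (_ * _)%E; apply: eq_bigr => i Qi; rewrite /C.
  by rewrite Qi.
by rewrite (negbTE Qi).
Qed.

Local Open Scope ereal_scope.

Lemma fubini_indep d1 d2 (T1 : measurableType d1) (T2 : measurableType d2)
    (A : {mfun T >-> T1}) (B : {mfun T >-> T2}) (f : T1 * T2 -> \bar R) :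
  (forall E F, measurable E -> measurable F ->
    P (A @^-1` E `&` B @^-1` F) = P (A @^-1` E) * P (B @^-1` F)) ->
  measurable_fun setT f -> (forall z, 0 <= f z) ->
  \int[P]_w f (A w, B w) = \int[P]_w \int[P]_w' f (A w, B w').
Proof.
move=> indep mf f0.
have mAB : measurable_fun [set: T] (fun w => (A w, B w)).
  by apply: measurable_fun_pair; exact: measurable_funP.
pose ABM := isMeasurableFun.Build _ _ T (T1 * T2)%type _ mAB.
pose AB : {mfun T >-> (T1 * T2)%type} := HB.pack (fun w => (A w, B w)) ABM.
transitivity (\int[distribution P AB]_z f z).
  by rewrite ge0_integral_distribution.
transitivity (\int[distribution P A \x distribution P B]_z f z).
  apply: eq_measure_integral => E mE _; apply/esym.
  by apply: product_measure_unique => // A1 B1 mA1 mB1; exact: indep.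
rewrite fubini_tonelli1// /fubini_F ge0_integral_distribution//; last first.
- by move=> x; exact: integral_ge0.
- exact: measurable_fun_fubini_tonelli_F.
apply: eq_integral => w _ /=; rewrite ge0_integral_distribution//.
by apply: measurableT_comp => //; exact: pair1_measurable.
Qed.

(** The identity of [T], seen through the sigma-algebra of the coordinates in [Q] and through that
    of the others, gives two independent random elements. [f] can thus mix arbitrary functions of
    the two groups. *)
Lemma iidN_fubini (I : finType) (X : I -> T -> R) (Q : pred I)
    (f : g_sigma_algebraType (boxes X Q) * g_sigma_algebraType (boxes X (predC Q)) -> \bar R) :
  iidN P X -> measurable_fun setT f -> (forall z, 0 <= f z) ->
  \int[P]_w f (w, w) = \int[P]_w \int[P]_w' f (w, w').
Proof.
move=> iX mf f0; have [mX _] := iX.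
have mid S : measurable_fun [set: T] (idfun : T -> g_sigma_algebraType (boxes X S)).
  by move=> _ A sA; rewrite setTI; exact: sigma_boxes_measurable sA.
pose aM := isMeasurableFun.Build _ _ T (g_sigma_algebraType (boxes X Q)) _ (mid Q).
pose a : {mfun T >-> g_sigma_algebraType (boxes X Q)} := HB.pack idfun aM.
pose bM := isMeasurableFun.Build _ _ T (g_sigma_algebraType (boxes X (predC Q))) _ (mid (predC Q)).
pose b : {mfun T >-> g_sigma_algebraType (boxes X (predC Q))} := HB.pack idfun bM.
by apply: (@fubini_indep _ _ _ _ a b f) => // E F mE mF; exact: (iidN_indep iX mE mF).
Qed.

Lemma iidN_integral_marginal (I : finType) (X : I -> T -> R) (i : I) (f : R -> \bar R) :
  iidN P X -> measurable_fun setT f -> (forall x, 0 <= f x) ->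
  \int[P]_w f (X i w) = \int[gauss]_x f x.
Proof.
move=> iX mf f0; have [mX _] := iX.
have e := @ge0_integral_pushforward _ _ T (measurableTypeR R) _ _ (mX i) P setT f.
apply: etrans (esym (e measurableT mf (in1W f0))) _.
apply: eq_measure_integral; first exact: mX.
by move=> mXi A mA _; exact: (iidN_marginal i iX mA).
Qed.

Lemma iidN_integral_prod (I : finType) (X : I -> T -> R) (f : I -> R -> R) :
  iidN P X -> (forall i, measurable_fun setT (f i)) -> (forall i x, (0 <= f i x)%R) ->
  \int[P]_w (\prod_i f i (X i w))%R%:E = \prod_i \int[gauss]_x (f i x)%:E.
Proof.
move=> iX mf f0.
suff H (s : seq I) : uniq s -> \int[P]_w (\prod_(i <- s) f i (X i w))%R%:E =
    \prod_(i <- s) \int[gauss]_x (f i x)%:E by exact: (H _ (index_enum_uniq I)).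
elim: s => [_|i s IHs /= /andP[si us]].
  rewrite big_nil; under eq_integral do rewrite big_nil.
  by rewrite integral_cst//= mul1e probability_setT.
rewrite big_cons -IHs//.
pose Q := pred1 i.
pose T1 := g_sigma_algebraType (boxes X Q).
pose T2 := g_sigma_algebraType (boxes X (predC Q)).
pose g (z : T1 * T2) := (f i (X i z.1) * \prod_(j <- s) f j (X j z.2))%:E.
have mg2 : measurable_fun [set: T2] (fun w => \prod_(j <- s) f j (X j w))%R.
  apply: measurable_prod => j js; apply: measurableT_comp => //.
  by apply: measurable_fun_boxes => /=; apply: contraNneq si => <-.
have mg1 : measurable_fun [set: T1] (fun w => f i (X i w)).
  by apply: measurableT_comp => //; apply: measurable_fun_boxes => /=.
have p0 w : (0 <= \prod_(j <- s) f j (X j w))%R by apply: prodr_ge0.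
transitivity (\int[P]_w g (w, w)).
  by apply: eq_integral => w _; rewrite big_cons.
rewrite (iidN_fubini iX) => [| |z]; last by rewrite /g lee_fin mulr_ge0.
  have mps : measurable_fun [set: T] (fun w => (\prod_(j <- s) f j (X j w))%R%:E).
    apply/measurable_EFinP; apply: measurable_prod => j js.
    by apply: measurableT_comp => //; exact: iX.1.
  transitivity (\int[P]_w ((f i (X i w))%:E * \int[P]_w' (\prod_(j <- s) f j (X j w'))%R%:E)).
    apply: eq_integral => w _; rewrite /g /=.
    by rewrite -[RHS]ge0_integralZl// => *; rewrite lee_fin.
  rewrite ge0_integralZr//.
  - congr (_ * _); apply: (@iidN_integral_marginal _ _ i (fun x => (f i x)%:E) iX).
      exact/measurable_EFinP.
    by move=> x; rewrite lee_fin.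
  - by apply/measurable_EFinP; apply: measurableT_comp => //; exact: iX.1.
  - by move=> *; rewrite lee_fin.
  - by apply: integral_ge0 => w _; rewrite lee_fin.
apply/measurable_EFinP; apply: measurable_funM.
  exact: (measurableT_comp mg1).
exact: (measurableT_comp mg2).
Qed.

End independence_and_fubini.

(** * The Gaussian families of the regression model *)

Section regression_families.
Context {R : realType} {d : measure_display} {T : measurableType d}.
Variable P : probability T R.
Notation gauss := (@normal_prob R 0 1).

(** The noise becomes an extra column [None], so that a row is a vector of R^(p+1) on which
    reflections can mix design and noise. *)
Definition design_noise (n p : nat) (X : 'I_n -> 'I_p -> {RV P >-> R}) (xi : 'I_n -> {RV P >-> R}) :
    'I_n * option 'I_p -> T -> R :=
  fun io => if io.2 is Some j then X io.1 j : T -> R else xi io.1.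

Lemma sigma_generated_forall (I : finType) (X : I -> {RV P >-> R}) (B : I -> set R) :
  (forall i, measurable (B i)) -> sigma_generated X [set w | forall i, B i (X i w)].
Proof.
move=> mB; pose G := [set X i @^-1` B | i in [set: I] & B in measurable].
have -> : [set w | forall i, B i (X i w)] = \bigcap_(i in [set: I]) (X i @^-1` B i).
  by apply/seteqP; split => w /= h i; [move=> _|]; exact: h.
apply: (@fin_bigcap_measurable _ (g_sigma_algebraType G)); first exact: finite_finset.
by move=> i _; apply: sub_sigma_algebra; exists i => //; exists (B i) => //; exact: mB.
Qed.

Lemma iidN_design_noise (n p : nat) (X : 'I_n -> 'I_p -> {RV P >-> R})
    (xi : 'I_n -> {RV P >-> R}) :
  gaussian_design X -> gaussian_noise X xi -> iidN P (design_noise X xi).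
Proof.
move=> /iid_std_gaussian_iidN iX [/iid_std_gaussian_iidN ixi ind].
split=> [[i [j|]]|B mB]; [exact: measurable_funP|exact: measurable_funP|].
have := ind _ _ (@sigma_generated_forall _ xi (fun i => B (i, None)) (fun i => mB _))
  (@sigma_generated_forall _ (fun ij : 'I_n * 'I_p => X ij.1 ij.2)
     (fun ij => B (ij.1, Some ij.2)) (fun ij => mB _)).
have e1 : P [set w | forall i, B (i, None) (xi i w)] = (\prod_i gauss (B (i, None)))%E :=
  ixi.2 _ (fun i => mB (i, None)).
have e2 : P [set w | forall ij : 'I_n * 'I_p, B (ij.1, Some ij.2) (X ij.1 ij.2 w)] =
    (\prod_(ij : 'I_n * 'I_p) gauss (B (ij.1, Some ij.2)))%E :=
  iX.2 (fun ij => B (ij.1, Some ij.2)) (fun ij => mB _).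
rewrite e1 e2.
set A := _ `&` _; have -> : A = [set w | forall i, B i (design_noise X xi i w)].
  apply/seteqP; split => w /=.
    by move=> [h1 h2] [i [j|]]; [exact: (h2 (i, j))|exact: h1].
  by move=> h; split => [i|[i j]]; [exact: (h (i, None))|exact: (h (i, Some j))].
move=> ->; rewrite (eq_bigr (fun io : 'I_n * option 'I_p => gauss (B (io.1, io.2)))); last by case.
rewrite -(pair_bigA _ (fun i o => gauss (B (i, o))))/=.
rewrite -(pair_bigA _ (fun i j => gauss (B (i, Some j))))/= -big_split/=.
apply: eq_bigr => i _; rewrite [RHS](bigD1 None)//=; congr (_ * _)%E.
rewrite (reindex_omap Some id) => [|[j|]//].
by apply: eq_bigl => j; rewrite eqxx.
Qed.

(* The basis vector makes this a unit vector also where the noise vanishes. *)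
Definition noise_dir (I J : finType) (i0 : I) (G : I * option J -> T -> R) (i : I) (w : T) : R :=
  if \sum_k G (k, None) w ^+ 2 == 0 then (i == i0)%:R
  else G (i, None) w / Num.sqrt (\sum_k G (k, None) w ^+ 2).

Definition projections (I J : finType) (i0 : I) (G : I * option J -> T -> R) (j : J) (w : T) : R :=
  \sum_i noise_dir i0 G i w * G (i, Some j) w.

Lemma noise_dir_unit (I J : finType) (i0 : I) (G : I * option J -> T -> R) w :
  \sum_i noise_dir i0 G i w ^+ 2 = 1.
Proof.
rewrite /noise_dir; case: eqP => [_|/eqP S0].
  rewrite (bigD1 i0)//= eqxx expr1n big1 ?addr0// => i /negbTE->.
  by rewrite expr0n.
have Sge0 : 0 <= \sum_k G (k, None) w ^+ 2 by apply: sumr_ge0 => *; exact: sqr_ge0.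
under eq_bigr do rewrite expr_div_n.
by rewrite -mulr_suml sqr_sqrtr// divff.
Qed.

(** Once the [None] column is frozen by Fubini, its direction is a fixed unit vector and
    [iidN_unit_comb] applies. The resulting law does not depend on that direction, so integrating
    over it changes nothing. *)
Lemma iidN_projections (I J : finType) (i0 : I) (G : I * option J -> T -> R) :
  iidN P G -> iidN P (projections i0 G).
Proof.
move=> iG; have [mG _] := iG.
pose Q := [pred io : I * option J | io.2 == None].
pose T1 := g_sigma_algebraType (boxes G Q).
pose T2 := g_sigma_algebraType (boxes G (predC Q)).
have mdir d' (T' : measurableType d') (G' : I * option J -> T' -> R) (i : I) :
    (forall k, measurable_fun [set: T'] (G' (k, None))) ->
    measurable_fun [set: T'] (fun w => if \sum_k G' (k, None) w ^+ 2 == 0 then (i == i0)%:R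
      else G' (i, None) w / Num.sqrt (\sum_k G' (k, None) w ^+ 2) : R).
  move=> mG'.
  have mS : measurable_fun [set: T'] (fun w => \sum_k G' (k, None) w ^+ 2).
    by apply: measurable_sum => k; exact: measurable_funX.
  apply: measurable_fun_ifT => //; first exact: measurable_fun_eqr.
  apply: measurable_funM => //.
  have -> : (fun w => (Num.sqrt (\sum_k G' (k, None) w ^+ 2))^-1) =
      (fun w => (\sum_k G' (k, None) w ^+ 2) `^ (- 2^-1)).
    apply/funext => w; rewrite powRN powR12_sqrt//.
    by apply: sumr_ge0 => *; exact: sqr_ge0.
  exact: (measurableT_comp (measurable_powR _)).
have mz j : measurable_fun [set: T] (projections i0 G j).
  apply: measurable_sum => i; apply: measurable_funM => //.
  by apply: (mdir _ T G).
split=> // B mB.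
pose F (z : T1 * T2) j := \sum_i noise_dir i0 G i z.1 * G (i, Some j) z.2.
have mF j : measurable_fun [set: T1 * T2] (fun z => F z j).
  apply: measurable_sum => i; apply: measurable_funM.
    have m1 : measurable_fun [set: T1] (noise_dir i0 G i).
      by apply: (mdir _ T1 G) => k; exact: measurable_fun_boxes.
    exact: (measurableT_comp m1).
  have m2 : measurable_fun [set: T2] (G (i, Some j)) by exact: measurable_fun_boxes.
  exact: (measurableT_comp m2).
pose D : set (T1 * T2) := [set z | forall j, B j (F z j)].
have mD : measurable D.
  have -> : D = \bigcap_(j in [set: J]) ((fun z => F z j) @^-1` B j).
    by apply/seteqP; split => z /= h j; [move=> _|]; exact: h.
  apply: fin_bigcap_measurable; first exact: finite_finset.
  by move=> j _; rewrite -[X in measurable X]setTI; exact: mF.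
pose f (z : T1 * T2) : \bar R := (\1_D z)%:E.
have mf : measurable_fun setT f by apply/measurable_EFinP; exact: measurable_indic.
have fub := iidN_fubini iG mf (fun z => _ : 0 <= f z)%E.
have mA : measurable [set w | forall j, B j (projections i0 G j w)].
  by have := @measurable_forall_fin R d T J _ B predT mz mB; congr measurable; apply/seteqP; split => w /= h j; [exact: h|move=> _; exact: h].
transitivity (\int[P]_w f (w, w))%E.
  rewrite -[X in P X]setIT -integral_indic//; apply: eq_integral => w _.
rewrite fub; last by move=> z; rewrite lee_fin.
transitivity (\int[P]_w (cst (\prod_j gauss (B j))%E w))%E; last first.
  by rewrite integral_cst//= probability_setT mule1.
apply: eq_integral => w _ /=.
pose X (ji : J * I) := G (ji.2, Some ji.1).
have iX : iidN P X.
  have inj : injective (fun ji : J * I => (ji.2, Some ji.1)) by move=> [a b] [a' b'] [-> ->].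
  exact: eq_iidN (iidN_reindex inj iG).
have := (iidN_unit_comb (noise_dir_unit i0 G w) iX).2 B mB.
move=> <-; rewrite -[X in P X]setIT -integral_indic//; last first.
  have mU := (iidN_unit_comb (noise_dir_unit i0 G w) iX).1.
  by have := @measurable_forall_fin R d T J _ B predT mU mB; congr measurable; apply/seteqP; split => w' /= h j; [exact: h|move=> _; exact: h].
Qed.

Lemma prob_le_integral (A : set T) (f : T -> R) : measurable A ->
  measurable_fun [set: T] f -> (forall w, 0 <= f w) -> (forall w, A w -> 1 <= f w) ->
  (P A <= \int[P]_w (f w)%:E)%E.
Proof.
move=> mA mf f0 f1; rewrite -[X in P X]setIT -integral_indic//.
apply: ge0_le_integral => //.
- by apply/measurable_EFinP; exact: measurable_indic.
- exact/measurable_EFinP.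
- move=> w _; rewrite lee_fin indicE; have [/set_mem/f1//|_] := boolP (w \in A).
  exact: f0.
Qed.

(** Markov's inequality for the exponential of [- l] times the sum of squares. *)
Lemma chi2_lower_tail (I : finType) (X : I -> T -> R) (l c : R) : iidN P X -> 0 <= l ->
  (P [set w | (\sum_i X i w ^+ 2 <= c)%R] <=
   (expR (l * c) * (Num.sqrt (1 + 2 * l))^-1 ^+ #|I|)%:E)%E.
Proof.
move=> iX l0; have [mX _] := iX.
have mS : measurable_fun [set: T] (fun w => \sum_i X i w ^+ 2).
  by apply: measurable_sum => k; exact: measurable_funX.
have mg : measurable_fun [set: R] (fun x : R => expR (- (l * x ^+ 2))).
  apply: measurableT_comp => //; apply: measurableT_comp => //.
  by apply: measurable_funM => //; exact: measurable_funX.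
have mprod : measurable_fun [set: T] (fun w => \prod_i expR (- (l * X i w ^+ 2))).
  by apply: measurable_prod => i _; exact: (measurableT_comp mg).
apply: (@le_trans _ _ (\int[P]_w (expR (l * c) * \prod_i expR (- (l * X i w ^+ 2)))%:E)%E).
  apply: prob_le_integral.
  - have := mS measurableT `]-oo, c]%classic (measurable_itv _).
    by rewrite setTI; congr measurable; apply/seteqP; split => w /=; rewrite in_itv.
  - exact: measurable_funM.
  - by move=> w; rewrite mulr_ge0 ?expR_ge0// prodr_ge0// => i _; rewrite expR_ge0.
  - move=> w /= Sc; rewrite -expR_sum -expRD -[leLHS]expR0 ler_expR sumrN -mulr_sumr -mulrBr.
    by rewrite mulr_ge0// subr_ge0.
under eq_integral do rewrite EFinM.
rewrite ge0_integralZl//.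
- rewrite (iidN_integral_prod iX (fun=> mg))//.
  under eq_bigr do rewrite gauss_expR_sqr//.
  by rewrite prodEFin prodr_const EFinM.
- exact/measurable_EFinP.
- by move=> w _; rewrite lee_fin prodr_ge0// => i _; rewrite expR_ge0.
Qed.

End regression_families.

(** * The empirical distribution of the null p-values *)

Section maximal_inequality.
Context {R : realType}.

Lemma expR_chord (l t : R) : 0 <= t <= 1 -> expR (l * t) <= 1 + (expR l - 1) * t.
Proof.
move=> t01; have h : Itv.spec (@Itv.num_sem R) (Itv.Real `[0%Z, 1%Z]) t.
  by rewrite /= /Itv.num_sem/= num_real in_itv/= t01.
have : expR (t * l + (1 - t) * 0) <= t * expR l + (1 - t) * expR 0 :=
  convex_expR (Itv.Def h) l 0.
rewrite mulr0 addr0 expR0 mulrC => /le_trans; apply.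
by rewrite le_eqVlt; apply/orP; left; apply/eqP; ring.
Qed.

Section discrete.
Variables (J : finType) (m : nat) (wt : 'I_m.+1 -> R).
Hypothesis wt_ge0 : forall c, 0 <= wt c.
Hypothesis wt_sum1 : \sum_c wt c = 1.
Hypothesis wt0_gt0 : 0 < wt ord0.

(** A label stands for a p-value rounded up to a grid level, [v] for the labels of all p-values,
    [mass v] for its probability. [coarsen l] forgets the labels below [l] but preserves every count
    at levels [k >= l]: it plays the role of the reverse filtration. *)
Let cum (l : 'I_m.+1) : R := \sum_(c < m.+1 | (c <= l)%N) wt c.
Let count (v : {ffun J -> 'I_m.+1}) (l : 'I_m.+1) : nat := #|[pred j | (v j <= l)%N]|.
Let mass (v : {ffun J -> 'I_m.+1}) : R := \prod_j wt (v j).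
Let coarsen (l c : 'I_m.+1) : 'I_m.+1 := if (c <= l)%N then l else c.

Let wt_le_cum l : wt ord0 <= cum l.
Proof. by rewrite /cum (bigD1 ord0)//= lerDl sumr_ge0. Qed.

Let mass_ge0 v : 0 <= mass v.
Proof. exact: prodr_ge0. Qed.

(* Conditionally on the coarsening at level [l], the factors [f] can be
   replaced by their conditional expectations. *)
Let condexp (l : 'I_m.+1) (f : 'I_m.+1 -> R) (G : {ffun J -> 'I_m.+1} -> R) :
  \sum_v mass v * (\prod_j f (v j)) * G [ffun j => coarsen l (v j)] =
  \sum_v mass v * (\prod_j (if (v j <= l)%N then (\sum_(c < m.+1 | (c <= l)%N) wt c * f c) / cum l
    else f (v j))) * G [ffun j => coarsen l (v j)].
Proof.
pose f' (c : 'I_m.+1) := if (c <= l)%N then (\sum_(c < m.+1 | (c <= l)%N) wt c * f c) / cum l else f c.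
have cum0 : cum l != 0 by rewrite gt_eqF// (lt_le_trans wt0_gt0).
(* Grouping the [v] by their coarsening factors the sum over [j] into fibre sums. It remains to see
   that [f] and [f'] have equal fibre sums, which is how the conditional mean is defined. *)
have step (h : 'I_m.+1 -> R) :
    \sum_v mass v * (\prod_j h (v j)) * G [ffun j => coarsen l (v j)] =
    \sum_u G u * \prod_j \sum_(c | coarsen l c == u j) wt c * h c.
  rewrite (partition_big (fun v : {ffun J -> 'I_m.+1} => [ffun j => coarsen l (v j)]) predT)//=.
  apply: eq_bigr => u _; rewrite bigA_distr_big_dep/= mulr_sumr.
  apply: eq_big => [v|v /eqP <-].
    apply/eqP/familyP => [<- j|h' ]; first by rewrite unfold_in ffunE eqxx.
    by apply/ffunP => j; rewrite ffunE; have := h' j; rewrite unfold_in => /eqP.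
  by rewrite mulrC /mass -big_split.
rewrite (step f) (step f'); apply: eq_bigr => u _; congr (_ * _); apply: eq_bigr => j _.
have [ul|ul] := leqP (u j) l; last first.
  apply: eq_bigr => c; rewrite /coarsen /f'; case: leqP => // cl /eqP cu.
  by move: ul; rewrite -cu ltnn.
have [ule|ule] := eqVneq (u j) l; last first.
  rewrite !big1// => c; rewrite /coarsen; case: leqP => cl /eqP cu.
  + by rewrite cu eqxx in ule.
  + by move: cl; rewrite cu ltnNge ul.
  + by rewrite cu eqxx in ule.
  + by move: cl; rewrite cu ltnNge ul.
have ce c : (coarsen l c == u j) = (c <= l)%N.
  rewrite ule /coarsen; case: leqP => cl; first by rewrite eqxx.
  by apply/eqP => cl'; move: cl; rewrite cl' ltnn.
rewrite (eq_bigl _ _ ce) [RHS](eq_bigl _ _ ce).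
rewrite [RHS](eq_bigr (fun c => wt c * ((\sum_(c < m.+1 | (c <= l)%N) wt c * f c) / cum l))).
  by rewrite -mulr_suml -/(cum l) mulrCA divff// mulr1.
by move=> c cl; rewrite /f' cl.
Qed.

(** The product of [f0 lam (v j)] over [j] is the exponential of [lam] times the number of labels 0,
    that is, of the final value of the martingale up to the factor [wt ord0]. *)
Let f0 (lam : R) (c : 'I_m.+1) : R := if c == ord0 then expR lam else 1.

Let level (x : R) (v : {ffun J -> 'I_m.+1}) (l : 'I_m.+1) : bool :=
  (x * cum l <= (count v l)%:R) &&
  [forall k : 'I_m.+1, (l < k)%N ==> ~~ (x * cum k <= (count v k)%:R)].

(* Doob's argument for the reverse martingale [count l / cum l], stopped at
   the largest level [l] at which it exceeds [x]. *)
Lemma discrete_maximal_inequality (lam x : R) : 0 <= lam -> 0 <= x ->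
  \sum_(v : {ffun J -> 'I_m.+1} | [exists l, x * cum l <= (count v l)%:R]) mass v <=
  expR (- (lam * x * wt ord0)) * (1 + (expR lam - 1) * wt ord0) ^+ #|J|.
Proof.
move=> lam0 x0; set g0 := wt ord0.
have total : \sum_v mass v * \prod_j f0 lam (v j) = (1 + (expR lam - 1) * g0) ^+ #|J|.
  transitivity (\prod_(j : J) \sum_c wt c * f0 lam c).
    by rewrite bigA_distr_bigA/=; apply: eq_bigr => v _; rewrite /mass -big_split.
  rewrite prodr_const; congr (_ ^+ _).
  have rest : \sum_(c | c != ord0) wt c = 1 - g0.
    by rewrite -wt_sum1 [in RHS](bigD1 ord0)//= addrC addrK.
  rewrite (bigD1 ord0)//= /f0 eqxx -/g0.
  rewrite [X in _ + X](eq_bigr wt); first by rewrite rest; ring.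
  by move=> c /negbTE->; rewrite mulr1.
have pos (v : {ffun J -> 'I_m.+1}) : 0 <= \prod_j f0 lam (v j).
  by apply: prodr_ge0 => j _; rewrite /f0; case: ifP; rewrite ?expR_ge0.
(* The event [level x v l] only involves counts at levels [k >= l], so [condexp] applies. By
   convexity each label at most [l] contributes at least exp(lam g0 / cum l), and there are at least
   [x * cum l] of them. *)
have piece (l : 'I_m.+1) : expR (lam * x * g0) * \sum_(v | level x v l) mass v <=
    \sum_(v | level x v l) mass v * \prod_j f0 lam (v j).
  pose G (v : {ffun J -> 'I_m.+1}) : R := (level x v l)%:R.
  have countE (v : {ffun J -> 'I_m.+1}) (k : 'I_m.+1) : (l <= k)%N -> count [ffun j => coarsen l (v j)] k = count v k.
    move=> lk; apply: eq_card => j; rewrite !inE ffunE /coarsen.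
    by have [vl|//] := leqP (v j) l; rewrite lk (leq_trans vl lk).
  have GE (v : {ffun J -> 'I_m.+1}) : G [ffun j => coarsen l (v j)] = G v.
    rewrite /G /level countE//; congr ((_ && _)%:R).
    apply: eq_forallb => k; case: ltnP => //= lk.
    by rewrite countE// ltnW.
  have := condexp l (f0 lam) G; under eq_bigr do rewrite GE; under [RHS]eq_bigr do rewrite GE.
  have mk (F : {ffun J -> 'I_m.+1} -> R) : \sum_v F v * G v = \sum_(v | level x v l) F v.
    rewrite [RHS]big_mkcond; apply: eq_bigr => v _; rewrite /G.
    by case: (level x v l); rewrite ?mulr1 ?mulr0.
  rewrite !mk => ->; rewrite mulr_sumr; apply: ler_sum => v /andP[xv _].
  rewrite mulrC ler_wpM2l//.
  have cl0 : 0 < cum l by exact: (lt_le_trans wt0_gt0).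
  have t01 : 0 <= g0 / cum l <= 1.
    by apply/andP; split; [rewrite divr_ge0// ltW|rewrite ler_pdivrMr// mul1r wt_le_cum].
  apply: (@le_trans _ _ (\prod_j (if (v j <= l)%N then expR (lam * (g0 / cum l)) else 1))).
    rewrite -big_mkcond/= prodr_const -expRM_natr ler_expR.
    have -> : lam * (g0 / cum l) * #|[pred j | (v j <= l)%N]|%:R =
       lam * g0 * ((count v l)%:R / cum l) by rewrite /count; ring.
    by rewrite mulrAC ler_wpM2l ?mulr_ge0 ?wt_ge0// ler_pdivlMr.
  apply: ler_prod => j _; case: ifP => vl; last first.
    rewrite ler01 /f0; case: eqP => [v0|_]; last by rewrite lexx.
    by rewrite v0 in vl.
  rewrite expR_ge0 (le_trans (expR_chord lam t01))//.
  rewrite ler_pdivlMr// [leRHS](bigD1 ord0)//= {1}/f0 eqxx -/g0.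
  rewrite [X in _ <= _ + X](eq_bigr wt); last by move=> c /andP[_ /negbTE]; rewrite /f0 => ->; rewrite mulr1.
  rewrite le_eqVlt; apply/orP; left; apply/eqP.
  have -> : \sum_(i < m.+1 | (i <= l)%N && (i != ord0)) wt i = cum l - g0.
    by rewrite /cum [in RHS](bigD1 ord0)//= addrC addrK.
  by field; rewrite gt_eqF.
rewrite expRN mulrC ler_pdivlMr ?expR_gt0// mulrC -total.
(* A given [v] has at most one largest exceeding level, so the sums over distinct [l] do not
   overlap. *)
apply: (@le_trans _ _ (\sum_l \sum_(v | level x v l) mass v * \prod_j f0 lam (v j))); last first.
  rewrite (exchange_big_dep predT)//=; apply: ler_sum => v _.
  rewrite sumr_const -mulr_natr -[leRHS]mulr1.
  rewrite ler_wpM2l//; first by rewrite mulr_ge0// pos.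
  rewrite -[leRHS]/(1%:R) ler_nat; apply/card_le1_eqP => l1 l2 /=; rewrite !unfold_in.
  move=> /andP[h1 /forallP g1] /andP[h2 /forallP g2]; apply/val_inj/eqP => /=.
  rewrite eqn_leq; apply/andP; split; rewrite leqNgt; apply/negP => h.
    by have /implyP/(_ h)/negP := g1 l2; apply.
  by have /implyP/(_ h)/negP := g2 l1; apply.
apply: (@le_trans _ _ (\sum_l expR (lam * x * g0) * \sum_(v | level x v l) mass v)); last first.
  by apply: ler_sum.
rewrite -mulr_sumr ler_wpM2l ?expR_ge0// (exchange_big_dep predT)//= big_mkcond.
apply: ler_sum => v _; case: ifPn => [/existsP[l xl]|_]; last first.
  by apply: sumr_ge0.
have xlv : level x v [arg max_(k > l | x * cum k <= (count v k)%:R) (k : nat)].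
  case: arg_maxnP => // k xk kmax; rewrite /level xk/=; apply/forallP => k'.
  by apply/implyP => kk'; apply/negP => /kmax h; move: kk'; rewrite ltnNge => /negP; apply.
by rewrite (bigD1 _ xlv)/= lerDl sumr_ge0.
Qed.

End discrete.
End maximal_inequality.

Section finite_partitions.
Context {R : realType} {d : measure_display} {T : measurableType d}.

Lemma measurable_fin_fun (C : finType) (K : T -> C) (B : pred C) :
  (forall c, measurable (K @^-1` [set c])) -> measurable [set x | B (K x)].
Proof.
move=> mK; have -> : [set x | B (K x)] = \bigcup_(c in [set c | B c]) (K @^-1` [set c]).
  by apply/seteqP; split => x /=; [exists (K x)|move=> [c /= Bc ->]].
by apply: fin_bigcup_measurable => //; exact: finite_finset.
Qed.

Lemma measure_fin_fun (mu : {measure set T -> \bar R}) (C : finType) (K : T -> C) (B : pred C) :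
  (forall c, measurable (K @^-1` [set c])) ->
  mu [set x | B (K x)] = (\sum_(c | B c) mu (K @^-1` [set c]))%E.
Proof.
move=> mK; have mB := measurable_fin_fun B mK.
rewrite -[X in mu X]setIT -integral_indic//.
transitivity (\int[mu]_x (\sum_(c <- [seq c <- index_enum C | B c]) (\1_(K @^-1` [set c]) x)%:E))%E.
  apply: eq_integral => x _; rewrite big_filter indicE.
  have [/set_mem/= BK|/negP nBK] := boolP (x \in _).
    rewrite (bigD1 (K x))//= indicE mem_set// big1 ?adde0// => c /andP[_ cK].
    by rewrite indicE memNset//= => Kc; rewrite Kc eqxx in cK.
  rewrite big1// => c Bc; rewrite indicE memNset//= => Kc; apply: nBK.
  by apply/mem_set; rewrite /= Kc.
rewrite ge0_integral_sum//.
- by rewrite big_filter; apply: eq_bigr => c _; rewrite integral_indic// setIT.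
- by move=> c; apply/measurable_EFinP; exact: measurable_indic.
Qed.

Variable P : probability T R.
Notation gauss := (@normal_prob R 0 1).

Lemma iidN_discretize (J C : finType) (z : J -> T -> R) (K : R -> C) (E : pred {ffun J -> C}) :
  iidN P z -> (forall c, measurable (K @^-1` [set c])) ->
  measurable [set w | E [ffun j => K (z j w)]] /\
  P [set w | E [ffun j => K (z j w)]] =
  (\sum_(v : {ffun J -> C} | E v) \prod_j fine (gauss (K @^-1` [set v j])))%:E.
Proof.
move=> iz mK; have [mz _] := iz.
have atomE (v : {ffun J -> C}) : (fun w => [ffun j => K (z j w)]) @^-1` [set v] =
    [set w | forall j, (K @^-1` [set v j]) (z j w)].
  apply/seteqP; split => w /=; first by move=> <- j; rewrite ffunE.
  by move=> h; apply/ffunP => j; rewrite ffunE.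
have matom (v : {ffun J -> C}) : measurable ((fun w => [ffun j => K (z j w)]) @^-1` [set v]).
  rewrite atomE.
  have := @measurable_forall_fin R d T J z (fun j => K @^-1` [set v j]) predT mz (fun j => mK _).
  by congr measurable; apply/seteqP; split => w /= h j; [exact: h|move=> _; exact: h].
split; first exact: measurable_fin_fun.
rewrite measure_fin_fun// -sumEFin; apply: eq_bigr => v _; rewrite atomE.
apply: etrans (iz.2 (fun j => K @^-1` [set v j]) (fun j => mK _)) _.
rewrite -prodEFin; apply: eq_bigr => j _.
by rewrite fineK// fin_num_measure//; exact: mK.
Qed.

End finite_partitions.

(** * Maximal inequality for the counts of p-values *)

Section pvalue_scan.
Context {R : realType} {d : measure_display} {T : measurableType d}.
Variable P : probability T R.
Notation gauss := (@normal_prob R 0 1).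

Definition pcount (J : finType) (y : J -> R) (q : R) : nat :=
  #|[pred j | gtail `|y j| <= q]|.

Lemma le_pcount (J : finType) (y : J -> R) (q q' : R) : q <= q' -> (pcount y q <= pcount y q')%N.
Proof.
move=> qq'; apply: subset_leq_card; apply/fintype.subsetP => j; rewrite !inE => h.
exact: le_trans qq'.
Qed.

Lemma gtail_abs_leP (q : R) : 0 < q <= 1 -> exists t, 0 <= t /\
  [set x : R | gtail `|x| <= q] = [set x | t <= `|x|] /\ gtail t = q.
Proof.
move=> /andP[q0 q1]; have [t t0 tq] := gtail_surj q0 q1.
exists t; split => //; split => //; apply/seteqP; split => x /=; by rewrite -tq gtail_mono.
Qed.

Lemma measurable_gtail_abs_le (q : R) : measurable [set x : R | gtail `|x| <= q].
Proof.
have [q0|q0] := leP q 0.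
  have -> : [set x : R | gtail `|x| <= q] = set0; last exact: measurable0.
  by apply/seteqP; split => x //= h; have := le_trans h q0; rewrite leNgt gtail_gt0.
have [q1|q1] := leP q 1; last first.
  have -> : [set x : R | gtail `|x| <= q] = setT; last exact: measurableT.
  by apply/seteqP; split => x //= _; rewrite (le_trans (gtail_le1 _))// ltW.
have [|t [t0 [-> _]]] := @gtail_abs_leP q; first by rewrite q0.
exact: measurable_abs_ge.
Qed.

Lemma gauss_gtail_abs_le (q : R) : 0 < q <= 1 -> gauss [set x : R | gtail `|x| <= q] = q%:E.
Proof. by move=> /gtail_abs_leP[t [t0 [-> <-]]]; exact: gauss_abs_ge. Qed.

(** Null p-values are uniform, so the label laws cumulate to the grid itself: [cum l = g l] and
    [wt ord0 = g 0]. *)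
Lemma grid_maximal_inequality (J : finType) (z : J -> T -> R) (m : nat) (g : nat -> R) (lam x : R) :
  iidN P z -> 0 < g 0%N -> {homo g : i j / (i <= j)%N >-> i <= j} -> g m = 1 ->
  0 <= lam -> 0 <= x ->
  measurable [set w | exists l : 'I_m.+1, x * g l <= (pcount (z^~ w) (g l))%:R] /\
  (P [set w | exists l : 'I_m.+1, (x * g l <= (pcount (z^~ w) (g l))%:R)%R] <=
   (expR (- (lam * x * g 0%N)) * (1 + (expR lam - 1) * g 0%N) ^+ #|J|)%:E)%E.
Proof.
move=> iz g0 ndg gm lam0 x0.
pose a (y : R) l := gtail `|y| <= g l.
(* Only the first [m] levels are searched: a failed search returns [m], the right label because
   [g m = 1]. *)
pose K (y : R) : 'I_m.+1 := inord (find (a y) (iota 0 m)).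
have findm y : (find (a y) (iota 0 m) <= m)%N by rewrite -[leqRHS](size_iota 0 m) find_size.
have Kval y : K y = find (a y) (iota 0 m) :> nat by rewrite /K inordK// ltnS findm.
have KE y (l : 'I_m.+1) : (K y <= l)%N = (gtail `|y| <= g l).
  rewrite Kval; apply/idP/idP => h.
    have [lt|ge] := ltnP (find (a y) (iota 0 m)) m; last first.
      have -> : l = m :> nat by apply/eqP; rewrite eqn_leq -ltnS ltn_ord (leq_trans ge h).
      by rewrite gm gtail_le1.
    have /(nth_find 0%N) : has (a y) (iota 0 m) by rewrite has_find size_iota.
    rewrite nth_iota//= add0n /a => h'; apply: (le_trans h'); exact: ndg.
  rewrite leqNgt; apply/negP => lt.
  have lm : (l < m)%N by exact: leq_trans lt (findm y).
  by have := before_find 0%N lt; rewrite nth_iota// add0n /a h.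
have mKle (l : 'I_m.+1) : measurable [set y | (K y <= l)%N].
  have -> : [set y | (K y <= l)%N] = [set y | gtail `|y| <= g l].
    by apply/seteqP; split => y /=; rewrite KE.
  exact: measurable_gtail_abs_le.
have mK (c : 'I_m.+1) : measurable (K @^-1` [set c]).
  have [c0|c0] := posnP c.
    have -> : K @^-1` [set c] = [set y | (K y <= c)%N]; last exact: mKle.
    apply/seteqP; split => y /=; first by move=> ->.
    by rewrite c0 leqn0 => /eqP Ky; apply: val_inj; rewrite /= Ky c0.
  have pc : (c.-1 < m.+1)%N by rewrite (leq_ltn_trans (leq_pred _)).
  have -> : K @^-1` [set c] = [set y | (K y <= c)%N] `\` [set y | (K y <= Ordinal pc)%N].
    apply/seteqP; split => y /=.
      by move=> ->; split => //; rewrite -ltnS prednK// ltnn.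
    move=> [h1 /negP]; rewrite -ltnNge/= prednK// => h2.
    by apply: val_inj; apply/eqP; rewrite eqn_leq h1 h2.
  by apply: measurableD; exact: mKle.
pose wt c := fine (gauss (K @^-1` [set c])).
have cumE (l : 'I_m.+1) : \sum_(c < m.+1 | (c <= l)%N) wt c = g l.
  apply: EFin_inj; rewrite -sumEFin.
  have gl : 0 < g l <= 1.
    by rewrite (lt_le_trans g0 (ndg _ _ (leq0n _)))/= -gm ndg// -ltnS.
  rewrite -(gauss_gtail_abs_le gl).
  have -> : [set y : R | gtail `|y| <= g l] = [set y | (K y <= l)%N].
    by apply/seteqP; split => y /=; rewrite KE.
  rewrite (@measure_fin_fun R _ _ gauss _ K (fun c => (c <= l)%N) mK).
  by apply: eq_bigr => c _; rewrite /wt fineK// fin_num_measure//; exact: mK.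
have wt0 : wt ord0 = g 0%N.
  rewrite -[in RHS](cumE ord0); rewrite (bigD1 ord0)//= big1 ?addr0// => c /andP[].
  by rewrite leqn0 => /eqP c0 /eqP; case; exact: val_inj.
have wt1 : \sum_c wt c = 1.
  by rewrite -gm -(cumE ord_max); apply: eq_bigl => c; rewrite leq_ord.
pose E := fun v : {ffun J -> 'I_m.+1} => [exists l : 'I_m.+1,
  x * \sum_(c < m.+1 | (c <= l)%N) wt c <= #|[pred j | (v j <= l)%N]|%:R].
have setE : [set w | exists l : 'I_m.+1, x * g l <= (pcount (z^~ w) (g l))%:R] =
    [set w | E [ffun j => K (z j w)]].
  have cE w (l : 'I_m.+1) : pcount (z^~ w) (g l) = #|[pred j | ([ffun j => K (z j w)] j <= l)%N]|.
    by apply: eq_card => j; rewrite !inE ffunE KE.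
  apply/seteqP; split => w /=; rewrite /E.
    by move=> [l h]; apply/existsP; exists l; rewrite cumE -cE.
  by move=> /existsP[l]; rewrite cumE -cE; exists l.
rewrite setE; have [mE ->] := iidN_discretize E iz mK; split => //.
rewrite lee_fin -wt0; apply: discrete_maximal_inequality => //.
- by move=> c; rewrite fine_ge0.
- by rewrite wt0.
Qed.

(** A bound on outer probability, since unions over a continuum of levels [q] are not shown to be
    measurable. *)
Definition pbound (A : set T) (b : R) : Prop :=
  exists F, [/\ measurable F, A `<=` F & (P F <= b%:E)%E].

Lemma pbound_sub (A B : set T) (a b : R) : A `<=` B -> a <= b -> pbound B a -> pbound A b.
Proof.
move=> AB ab [F [mF BF PF]]; exists F; split => //; first exact: subset_trans BF.
by apply: (le_trans PF); rewrite lee_fin.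
Qed.

Lemma pboundU (A B : set T) (a b : R) : pbound A a -> pbound B b -> pbound (A `|` B) (a + b).
Proof.
move=> [F [mF AF PF]] [G [mG BG PG]]; exists (F `|` G); split.
- exact: measurableU.
- exact: setUSS.
- by rewrite EFinD; apply: (le_trans (measureU2 _ mF mG)); exact: leeD.
Qed.

Lemma pbound_ord (M : nat) (A : nat -> set T) (b : R) :
  (forall i, (i < M)%N -> pbound (A i) b) ->
  pbound [set w | exists i, (i < M)%N /\ A i w] (M%:R * b).
Proof.
elim: M => [_|M IHM h].
  by exists set0; split => //; [move=> w [i []]|rewrite measure0 mul0r].
have h1 := IHM (fun i iM => h i (ltnW iM)); have h2 := h M (ltnSn M).
apply: (pbound_sub _ _ (pboundU h1 h2)); last by rewrite -natr1 mulrDl mul1r.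
move=> w [i []]; rewrite ltnS leq_eqVlt => /predU1P[->|iM] Aw; first by right.
by left; exists i.
Qed.

(** Every level lies within a factor [1 + e] below a point of a geometric grid, and counts are
    monotone, so an exceedance of slope [x] forces one of slope [x / (1 + e)] on the grid. *)
Lemma pcount_maximal_inequality (J : finType) (z : J -> T -> R) (s lam x : R) :
  iidN P z -> 0 < s <= 1 -> 0 <= lam -> 0 <= x ->
  pbound [set w | exists q, s <= q <= 1 /\ x * q <= (pcount (z^~ w) q)%:R]
    (2 * expR (#|J|%:R * s * (expR lam - 1) - lam * x * s)).
Proof.
move=> iz /andP[s0 s1] lam0 x0.
(* With this mesh, replacing [x] by [x / (1 + e)] raises the exponent by at most 1/2, hence the
   factor 2. *)
pose e := (2 * (lam * x * s + 1))^-1.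
have K0 : 0 <= lam * x * s by rewrite !mulr_ge0// ltW.
have e0 : 0 < e by rewrite invr_gt0; lra.
pose g l := Num.min 1 (s * (1 + e) ^+ l).
have e1 : 1 <= 1 + e by rewrite lerDl ltW.
have g00 : g 0%N = s by rewrite /g expr0 mulr1; exact/min_idPr.
have ndg : {homo g : i j / (i <= j)%N >-> i <= j}.
  move=> i j ij; rewrite /g le_min ge_min lexx/= ge_min; apply/orP; right.
  by rewrite ler_pM2l// ler_weXn2l.
have [m gm] : exists m, g m = 1.
  pose m := Num.bound (s^-1 / e).
  exists m; apply/min_idPl; rewrite -ler_pdivrMl// mulr1.
  have /ltW h : s^-1 / e < m%:R.
    by apply: archi_boundP; apply: divr_ge0; [rewrite invr_ge0|]; exact: ltW.
  apply: (@le_trans _ _ (1 + e * m%:R)).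
    by move: h; rewrite ler_pdivrMr// mulrC; lra.
  elim: (m) => [|k IHk]; first by rewrite mulr0 addr0 expr0.
  rewrite exprS -natr1.
  have : (1 + e) * (1 + e * k%:R) <= (1 + e) * (1 + e) ^+ k by rewrite ler_wpM2l// addr_ge0// ltW.
  have : 0 <= e * (e * k%:R) by rewrite !mulr_ge0// ltW.
  by nra.
have g0 : 0 < g 0%N by rewrite g00.
have xe0 : 0 <= x / (1 + e) by rewrite divr_ge0// addr_ge0// ltW.
have [mA PA] := grid_maximal_inequality iz g0 ndg gm lam0 xe0.
eexists; split; first exact: mA.
  move=> w [q [/andP[sq q1] xq]] /=.
  have [l [lm ql gq]] : exists l, [/\ (l <= m)%N, q <= g l & g l <= (1 + e) * q].
    have q0 : 0 < q := lt_le_trans s0 sq.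
    have : q <= g m by rewrite gm.
    elim: (m) => [qg|k IHk qk1].
      by exists 0%N; split => //; rewrite g00 (le_trans sq)// ler_peMl ?(ltW q0).
    have [/IHk[l [lk ql lq]]|kq] := leP q (g k); first by exists l; split => //; exact: leqW.
    exists k.+1; split => //; apply: (@le_trans _ _ ((1 + e) * g k)); last first.
      by rewrite ler_pM2l ?ltW// (lt_le_trans ltr01).
    rewrite /g minr_pMr ?(le_trans ler01)// le_min mulr1; apply/andP; split.
      by rewrite ge_min e1.
    by rewrite ge_min exprS mulrCA lexx orbT.
  exists (Ordinal (lm : (l < m.+1)%N)) => /=.
  rewrite mulrAC ler_pdivrMr ?(lt_le_trans ltr01)//.
  apply: (@le_trans _ _ (x * q * (1 + e))).
    by rewrite -mulrA ler_wpM2l// mulrC.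
  rewrite ler_wpM2r ?(le_trans ler01)//; apply: (le_trans xq).
  by rewrite ler_nat le_pcount.
apply: (le_trans PA); rewrite lee_fin g00.
have h1 : (1 + (expR lam - 1) * s) ^+ #|J| <= expR (#|J|%:R * s * (expR lam - 1)).
  have -> : #|J|%:R * s * (expR lam - 1) = (expR lam - 1) * s * #|J|%:R by ring.
  rewrite expRM_natr; apply: lerXn2r; rewrite ?nnegrE ?expR_ge0 ?expR_ge1Dx//.
  by rewrite addr_ge0// mulr_ge0 ?(ltW s0)// subr_ge0 -expR0 ler_expR.
have h2 : expR (- (lam * (x / (1 + e)) * s)) <= 2 * expR (- (lam * x * s)).
  have -> : - (lam * (x / (1 + e)) * s) = lam * x * s * e / (1 + e) - lam * x * s.
    by field; rewrite gt_eqF// (lt_le_trans ltr01).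
  rewrite expRD ler_wpM2r ?expR_ge0//.
  apply: (@le_trans _ _ (expR 2^-1)).
    rewrite ler_expR ler_pdivrMr ?(lt_le_trans ltr01)//.
    have : lam * x * s * e <= 2^-1.
      by rewrite /e ler_pdivrMr; lra.
    by lra.
  have := expR_ge1Dx (- 2^-1 : R); rewrite expRN.
  have e20 := expR_gt0 (2^-1 : R) => h.
  have : 2^-1 <= (expR 2^-1)^-1 :> R by lra.
  by rewrite lef_pV2// posrE.
have h3 : 0 <= (1 + (expR lam - 1) * s) ^+ #|J|.
  by rewrite exprn_ge0// addr_ge0// mulr_ge0 ?(ltW s0)// subr_ge0 -expR0 ler_expR.
apply: (le_trans (ler_pM (expR_ge0 _) h3 h2 h1)).
by rewrite -[leLHS]mulrA -expRD addrC.
Qed.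

End pvalue_scan.

(** * Elementary bounds on the exponential *)

Section expR_bounds.
Context {R : realType}.
Implicit Types x : R.

(** The polynomial times exp(- t) equals 1 at 0 and has derivative (t^2 - t^3 / 2) exp(- t),
    nonnegative on [0, 1]. The exact quadratic coefficient is what preserves the Gaussian constant
    in the moderate range. *)
Lemma expR_cubic_le x : 0 <= x <= 1 -> expR x <= 1 + x + x ^+ 2 / 2 + x ^+ 3 / 2.
Proof.
move=> /andP[x0 x1]; pose p : {poly R} := 1%:P + 'X + 2^-1 *: 'X^2 + 2^-1 *: 'X^3.
have pE y : p.[y] = 1 + y + y ^+ 2 / 2 + y ^+ 3 / 2.
  by rewrite /p !hornerE /=; ring.
have dpE y : (deriv p).[y] = 1 + y + 3 / 2 * y ^+ 2.
  by rewrite /p !derivD !derivZ !derivXn derivX derivC !hornerE /= ?hornerMn; field.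
have dexp y : is_derive y (1 : R) (fun t : R => expR (- t)) (- expR (- y)).
  by apply: is_derive_eq; rewrite mulrN1.
have dh y : is_derive y (1 : R) ((horner p) * (fun t => expR (- t)))
    ((y ^+ 2 - y ^+ 3 / 2) * expR (- y)).
  by apply: is_derive_eq; rewrite pE dpE /GRing.scale/=; field.
have cont : {within `[0, x], continuous ((horner p) * (fun t => expR (- t)))}.
  apply: continuous_subspaceT => y.
  by apply/differentiable_continuous/derivable1_diffP; exact: (@ex_derive _ _ _ _ _ _ _ (dh y)).
have [c + e] := MVT_segment x0 (fun y _ => dh y) cont.
rewrite in_itv/= => /andP[c0 cx].
have {}e : p.[x] * expR (- x) - p.[0] * expR (- 0) =
  (c ^+ 2 - c ^+ 3 / 2) * expR (- c) * (x - 0) := e.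
move: e; rewrite !pE oppr0 expR0 addr0 => e.
have ce : 0 <= (c ^+ 2 - c ^+ 3 / 2) * expR (- c) * x.
  rewrite !mulr_ge0 ?expR_ge0//.
  have -> : c ^+ 2 - c ^+ 3 / 2 = c ^+ 2 * (1 - c / 2) by ring.
  by rewrite mulr_ge0 ?sqr_ge0//; lra.
have : 1 <= (1 + x + x ^+ 2 / 2 + x ^+ 3 / 2) * expR (- x) by lra.
by rewrite expRN ler_pdivlMr ?expR_gt0// mul1r.
Qed.

Lemma expR_quadratic_le x : 0 <= x <= 1 -> expR x <= 1 + x + x ^+ 2.
Proof.
move=> /andP[x0 x1]; apply: (le_trans (expR_cubic_le _)); first by rewrite x0.
have : 0 <= x ^+ 2 * (1 - x) by rewrite mulr_ge0 ?sqr_ge0 ?subr_ge0.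
by rewrite !exprS expr0; lra.
Qed.

Lemma expRN_quadratic_le x : 0 <= x -> expR (- x) <= 1 - x + x ^+ 2.
Proof.
move=> x0; have x1 : 0 < 1 + x by rewrite ltr_pwDl.
apply: (@le_trans _ _ (1 + x)^-1).
  by rewrite expRN lef_pV2 ?posrE ?expR_gt0 ?expR_ge1Dx.
rewrite -div1r ler_pdivrMr//.
have -> : (1 - x + x ^+ 2) * (1 + x) = 1 + x ^+ 3 by ring.
by rewrite lerDl exprn_ge0.
Qed.

Lemma expRN_le_invr (n : nat) x : 0 < x -> expR (- x) <= n.+1`!%:R / x ^+ n.+1.
Proof.
move=> x0; rewrite expRN -[leRHS]invf_div lef_pV2 ?posrE ?expR_gt0//.
  by have := expR_ge1Dxn n (ltW x0); lra.
by rewrite divr_gt0 ?exprn_gt0// ltr0n fact_gt0.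
Qed.

End expR_bounds.

(** * The statistic expressed through counts *)

Section higher_criticism_statistic.
Context {R : realType} {n p : nat}.
Variables (X : 'M[R]_(n, p)) (Y : 'cV[R]_n).

Let pv := [seq pvalue X Y j | j : 'I_p].

Lemma count_pvalue (q : R) : count (<= q) (sort <=%R pv) = pcount (ystat X Y) q.
Proof.
rewrite (permP (permEl (perm_sort _ _))) /pv count_map /pcount.
by rewrite -sum1_count big_enum_cond -sum1_card; apply: eq_bigl => j; rewrite !inE.
Qed.

Let size_pv : size (sort <=%R pv) = p.
Proof. by rewrite size_sort /pv size_map size_enum_ord. Qed.

Let sorted_pv : sorted <=%O (sort <=%R pv).
Proof. exact: sort_sorted (@le_total _ R) _. Qed.

Lemma pvalue_order_gt0 (i : 'I_p) : 0 < pvalue_order X Y i.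
Proof.
have : pvalue_order X Y i \in sort <=%R pv by rewrite mem_nth// size_pv.
by rewrite mem_sort => /mapP[j _ ->]; exact: gtail_gt0.
Qed.

Lemma pvalue_order_leP (i : 'I_p) (q : R) :
  (pvalue_order X Y i <= q) = (i < pcount (ystat X Y) q)%N.
Proof.
rewrite -count_pvalue /pvalue_order; apply/idP/idP => h; last exact: nth_count_le.
rewrite ltnNge; apply/negP => c.
have := @nth_count_gt _ _ q 0 _ i sorted_pv; rewrite c size_pv ltn_ord => /(_ isT).
by rewrite ltNge h.
Qed.

Lemma HC_term_lt (t q N : R) : 0 < p%:R :> R -> 0 < q -> q <= 2^-1 ->
  (t < Num.sqrt p%:R * (N / p%:R - q) / Num.sqrt (q * (1 - q))) =
  (p%:R * q + t * Num.sqrt (p%:R * q * (1 - q)) < N).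
Proof.
move=> p0 q0 q1; have qq : 0 < q * (1 - q) by rewrite mulr_gt0//; lra.
rewrite ltr_pdivlMr ?sqrtr_gt0//.
have -> : Num.sqrt (p%:R * q * (1 - q)) = Num.sqrt p%:R * Num.sqrt (q * (1 - q)).
  by rewrite -mulrA sqrtrM// ltW.
have sp : 0 < Num.sqrt p%:R :> R by rewrite sqrtr_gt0.
have e : p%:R = Num.sqrt p%:R * Num.sqrt p%:R :> R by rewrite -expr2 sqr_sqrtr// ltW.
set s := Num.sqrt p%:R in sp e *; set r := Num.sqrt _; rewrite e -(ltr_pM2l sp).
have -> : s * (s * (N / (s * s) - q)) = N - s * s * q by field; rewrite gt_eqF.
by rewrite ltrBrDl mulrCA.
Qed.

(** The witness is an order statistic whose term exceeds [t]; ties can only make the count larger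
    than its rank. *)
Lemma t_HC_gt (t : R) : (t%:E < t_HC X Y)%E ->
  exists q, [/\ 0 < q, q <= 2^-1 &
    p%:R * q + t * Num.sqrt (p%:R * q * (1 - q)) < (pcount (ystat X Y) q)%:R].
Proof.
move=> /bigmax_gtP[|[i iq]]; first by rewrite ltNge leNye.
rewrite lte_fin => h; have q0 := pvalue_order_gt0 i.
have p0 : 0 < p%:R :> R by rewrite ltr0n (leq_ltn_trans (leq0n i)).
exists (pvalue_order X Y i); split => //.
rewrite HC_term_lt// in h; apply: (lt_le_trans h).
by rewrite ler_nat -pvalue_order_leP.
Qed.

(** The level [q] is moved down to the p-value whose rank is the count at [q]. The rank is kept
    while mean and standard deviation decrease, so any level may be used to prove that the test
    rejects. *)
Lemma t_HC_lt (t q : R) : 0 <= t -> 0 < q -> q <= 2^-1 ->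
  p%:R * q + t * Num.sqrt (p%:R * q) < (pcount (ystat X Y) q)%:R ->
  (t%:E < t_HC X Y)%E.
Proof.
move=> t0 q0 q1 h.
have pq0 : 0 <= p%:R * q + t * Num.sqrt (p%:R * q).
  by rewrite addr_ge0// mulr_ge0// ?sqrtr_ge0// ltW.
have N0 : (0 < pcount (ystat X Y) q)%N by rewrite -(ltr0n R) (le_lt_trans pq0).
have Np : (pcount (ystat X Y) q <= p)%N.
  by rewrite /pcount -[leqRHS](card_ord p); exact: max_card.
have ip : ((pcount (ystat X Y) q).-1 < p)%N by rewrite prednK.
pose i := Ordinal ip.
have iq : pvalue_order X Y i <= q by rewrite pvalue_order_leP /= prednK.
have i0 := pvalue_order_gt0 i.
have p0 : 0 < p%:R :> R by rewrite ltr0n (leq_ltn_trans (leq0n i)).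
apply/bigmax_gtP; right; exists i; first exact: le_trans q1.
rewrite lte_fin HC_term_lt ?(le_trans iq)// /= prednK//.
apply: le_lt_trans h; apply: lerD; first by rewrite ler_pM2l.
rewrite ler_wpM2l// ler_wsqrtr// -mulrA ler_pM2l// (le_trans _ iq)//.
by rewrite ler_piMr ?ltW//; lra.
Qed.

End higher_criticism_statistic.

(** * Exceedances of the null counts, block by block *)

Section null_scan.
Context {R : realType} {d : measure_display} {T : measurableType d}.
Variable P : probability T R.
Variables (J : finType) (z : J -> T -> R).
Hypothesis iz : iidN P z.
Let p : R := #|J|%:R.
Hypothesis p_gt0 : 0 < p.

Definition exceeds (t q : R) (w : T) : Prop :=
  #|J|%:R * q + t * Num.sqrt (#|J|%:R * q * (1 - q)) < (pcount (z^~ w) q)%:R.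

Definition exceedance (t lo hi : R) : set T :=
  [set w | exists q, [/\ lo <= q <= hi, 0 < q <= 2^-1 & exceeds t q w]].

Lemma pbound_exists (I : finType) (A : I -> set T) (b : R) :
  (forall i, pbound P (A i) b) -> pbound P [set w | exists i, A i w] (#|I|%:R * b).
Proof.
move=> h; have [I0|/card_gt0P[i0 _]] := posnP #|I|.
  exists set0; split => //; last by rewrite I0 measure0 mul0r.
  by move=> w [i]; have := card0_eq I0 i; rewrite inE.
have := @pbound_ord _ _ _ P #|I| (fun k => A (nth i0 (enum I) k)) b (fun k _ => h _).
apply: pbound_sub => // w [i Ai]; exists (index i (enum I)).
by rewrite cardE index_mem mem_enum nth_index// mem_enum.
Qed.

Lemma exceedance_low (t u : R) : 0 <= t -> 0 < u <= 1 -> pbound P (exceedance t 0 u) (p * u).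
Proof.
move=> t0 u01; have : forall j, pbound P [set w | gtail `|z j w| <= u] u.
  move=> j; exists [set w | gtail `|z j w| <= u]; split => //.
    by have := iz.1 j measurableT _ (measurable_gtail_abs_le u); rewrite setTI.
  have := iidN_marginal j iz (measurable_gtail_abs_le u).
  by rewrite gauss_gtail_abs_le// => ->.
move=> /pbound_exists; apply: pbound_sub => // w [q [/andP[_ qu] /andP[q0 q1]]].
rewrite /exceeds => h.
have : (0 < pcount (z^~ w) q)%N.
  rewrite -(ltr0n R); apply: le_lt_trans h.
  rewrite addr_ge0 ?mulr_ge0 ?sqrtr_ge0//; exact: ltW.
by move=> /card_gt0P[j]; rewrite inE => jq; exists j => /=; exact: le_trans jq qu.
Qed.

(** On the block the boundary lies above the line of slope [p * (1 + eta)], to which the maximal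
    inequality applies. The ratio of t sqrt(p q (1 - q)) to q decreases, so the condition on [eta]
    is read at the upper end [h], with [kappa] below [1 - q]. *)
Lemma exceedance_block (t s h kappa eta lam : R) : 0 < s -> 0 <= t -> 0 <= eta -> 0 <= lam ->
  0 <= kappa -> (forall q, q <= h -> q <= 2^-1 -> kappa <= 1 - q) ->
  eta ^+ 2 * (p * h) <= t ^+ 2 * kappa ->
  pbound P (exceedance t s h) (2 * expR (p * s * (expR lam - 1) - lam * (p * (1 + eta)) * s)).
Proof.
move=> s0 t0 eta0 lam0 k0 hk heta.
(* Levels are at most 1/2, so a block starting above 1 is empty. *)
have [s1|s1] := leP s 1; last first.
  exists set0; split => //; last by rewrite measure0 lee_fin mulr_ge0// expR_ge0.
  move=> w [q [/andP[sq _] /andP[_ q1] _]].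
  by have := lt_le_trans s1 (le_trans sq q1); rewrite ltNge; case/negP; lra.
have x0 : 0 <= p * (1 + eta) by rewrite mulr_ge0 ?addr_ge0// ltW.
have s01 : 0 < s <= 1 by rewrite s0.
apply: (pbound_sub _ _ (pcount_maximal_inequality iz s01 lam0 x0)) => //.
move=> w [q [/andP[sq qh] /andP[q0 q1] e]]; exists q; split.
  by rewrite sq (le_trans q1)//; lra.
apply: le_trans (ltW e); rewrite mulrDr mulr1 mulrDl lerD2l.
have pq0 : 0 < p * q by rewrite mulr_gt0.
have qq : 0 <= 1 - q by lra.
have -> : p * eta * q = p * q * eta by ring.
have -> : t * Num.sqrt (p * q * (1 - q)) = Num.sqrt (t ^+ 2 * (p * q * (1 - q))).
  by rewrite [RHS]sqrtrM ?sqr_ge0// sqrtr_sqr ger0_norm.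
have -> : p * q * eta = Num.sqrt ((p * q * eta) ^+ 2).
  by rewrite sqrtr_sqr ger0_norm// mulr_ge0// ltW.
apply: ler_wsqrtr.
have -> : (p * q * eta) ^+ 2 = p * q * (eta ^+ 2 * (p * q)) by ring.
have -> : t ^+ 2 * (p * q * (1 - q)) = p * q * (t ^+ 2 * (1 - q)) by ring.
rewrite ler_pM2l//; apply: (@le_trans _ _ (eta ^+ 2 * (p * h))).
  by rewrite ler_wpM2l ?sqr_ge0// ler_pM2l.
by apply: (le_trans heta); rewrite ler_wpM2l ?sqr_ge0// hk.
Qed.

(* Moderate-deviation range: the Gaussian exponent, up to factors close to 1. *)
Lemma exceedance_block_moderate (t s h rho del : R) : 0 < s -> 0 <= t -> 1 <= rho ->
  0 < del < 1 -> h <= rho * s -> h <= del -> t ^+ 2 <= del ^+ 2 * (p * s) ->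
  pbound P (exceedance t s h) (2 * expR (- ((1 - del) ^+ 2 / (2 * rho) * t ^+ 2))).
Proof.
move=> s0 t0 rho1 /andP[del0 del1] hs hd tps.
have rho0 : 0 < rho by exact: lt_le_trans ltr01 rho1.
have ps0 : 0 < p * s by rewrite mulr_gt0.
(* The largest slope allowed with [kappa = 1 - del] and upper end [rho * s]. It also serves as
   [lam], close to the optimum ln (1 + eta) since [eta <= del]. *)
pose eta := t * Num.sqrt ((1 - del) / (p * (rho * s))).
have d1 : 0 < 1 - del by rewrite subr_gt0.
have eta0 : 0 <= eta by rewrite mulr_ge0// sqrtr_ge0.
have eta2 : eta ^+ 2 = t ^+ 2 * ((1 - del) / (p * (rho * s))).
  by rewrite exprMn sqr_sqrtr// divr_ge0 ?ltW// !mulr_gt0.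
have pseta : p * s * eta ^+ 2 = t ^+ 2 * ((1 - del) / rho).
  by rewrite eta2; field; rewrite !gt_eqF.
have etad : eta <= del.
  rewrite -(@ler_pXn2r _ 2)// ?nnegrE ?(ltW del0)//.
  rewrite -(ler_pM2l ps0) pseta [leRHS]mulrC; apply: le_trans tps.
  rewrite ler_piMr ?sqr_ge0// ler_pdivrMr// mul1r; lra.
have hk q : q <= h -> q <= 2^-1 -> 1 - del <= 1 - q.
  by move=> qh _; rewrite lerD2l lerN2 (le_trans qh).
have heta : eta ^+ 2 * (p * h) <= t ^+ 2 * (1 - del).
  rewrite eta2; apply: (@le_trans _ _ (t ^+ 2 * ((1 - del) / (p * (rho * s))) * (p * (rho * s)))).
    apply: ler_wpM2l; last by rewrite ler_pM2l.
    by apply: mulr_ge0; [exact: sqr_ge0|apply: divr_ge0; apply: ltW => //; rewrite !mulr_gt0].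
  by rewrite -mulrA divfK// gt_eqF// !mulr_gt0.
have [F [mF sF PF]] := exceedance_block s0 t0 eta0 eta0 (ltW d1) hk heta.
exists F; split => //; apply: (le_trans PF).
rewrite lee_fin ler_pM2l// ler_expR.
have e01 : 0 <= eta <= 1 by rewrite eta0 (le_trans etad)// ltW.
have := expR_cubic_le e01 => e3.
have h1 : p * s * (expR eta - 1) - eta * (p * (1 + eta)) * s <=
    p * s * (eta ^+ 3 / 2 - eta ^+ 2 / 2).
  have -> : p * s * (expR eta - 1) - eta * (p * (1 + eta)) * s =
    p * s * (expR eta - 1 - eta - eta ^+ 2) by ring.
  by rewrite ler_pM2l//; lra.
apply: (le_trans h1).
have -> : p * s * (eta ^+ 3 / 2 - eta ^+ 2 / 2) = p * s * eta ^+ 2 * (eta - 1) / 2 by ring.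
rewrite pseta.
have -> : t ^+ 2 * ((1 - del) / rho) * (eta - 1) / 2 =
  - (t ^+ 2 * ((1 - del) / (2 * rho)) * (1 - eta)) by field; rewrite gt_eqF.
have -> : (1 - del) ^+ 2 / (2 * rho) * t ^+ 2 = t ^+ 2 * ((1 - del) / (2 * rho)) * (1 - del).
  by field; rewrite gt_eqF.
rewrite lerN2 ler_wpM2l ?lerD2l ?lerN2// mulr_ge0 ?sqr_ge0// divr_ge0 ?ltW// mulr_gt0//.
Qed.

(** Covers the blocks where the Gaussian approximation fails: [p * s] small compared with the
    squared threshold, or [1 - q] far from 1. They are few, so the weak exponent suffices. *)
Lemma exceedance_block_crude (tau s h rho : R) : 0 < s -> 1 <= tau -> 1 <= rho <= 2 ->
  h <= rho * s -> 1 <= tau ^+ 2 * (p * s) ->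
  pbound P (exceedance (tau ^+ 2) s h) (2 * expR (- (tau / 16))).
Proof.
move=> s0 tau1 /andP[rho1 rho2] hs tps.
have ps0 : 0 < p * s by rewrite mulr_gt0.
have tau0 : 0 < tau by exact: lt_le_trans ltr01 tau1.
pose v := Num.sqrt (p * s).
have v0 : 0 < v by rewrite sqrtr_gt0.
have v2 : v ^+ 2 = p * s by rewrite sqr_sqrtr// ltW.
have tv : 1 <= tau * v.
  by rewrite -(@ler_pXn2r _ 2)// ?nnegrE ?mulr_ge0 ?(ltW v0) ?(ltW tau0)// expr1n exprMn v2.
(* The largest slope allowed with [kappa = 1/2] and [h <= 2 * s]. Capping [lam] at 1/2 keeps the
   quadratic bound on exp valid; the exponent is then at least tau^4 / 16 if [eta <= 1] and tau / 8
   otherwise. *)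
pose eta := tau ^+ 2 / (2 * v).
have eta0 : 0 < eta by rewrite divr_gt0 ?exprn_gt0// mulr_gt0.
pose lam := Num.min eta 1 / 2.
have m0 : 0 < Num.min eta 1 by rewrite lt_min eta0/=.
have lam0 : 0 <= lam by rewrite divr_ge0// ltW.
have hk q : q <= h -> q <= 2^-1 -> 2^-1 <= 1 - q by move=> _ q1; lra.
have heta : eta ^+ 2 * (p * h) <= (tau ^+ 2) ^+ 2 * 2^-1.
  apply: (@le_trans _ _ (eta ^+ 2 * (2 * v ^+ 2))).
    rewrite ler_wpM2l ?sqr_ge0// v2 mulrCA ler_pM2l//.
    by apply: (le_trans hs); rewrite ler_pM2r.
  by rewrite le_eqVlt; apply/orP; left; apply/eqP; rewrite /eta; field; rewrite gt_eqF.
have k0 : 0 <= 2^-1 :> R by [].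
have [F [mF sF PF]] := exceedance_block s0 (sqr_ge0 tau) (ltW eta0) lam0 k0 hk heta.
exists F; split => //; apply: (le_trans PF).
rewrite lee_fin ler_pM2l// ler_expR.
have lam1 : 0 <= lam <= 1.
  rewrite lam0 /lam ler_pdivrMr// mul1r (le_trans (_ : _ <= 1))//; last by lra.
  by rewrite ge_min lexx orbT.
have lame : lam <= eta / 2 by rewrite /lam ler_pM2r ?invr_gt0// ge_min lexx.
have := expR_quadratic_le lam1 => e2.
have -> : p * s * (expR lam - 1) - lam * (p * (1 + eta)) * s =
  v ^+ 2 * (expR lam - 1 - lam - lam * eta) by rewrite v2; ring.
apply: (@le_trans _ _ (- (v ^+ 2 * (lam * eta / 2)))).
  rewrite -[leRHS]mulrN ler_pM2l ?exprn_gt0//.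
  have : lam * lam <= lam * (eta / 2) by rewrite ler_wpM2l.
  by rewrite expr2 in e2; lra.
rewrite lerN2.
have etav : v * eta = tau ^+ 2 / 2 by rewrite /eta; field; rewrite gt_eqF.
have -> : v ^+ 2 * (lam * eta / 2) = v * (v * eta) * Num.min eta 1 / 4 by rewrite /lam; field.
rewrite etav; have [e1|e1] := leP eta 1.
  have -> : v * (tau ^+ 2 / 2) * eta / 4 = v * eta * (tau ^+ 2 / 8) by field.
  rewrite etav.
  have -> : tau ^+ 2 / 2 * (tau ^+ 2 / 8) = tau * (tau * tau * tau) / 16 by field.
  rewrite ler_pM2r ?invr_gt0// ler_pMr// -(mulr1 1) ler_pM// -(mulr1 1) ler_pM//.
have -> : v * (tau ^+ 2 / 2) * 1 / 4 = tau * (tau * v) / 8 by field.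
have : tau <= tau * (tau * v) by rewrite ler_pMr.
by lra.
Qed.

(** Truncating each block at [y] keeps the last one inside the range, where bounds such as
    [h <= del] hold. *)
Lemma exceedance_geometric (t x y rho b : R) (M : nat) : 0 < x -> 1 <= rho ->
  y <= x * rho ^+ M.+1 ->
  (forall i, (i <= M)%N ->
     pbound P (exceedance t (x * rho ^+ i) (Num.min (x * rho ^+ i.+1) y)) b) ->
  pbound P (exceedance t x y) (M.+1%:R * b).
Proof.
move=> x0 rho1 yM hb.
apply: (pbound_sub _ _ (pbound_ord (M := M.+1) hb)) => //.
move=> w [q [/andP[xq qy] q01 e]].
have [i [iM iq qi]] : exists i, [/\ (i <= M)%N, x * rho ^+ i <= q & q <= x * rho ^+ i.+1].
  have := le_trans qy yM; elim: (M) => [qx|m IHm qx].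
    by exists 0%N; rewrite expr0 mulr1.
  have [/IHm[i [im h1 h2]]|/ltW h] := leP q (x * rho ^+ m.+1).
    by exists i; split => //; exact: leqW.
  by exists m.+1.
exists i; split => //; exists q; split => //.
by rewrite iq le_min qi qy.
Qed.

Lemma geometric_steps (rho y : R) : 1 < rho -> 1 <= y ->
  exists M : nat, y <= rho ^+ M.+1 /\ M.+1%:R <= ln y / ln rho + 1.
Proof.
move=> rho1 y1; have l0 : 0 < ln rho by exact: ln_gt0.
have h0 : 0 <= ln y / ln rho by rewrite divr_ge0 ?ln_ge0// ltW.
exists (Num.truncn (ln y / ln rho)); split; last first.
  by rewrite -natr1 lerD2r truncn_le.
have y0 : 0 < y by exact: lt_le_trans y1.
have r0 : 0 < rho by exact: lt_trans rho1.
rewrite -ler_ln ?posrE ?exprn_gt0// lnXn// -mulr_natl -ler_pdivrMr//.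
by rewrite ltW// truncnS_gt.
Qed.

Lemma exceedance_bound (tau rho del : R) : 1 <= tau -> 1 < rho <= 2 -> 0 < del <= 2^-1 -> 1 <= p ->
  pbound P (exceedance (tau ^+ 2) 0 2^-1)
    ((tau ^+ 2)^-1
     + (ln (tau ^+ 6 / del ^+ 2) / ln rho + 1) * (2 * expR (- (tau / 16)))
     + (ln p / ln rho + 1) * (2 * expR (- ((1 - del) ^+ 2 / (2 * rho) * (tau ^+ 2) ^+ 2)))
     + (ln (del^-1) / ln rho + 1) * (2 * expR (- (tau / 16)))).
Proof.
move=> tau1 /andP[rho1 rho2] /andP[del0 del1] p1.
have tau0 : 0 < tau by exact: lt_le_trans ltr01 tau1.
have t0 k : 0 < tau ^+ k by rewrite exprn_gt0.
have t1 k : 1 <= tau ^+ k by rewrite exprn_ege1.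
have rho0 : 0 < rho by exact: lt_trans rho1.
have rk i : 1 <= rho ^+ i by rewrite exprn_ege1// ltW.
(* Below [u] a p-value occurs with probability at most [1 / tau ^+ 2], and from [u] on the crude
   block bound is available. *)
pose u := (tau ^+ 2 * p)^-1.
have u0 : 0 < u by rewrite invr_gt0 mulr_gt0.
have pu : p * u = (tau ^+ 2)^-1 by rewrite /u; field; rewrite !gt_eqF.
(* The level at which the moderate condition [t ^+ 2 <= del ^+ 2 * (p * s)] becomes true for
   [t = tau ^+ 2]. *)
pose x1 := tau ^+ 4 / (del ^+ 2 * p).
have x10 : 0 < x1 by rewrite divr_gt0// mulr_gt0// exprn_gt0.
have d2 : 0 < del ^+ 2 by rewrite exprn_gt0.
have [Mb [hb nb]] : exists M : nat, tau ^+ 6 / del ^+ 2 <= rho ^+ M.+1 /\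
    M.+1%:R <= ln (tau ^+ 6 / del ^+ 2) / ln rho + 1.
  apply: geometric_steps => //; rewrite ler_pdivlMr// mul1r (le_trans _ (t1 6%N))//.
  by rewrite exprn_ile1//; lra.
have [Mm [hm nm]] := geometric_steps rho1 p1.
have [Mt [ht nt]] : exists M : nat, del^-1 <= rho ^+ M.+1 /\ M.+1%:R <= ln (del^-1) / ln rho + 1.
  by apply: geometric_steps => //; rewrite invf_ge1//; lra.
have B0 : pbound P (exceedance (tau ^+ 2) 0 u) (tau ^+ 2)^-1.
  rewrite -pu; apply: exceedance_low; first exact: sqr_ge0.
  by rewrite u0/= invf_le1 ?mulr_gt0// -(mulr1 1) ler_pM.
have B1 : pbound P (exceedance (tau ^+ 2) u x1) (Mb.+1%:R * (2 * expR (- (tau / 16)))).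
  apply: (exceedance_geometric (rho := rho)) => //; first exact: ltW.
    have -> : x1 = u * (tau ^+ 6 / del ^+ 2) by rewrite /x1 /u; field; rewrite !gt_eqF.
    by rewrite ler_pM2l.
  move=> i _; apply: (exceedance_block_crude (rho := rho)) => //.
  - by rewrite mulr_gt0// exprn_gt0.
  - by rewrite (ltW rho1).
  - by rewrite ge_min exprS mulrCA lexx.
  - have -> : tau ^+ 2 * (p * (u * rho ^+ i)) = rho ^+ i by rewrite /u; field; rewrite !gt_eqF.
    exact: rk.
have B2 : pbound P (exceedance (tau ^+ 2) x1 del) (Mm.+1%:R *
    (2 * expR (- ((1 - del) ^+ 2 / (2 * rho) * (tau ^+ 2) ^+ 2)))).
  apply: (exceedance_geometric (rho := rho)) => //; first exact: ltW.
    apply: (@le_trans _ _ (x1 * p)); last by rewrite ler_pM2l.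
    have -> : x1 * p = tau ^+ 4 / del ^+ 2 by rewrite /x1; field; rewrite !gt_eqF.
    rewrite ler_pdivlMr// (le_trans _ (t1 4%N))// -exprS exprn_ile1//; lra.
  move=> i _; apply: exceedance_block_moderate => //.
  - by rewrite mulr_gt0// exprn_gt0.
  - exact: sqr_ge0.
  - exact: ltW.
  - by rewrite del0/=; lra.
  - by rewrite ge_min exprS mulrCA lexx.
  - by rewrite ge_min lexx orbT.
  - have -> : del ^+ 2 * (p * (x1 * rho ^+ i)) = tau ^+ 4 * rho ^+ i.
      by rewrite /x1; field; rewrite !gt_eqF.
    by rewrite -exprM -[(2 * 2)%N]/4%N ler_peMr// ltW.
(* Starting from the maximum with [u] secures [1 <= tau ^+ 2 * (p * s)] even when [u] exceeds
   [del]. *)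
have B3 : pbound P (exceedance (tau ^+ 2) (Num.max u del) 2^-1) (Mt.+1%:R * (2 * expR (- (tau / 16)))).
  have m0 : 0 < Num.max u del by rewrite lt_max u0.
  apply: (exceedance_geometric (rho := rho)) => //; first exact: ltW.
    apply: (@le_trans _ _ (del * del^-1)); first by rewrite divff ?gt_eqF//; lra.
    by rewrite ler_pM// ?invr_ge0 ?(ltW del0)// le_max lexx orbT.
  move=> i _; apply: (exceedance_block_crude (rho := rho)) => //.
  - by rewrite mulr_gt0// exprn_gt0.
  - by rewrite (ltW rho1).
  - by rewrite ge_min exprS mulrCA lexx.
  - have : u * 1 <= Num.max u del * rho ^+ i.
      by rewrite ler_pM// ?(ltW u0)// le_max lexx.
    rewrite mulr1 /u -div1r ler_pdivrMr ?mulr_gt0// => h; apply: (le_trans h).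
    by rewrite le_eqVlt; apply/orP; left; apply/eqP; ring.
have := pboundU (pboundU (pboundU B0 B1) B2) B3; apply: pbound_sub.
  move=> w [q [/andP[q0 q1] q01 e]].
  have [qu|uq] := leP q u; first by left; left; left; exists q; rewrite q0 qu.
  have [qx|xq] := leP q x1; first by left; left; right; exists q; rewrite (ltW uq) qx.
  have [qd|dq] := leP q del; first by left; right; exists q; rewrite (ltW xq) qd.
  by right; exists q; split => //; rewrite ge_max (ltW uq) (ltW dq) q1.
by rewrite !lerD// ler_wpM2r// mulr_ge0// expR_ge0.
Qed.

End null_scan.

(** * Rate of the null bound *)

Section null_asymptotics.
Context {R : realType}.

(** The power 7 absorbs a number of crude blocks bounded by a multiple of [tau ^+ 6] and still
    leaves [1 / tau]. *)
Lemma expRN_div16_le : exists C : R, 0 <= C /\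
  forall x : R, 0 < x -> expR (- (x / 16)) <= C / x ^+ 7.
Proof.
exists (7`!%:R * 16 ^+ 7); split; first by rewrite mulr_ge0// exprn_ge0.
move=> x x0; have := expRN_le_invr 6 (divr_gt0 x0 (ltr0Sn R 15)).
by rewrite expr_div_n invf_div mulrA.
Qed.

Lemma exceedance_rate (a : R) : 0 < a -> exists K : R,
  forall (d : measure_display) (T : measurableType d) (P : probability T R)
    (J : finType) (z : J -> T -> R) (tau : R),
  iidN P z -> 1 <= tau -> 1 < ln (#|J|%:R : R) ->
  tau ^+ 2 = (1 + a) * Num.sqrt (2 * ln (ln (#|J|%:R))) ->
  pbound P (exceedance z (tau ^+ 2) 0 2^-1) (K / tau).
Proof.
move=> a0; have a1 : 0 < 1 + a by rewrite addr_gt0.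
have [C [C0 hC]] := expRN_div16_le.
(* Then (1 + a) (1 - 2 del) = 1 + a / 2, which is at least [rho]. The moderate exponent is thus at
   least (1 + a) ln ln p, and the ln p blocks leave exp(- a ln ln p). *)
pose del := a / (4 * (1 + a)).
have del0 : 0 < del by rewrite divr_gt0// mulr_gt0.
have del1 : del <= 2^-1.
  by rewrite ler_pdivrMr ?mulr_gt0//; lra.
pose rho := 1 + Num.min (a / 2) 1.
have rho1 : 1 < rho by rewrite ltrDl lt_min ltr01 andbT divr_gt0.
have rho2 : rho <= 2.
  have -> : 2 = 1 + 1 :> R by [].
  by rewrite lerD2l ge_min lexx orbT.
have rhoa : rho <= 1 + a / 2 by rewrite lerD2l ge_min lexx.
have l0 : 0 < ln rho by exact: ln_gt0.
have d2 : 0 < del ^+ 2 by rewrite exprn_gt0.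
have ld0 : 0 <= ln (del^-1).
  by rewrite ln_ge0// invf_ge1//; lra.
pose K2 := (1 / (del ^+ 2 * ln rho) + 1) * (2 * C).
pose K3 := (1 / ln rho + 1) * (2 * (2 * (1 + a) ^+ 2 / a)).
pose K4 := (ln (del^-1) / ln rho + 1) * (2 * C).
exists (1 + K2 + K3 + K4) => d T P J z tau iz tau1 lp1 tauE.
have tau0 : 0 < tau by exact: lt_le_trans ltr01 tau1.
have t1 k : 1 <= tau ^+ k by rewrite exprn_ege1.
have t0 k : 0 < tau ^+ k by rewrite exprn_gt0.
set p : R := #|J|%:R in lp1 tauE.
have p1 : 1 <= p.
  rewrite leNgt; apply/negP => p1; have := ln_le0 (ltW p1); lra.
have p0 : 0 < p by exact: lt_le_trans p1.
set L := ln (ln p) in tauE.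
have L0 : 0 < L by exact: ln_gt0.
have eL : expR L = ln p by rewrite lnK// posrE (lt_trans ltr01).
have t2 : (tau ^+ 2) ^+ 2 = 2 * (1 + a) ^+ 2 * L.
  rewrite tauE exprMn sqr_sqrtr; last by rewrite mulr_ge0// ltW.
  by ring.
have rd : 1 < rho <= 2 by rewrite rho1.
have dd : 0 < del <= 2^-1 by rewrite del0.
apply: pbound_sub (exceedance_bound iz p0 tau1 rd dd p1) => //.
have inv_le k : (tau ^+ k.+1)^-1 <= tau^-1.
  by rewrite lef_pV2 ?posrE// exprS ler_peMr// ltW.
have -> : (1 + K2 + K3 + K4) / tau = tau^-1 + K2 / tau + K3 / tau + K4 / tau.
  by move: K2 K3 K4 => k2 k3 k4; ring.
apply: lerD; first apply: lerD; first apply: lerD.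
- exact: inv_le.
- apply: (@le_trans _ _ ((tau ^+ 6 / (del ^+ 2 * ln rho) + tau ^+ 6) * (2 * (C / tau ^+ 7)))).
    apply: ler_pM.
    + by rewrite addr_ge0// divr_ge0 ?(ltW l0)// ln_ge0// ler_pdivlMr// mul1r
        (le_trans _ (t1 6%N))// exprn_ile1 ?(ltW del0)//; lra.
    + by rewrite mulr_ge0// expR_ge0.
    + rewrite lerD//.
      have -> : tau ^+ 6 / (del ^+ 2 * ln rho) = tau ^+ 6 / del ^+ 2 / ln rho.
        by rewrite invfM mulrA.
      by rewrite ler_pM2r ?invr_gt0// ltW// ln_sublinear// divr_gt0.
    + by rewrite ler_pM2l// hC.
  rewrite /K2 le_eqVlt; apply/orP; left; apply/eqP.
  by field; rewrite !gt_eqF.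
- have e3 : expR (- ((1 - del) ^+ 2 / (2 * rho) * (tau ^+ 2) ^+ 2)) <= expR (- ((1 + a) * L)).
    rewrite ler_expR lerN2 t2.
    have -> : (1 - del) ^+ 2 / (2 * rho) * (2 * (1 + a) ^+ 2 * L) =
      (1 + a) * L * ((1 + a) * (1 - del) ^+ 2 / rho) by field; rewrite gt_eqF// (lt_trans ltr01).
    rewrite ler_peMr ?mulr_ge0 ?(ltW a1) ?(ltW L0)//.
    rewrite ler_pdivlMr ?(lt_trans ltr01)// mul1r (le_trans rhoa)//.
    have -> : 1 + a / 2 = (1 + a) * (1 - 2 * del) by rewrite /del; field; rewrite gt_eqF.
    rewrite ler_pM2l//; have := sqr_ge0 del; rewrite !expr2; lra.
  apply: (@le_trans _ _ ((expR L / ln rho + expR L) * (2 * expR (- ((1 + a) * L))))).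
    apply: ler_pM.
    + by rewrite addr_ge0// divr_ge0 ?(ltW l0)// ln_ge0.
    + by rewrite mulr_ge0// expR_ge0.
    + by rewrite eL lerD// ltW.
    + by rewrite ler_pM2l.
  have -> : (expR L / ln rho + expR L) * (2 * expR (- ((1 + a) * L))) =
      (1 / ln rho + 1) * (2 * expR (- (a * L))).
    have -> : - (a * L) = L + - ((1 + a) * L) by ring.
    by rewrite expRD; field; rewrite gt_eqF.
  rewrite /K3 -mulrA ler_wpM2l//; first by rewrite addr_ge0// divr_ge0// ltW.
  rewrite -[leRHS]mulrA ler_pM2l//.
  have aL : 0 < a * L by rewrite mulr_gt0.
  have h : expR (- (a * L)) <= 1%:R / (a * L) := expRN_le_invr 0 aL.
  apply: (le_trans h).
  have -> : a * L = a * (tau ^+ 4 / (2 * (1 + a) ^+ 2)).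
    congr (_ * _); have -> : tau ^+ 4 = (tau ^+ 2) ^+ 2 by rewrite -exprM.
    by rewrite t2; field; rewrite gt_eqF.
  have -> : 1%:R / (a * (tau ^+ 4 / (2 * (1 + a) ^+ 2))) = 2 * (1 + a) ^+ 2 / a / tau ^+ 4.
    by field; rewrite !gt_eqF.
  by rewrite ler_wpM2l// divr_ge0 ?(ltW a0)// mulr_ge0// sqr_ge0.
- rewrite /K4 -mulrA ler_wpM2l//; first by rewrite addr_ge0// divr_ge0// ltW.
  rewrite -[leRHS]mulrA ler_pM2l// (le_trans (hC _ tau0))// ler_wpM2l//.
Qed.

End null_asymptotics.

Section expectation_bounds.
Context {R : realType} {d : measure_display} {T : measurableType d}.
Variable P : probability T R.

(* [f] need not be measurable: the integral of a nonnegative function is a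
   supremum over the simple functions below it. *)
Lemma expectation_le_pbound (f : T -> R) (A : set T) (b : R) :
  (forall w, 0 <= f w <= 1) -> (forall w, ~ A w -> f w = 0) -> pbound P A b ->
  ('E_P[f] <= b%:E)%E.
Proof.
move=> f01 fA [F [mF AF PF]]; apply: le_trans PF.
rewrite unlock.
have f0 w : (0 <= (f w)%:E)%E by rewrite lee_fin; have /andP[] := f01 w.
rewrite -[X in (_ <= P X)%E]setIT -integral_indic//.
rewrite !ge0_integralE//=; apply: ereal_sup_le => _ [h hf <-]; exists h => // x.
apply: le_trans (hf x) _; rewrite !patch_setT lee_fin indicE.
have [/set_mem Fx|/negP nF] := boolP (x \in F); first by have /andP[] := f01 x.
by rewrite fA// => /AF Fx; apply: nF; exact/mem_set.
Qed.

End expectation_bounds.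

(** * Type I error *)

Section type1.
Context {R : realType}.

(** Normalizing by the norm of [Y] removes the scale [c], which is 1 under the null and [sg] under
    the alternative. *)
Lemma dotp_normalized (d : measure_display) (T : measurableType d) (n : nat) (J : finType) (i0 : 'I_n)
    (G : 'I_n * option J -> T -> R) (c : R) (Y v : 'cV[R]_n) (w : T) :
  0 < c -> (forall i, Y i 0 = c * G (i, None) w) -> \sum_k G (k, None) w ^+ 2 != 0 ->
  dotp Y v / norm2 Y = \sum_i noise_dir i0 G i w * v i 0.
Proof.
move=> c0 YE S0; rewrite /norm2 /dotp.
have S1 : 0 <= \sum_k G (k, None) w ^+ 2 by apply: sumr_ge0 => *; exact: sqr_ge0.
have -> : \sum_i Y i 0 * Y i 0 = c ^+ 2 * \sum_k G (k, None) w ^+ 2.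
  by rewrite mulr_sumr; apply: eq_bigr => i _; rewrite YE; ring.
rewrite sqrtrM ?sqr_ge0// sqrtr_sqr gtr0_norm//.
rewrite mulr_suml; apply: eq_bigr => i _; rewrite /noise_dir (negbTE S0) YE.
have sq0 : Num.sqrt (\sum_k G (k, None) w ^+ 2) != 0 by rewrite gt_eqF// sqrtr_gt0 lt_neqAle eq_sym S0.
by field; rewrite sq0 gt_eqF.
Qed.

Lemma type1_error_small (a eps : R) : 0 < a -> 0 < eps -> exists A : R,
  forall (n p : nat) (d : measure_display) (T : measurableType d) (P : probability T R)
    (X : 'I_n -> 'I_p -> {RV P >-> R}) (xi : 'I_n -> {RV P >-> R}),
  gaussian_design X -> gaussian_noise X xi -> (0 < n)%N -> A <= ln (p%:R) ->
  (type1_error X xi (psi_HC a) <= eps%:E)%E.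
Proof.
move=> a0 eps0; have [K hK] := exceedance_rate a0.
pose S := Num.max 1 (K / eps).
(* This makes ln ln p at least 1 + S^4, whence the threshold is at least [S ^+ 2] and
   [tau >= S >= K / eps]. *)
exists (expR (1 + (S ^+ 2) ^+ 2)) => n p d T P X xi gX gxi n0 lp.
have S1 : 1 <= S by rewrite le_max lexx.
have S4 : 1 <= (S ^+ 2) ^+ 2 by rewrite -exprM exprn_ege1.
have lp1 : 1 < ln (p%:R : R).
  apply: lt_le_trans lp; apply: lt_le_trans (expR_ge1Dx _); lra.
have lp0 : 0 < ln (p%:R : R) by exact: lt_trans lp1.
pose t : R := (1 + a) * Num.sqrt (2 * ln (ln p%:R)).
have llp : 1 + (S ^+ 2) ^+ 2 <= ln (ln p%:R).
  by rewrite -[leLHS]expRK ler_ln ?posrE ?expR_gt0.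
have tS : S ^+ 2 <= t.
  rewrite -[leLHS]mul1r ler_pM ?sqr_ge0//; first lra.
  rewrite -[leLHS]ger0_norm ?sqr_ge0// -sqrtr_sqr ler_wsqrtr//; lra.
have t0 : 0 <= t by apply: le_trans tS; exact: sqr_ge0.
pose tau := Num.sqrt t.
have tau2 : tau ^+ 2 = t by rewrite sqr_sqrtr.
have tauS : S <= tau.
  by rewrite -[leLHS]ger0_norm ?(le_trans ler01)// -sqrtr_sqr ler_wsqrtr.
have tau1 : 1 <= tau by exact: le_trans tauS.
have tau0 : 0 < tau by exact: lt_le_trans tau1.
pose i0 : 'I_n := Ordinal n0.
have iG := iidN_design_noise gX gxi.
have iz := iidN_projections i0 iG.
set z := projections _ _ in iz.
have := hK d T P _ z tau iz tau1; rewrite card_ord => /(_ lp1 tau2) pb.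
rewrite /type1_error /Etheta.
apply: (@expectation_le_pbound _ _ _ P _ (exceedance z (tau ^+ 2) 0 2^-1)).
- by move=> w; rewrite /psi_HC; case: (_ < _)%E; rewrite /= ?lexx ?ler01.
- move=> w nw; rewrite /psi_HC; case H: (_ < _)%E => //; have [q [q0 q1 hq]] := t_HC_gt H.
  case: nw; exists q; split; [by rewrite ltW|by rewrite q0|].
  rewrite /exceeds tau2 card_ord; apply: (lt_le_trans hq); rewrite ler_nat.
  have YE i : response X xi 0 w i 0 = 1 * design_noise X xi (i, None) w.
    by rewrite !mxE mul1r big1 ?add0r// => j _; rewrite mxE mul0r.
  have [S0|S0] := eqVneq (\sum_k design_noise X xi (k, None) w ^+ 2) 0; last first.
    rewrite /pcount; apply: subset_leq_card; apply/fintype.subsetP => j.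
    rewrite !inE /ystat (dotp_normalized i0 _ ltr01 YE S0).
    congr (gtail `|_| <= q); apply: eq_bigr => i _; by rewrite !mxE.
  (* If the noise vanishes, division by zero makes every statistic 0 and every p-value 1, above the
     admissible levels. *)
  rewrite leqNgt; apply/negP => /(leq_ltn_trans (leq0n _)) /card_gt0P[j]; rewrite inE.
  have -> : ystat (design X w) (response X xi 0 w) j = 0.
    rewrite /ystat (_ : norm2 _ = 0) ?invr0 ?mulr0// /norm2 /dotp.
    rewrite (eq_bigr (fun k => design_noise X xi (k, None) w ^+ 2)) ?S0 ?sqrtr0//.
    by move=> k _; rewrite YE mul1r.
  by rewrite normr0 gtail0 leNgt (le_lt_trans q1)//; lra.
- apply: pbound_sub pb => //.
  have : K / eps <= tau by rewrite (le_trans _ tauS)// le_max lexx orbT.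
  by rewrite !ler_pdivrMr// mulrC.
Qed.

End type1.

(** * Type II error *)

Section alternative_representation.
Context {R : realType} {d : measure_display} {T : measurableType d}.
Variable P : probability T R.

Lemma reflect_along_involutive (I : finType) (h : I -> R) (X : I -> T -> R) i w :
  reflect_along h (reflect_along h X) i w = X i w.
Proof.
have [Q0|Q0] := eqVneq (\sum_m h m ^+ 2) 0.
  by rewrite /reflect_along Q0 invr0 !mulr0 !mul0r !subr0.
rewrite {1}/reflect_along.
have -> : \sum_m h m * reflect_along h X m w = - \sum_m h m * X m w.
  rewrite /reflect_along; set S := \sum_m h m * X m w; set Q := \sum_m h m ^+ 2 in Q0 *.
  rewrite (eq_bigr (fun m => h m * X m w - 2 * S / Q * h m ^+ 2)); last by move=> m _; ring.
  by rewrite sumrB -/S -mulr_sumr -/Q; field.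
by rewrite /reflect_along; field.
Qed.

(* The reflection sends the noise coordinate to the normalized response, and
   leaves [p] other Gaussian columns that are independent of it; the columns of
   the design are recovered by reflecting back. *)
Lemma ystat_representation (n p : nat) (X : 'I_n -> 'I_p -> {RV P >-> R})
    (xi : 'I_n -> {RV P >-> R}) (theta : 'cV[R]_p) :
  gaussian_design X -> gaussian_noise X xi -> (0 < n)%N -> 0 < norm2 theta ->
  let tau := norm2 theta in let sg := Num.sqrt (1 + tau ^+ 2) in
  let u j := theta j 0 / tau in
  exists (z : 'I_p -> T -> R) (zeta : 'I_n -> T -> R),
    [/\ iidN P z, iidN P zeta & forall w, \sum_i zeta i w ^+ 2 != 0 -> forall j,
     ystat (design X w) (response X xi theta w) j =
     z j w + u j * (tau / sg * Num.sqrt (\sum_i zeta i w ^+ 2) - (1 + sg^-1) * \sum_l u l * z l w)].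
Proof.
move=> gX gxi n0 tau0 tau sg u.
have tau2 : tau ^+ 2 = \sum_j theta j 0 ^+ 2.
  rewrite /tau /norm2 sqr_sqrtr; last by apply: sumr_ge0 => j _; rewrite -expr2 sqr_ge0.
  by apply: eq_bigr => j _; rewrite expr2.
have t2 : 0 < tau ^+ 2 by rewrite exprn_gt0.
have sg2 : sg ^+ 2 = 1 + tau ^+ 2 by rewrite sqr_sqrtr// addr_ge0// ltW.
have sg1 : 1 < sg.
  by rewrite -[ltLHS]sqrtr1 ltr_sqrt// ?ltrDl// addr_gt0.
have sg0 : 0 < sg by exact: lt_trans sg1.
pose i0 : 'I_n := Ordinal n0.
pose G := design_noise X xi.
have iG : iidN P G := iidN_design_noise gX gxi.
(* The unit vector of R^(p+1) along (theta, 1), the direction of the response in each row; [h] below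
   is its difference with the noise basis vector, so the reflection exchanges the two. *)
pose v (o : option 'I_p) : R := if o is Some j then theta j 0 / sg else sg^-1.
have sumopt (F : option 'I_p -> R) : \sum_o F o = F None + \sum_j F (Some j).
  rewrite (bigD1 None)//=; congr (_ + _).
  rewrite (reindex_omap Some id) => [|[j|]//].
  by apply: eq_bigl => j; rewrite eqxx.
have v1 : \sum_o v o ^+ 2 = 1.
  rewrite sumopt /v; under eq_bigr do rewrite expr_div_n.
  by rewrite -mulr_suml -tau2 exprVn -[X in X + _]mul1r -mulrDl -sg2 divff// sg2 gt_eqF// addr_gt0.
pose h o := v o - (o == None)%:R.
pose G' (io : 'I_n * option 'I_p) w := reflect_along h (fun o => G (io.1, o)) io.2 w.
have iG' : iidN P G' := iidN_reflect_blocks h iG.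
have G'N i w : G' (i, None) w = (\sum_j theta j 0 * X i j w + xi i w) / sg.
  rewrite /G' /= (reflect_along_unit None (fun o => G (i, o)) w v1) sumopt /v /G /design_noise/=.
  rewrite mulrDl addrC mulrC; congr (_ + _); rewrite mulr_suml.
  by apply: eq_bigr => j _; rewrite mulrAC.
have Q : \sum_o h o ^+ 2 = 2 * (1 - sg^-1).
  have -> : 2 * (1 - sg^-1) = 1 - 2 * sg^-1 + 1 by ring.
  rewrite sumopt /h /= mulr1n (eq_bigr (fun j => v (Some j) ^+ 2)); last first.
    by move=> j _; rewrite subr0.
  have : v None ^+ 2 + \sum_j v (Some j) ^+ 2 = 1.
    by rewrite -(sumopt (fun o => v o ^+ 2)).
  by rewrite /v /= => e; rewrite -[X in _ = _ + X]e; ring.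
have sgm : sg - 1 != 0 by rewrite subr_eq0 gt_eqF.
have sgn0 : sg != 0 by rewrite gt_eqF.
have sg' : 1 - sg^-1 != 0 by rewrite subr_eq0 eq_sym invr_eq1 gt_eqF.
have GE i j w : G (i, Some j) w = G' (i, Some j) w
    - v (Some j) / (1 - sg^-1) * (\sum_l v (Some l) * G' (i, Some l) w) + v (Some j) * G' (i, None) w.
  rewrite -[LHS](reflect_along_involutive h (fun o => G (i, o)) (Some j) w).
  rewrite {1}/reflect_along Q sumopt -/(G' (i, None) w).
  have -> : reflect_along h (fun o => G (i, o)) (Some j) w = G' (i, Some j) w by [].
  have -> : \sum_l h (Some l) * reflect_along h (fun o => G (i, o)) (Some l) w =
      \sum_l v (Some l) * G' (i, Some l) w.
    by apply: eq_bigr => l _; rewrite /h /= subr0.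
  by rewrite /h /= mulr1n subr0; field; rewrite sgm sgn0.
exists (projections i0 G'), (fun i => G' (i, None)); split.
- exact: (iidN_projections i0 iG').
- have inj : injective (fun i : 'I_n => (i, None : option 'I_p)) by move=> ? ? [].
  exact: iidN_reindex inj iG'.
move=> w S0 j.
have YE i : response X xi theta w i 0 = sg * G' (i, None) w.
  by rewrite G'N mxE mulrC divfK// gt_eqF.
rewrite /ystat (dotp_normalized i0 _ sg0 YE S0).
pose e i := noise_dir i0 G' i w.
(* The normalized response projected on its own direction gives its norm: this is the source of the
   drift. *)
have eN : \sum_i e i * G' (i, None) w = Num.sqrt (\sum_i G' (i, None) w ^+ 2).
  have S1 : 0 <= \sum_k G' (k, None) w ^+ 2 by apply: sumr_ge0 => *; exact: sqr_ge0.
  set S := \sum_k _ in S0 S1 *.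
  rewrite (eq_bigr (fun i => G' (i, None) w ^+ 2 / Num.sqrt S)).
    rewrite -mulr_suml -/S -{1}(sqr_sqrtr S1) expr2 mulfK// gt_eqF// sqrtr_gt0.
    by rewrite lt_neqAle eq_sym S0.
  by move=> i _; rewrite /e /noise_dir (negbTE S0) -/S expr2 mulrAC.
transitivity (\sum_i e i * G' (i, Some j) w
    - v (Some j) / (1 - sg^-1) * (\sum_l v (Some l) * \sum_i e i * G' (i, Some l) w)
    + v (Some j) * \sum_i e i * G' (i, None) w).
  rewrite (eq_bigr (fun i => e i * G' (i, Some j) w
     - v (Some j) / (1 - sg^-1) * (e i * \sum_l v (Some l) * G' (i, Some l) w)
     + v (Some j) * (e i * G' (i, None) w))); last first.
    move=> i _; have -> : col j (design X w) i 0 = G (i, Some j) w by rewrite !mxE.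
    by rewrite GE /e; ring.
  rewrite big_split sumrB /= -!mulr_sumr; congr (_ - _ * _ + _).
  under eq_bigr do rewrite mulr_sumr; rewrite exchange_big/=.
  apply: eq_bigr => l _; rewrite mulr_sumr; apply: eq_bigr => i _; ring.
rewrite eN -/(projections i0 G' j w).
have -> : \sum_l v (Some l) * \sum_i e i * G' (i, Some l) w =
    tau / sg * \sum_l u l * projections i0 G' l w.
  rewrite mulr_sumr; apply: eq_bigr => l _; rewrite /v /u -/(projections i0 G' l w).
  by field; rewrite !gt_eqF.
have -> : v (Some j) = tau / sg * u j by rewrite /v /u; field; rewrite !gt_eqF.
have -> : tau / sg * u j / (1 - sg^-1) * (tau / sg * \sum_l u l * projections i0 G' l w) =
    u j * (tau ^+ 2 / sg ^+ 2 / (1 - sg^-1)) * \sum_l u l * projections i0 G' l w.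
  by field; rewrite sgm sgn0.
have -> : tau ^+ 2 / sg ^+ 2 / (1 - sg^-1) = 1 + sg^-1.
  have -> : tau ^+ 2 = sg ^+ 2 - 1 by rewrite sg2 addrC addKr.
  by field; rewrite sgm sgn0.
ring.
Qed.

(** Markov's inequality for the exponential of [- lam] times the count, with probabilities that may
    vary with [j]. The quadratic bound on exp(- lam) produces the term [lam ^+ 2 * M]. *)
Lemma chernoff_lower_tail (J : finType) (z : J -> T -> R) (S : J -> set R) (lam x : R) :
  iidN P z -> (forall j, measurable (S j)) -> 0 <= lam ->
  let M := \sum_j fine (normal_prob 0 1 (S j)) in
  pbound P [set w | \sum_j (\1_(S j) (z j w) : R) <= x]
    (expR (lam ^+ 2 * M - lam * (M - x))).
Proof.
move=> iz mS lam0 M; have [mz _] := iz.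
have mI j : measurable_fun [set: T] (fun w => \1_(S j) (z j w) : R).
  by apply: measurableT_comp => //; exact: measurable_indic.
pose f j (y : R) := expR (- (lam * \1_(S j) y)).
have mf j : measurable_fun [set: R] (f j).
  apply: measurableT_comp => //; apply: measurableT_comp => //.
  by apply: measurable_funM => //; exact: measurable_indic.
have mprod : measurable_fun [set: T] (fun w => \prod_j f j (z j w)).
  by apply: measurable_prod => j _; exact: (measurableT_comp (mf j)).
exists [set w | \sum_j (\1_(S j) (z j w) : R) <= x]; split => //.
  have mT : measurable_fun [set: T] (fun w => \sum_j (\1_(S j) (z j w) : R)).
    exact: measurable_sum.
  have := mT measurableT `]-oo, x]%classic (measurable_itv _).
  by rewrite setTI; congr measurable; apply/seteqP; split => w /=; rewrite in_itv.
apply: (@le_trans _ _ (\int[P]_w (expR (lam * x) * \prod_j f j (z j w))%:E)%E).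
  apply: prob_le_integral.
  - have mT : measurable_fun [set: T] (fun w => \sum_j (\1_(S j) (z j w) : R)).
      exact: measurable_sum.
    have := mT measurableT `]-oo, x]%classic (measurable_itv _).
    by rewrite setTI; congr measurable; apply/seteqP; split => w /=; rewrite in_itv.
  - exact: measurable_funM.
  - by move=> w; rewrite mulr_ge0 ?expR_ge0// prodr_ge0// => j _; rewrite expR_ge0.
  - move=> w /= Sx; rewrite -expR_sum -expRD -[leLHS]expR0 ler_expR sumrN -mulr_sumr -mulrBr.
    by rewrite mulr_ge0// subr_ge0.
under eq_integral do rewrite EFinM.
rewrite ge0_integralZl//; last 2 first.
- exact/measurable_EFinP.
- by move=> w _; rewrite lee_fin prodr_ge0// => i _; rewrite expR_ge0.
rewrite (iidN_integral_prod iz mf); last by move=> *; exact: expR_ge0.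
have intf j : (\int[normal_prob 0 1]_y (f j y)%:E =
    (1 - (1 - expR (- lam)) * fine (normal_prob 0 1 (S j)))%:E)%E.
  have mSC : measurable (~` S j) by exact: measurableC.
  transitivity (\int[normal_prob 0 1]_y
      ((expR (- lam))%:E * (\1_(S j) y)%:E + (\1_(~` S j) y)%:E))%E.
    apply: eq_integral => y _; rewrite -EFinM -EFinD /f !indicE in_setC; congr (_%:E).
    by case: (y \in S j); rewrite /= ?mulr1 ?mulr0 ?addr0 ?oppr0 ?expR0 ?add0r.
  have iI (B : set R) : measurable B ->
      (\int[normal_prob 0 1]_y (\1_B y)%:E = normal_prob (0 : R) 1 B)%E.
    by move=> mB; rewrite integral_indic ?setIT.
  rewrite ge0_integralD//.
  - rewrite ge0_integralZl//; last by apply/measurable_EFinP; apply: measurable_indic; exact: mS.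
    rewrite (iI _ (mS j)) (iI _ mSC) probability_setC; last exact: mS.
    rewrite -[X in (_ * X)%E]fineK; last by rewrite fin_num_measure//; exact: mS.
    rewrite -[X in (_ + (_ - X))%E]fineK; last by rewrite fin_num_measure//; exact: mS.
    by rewrite -EFinM -EFinB -EFinD; congr (_%:E); ring.
  - by apply: emeasurable_funM => //; apply/measurable_EFinP; apply: measurable_indic; exact: mS.
  - by apply/measurable_EFinP; apply: measurable_indic; exact: mSC.
under eq_bigr do rewrite intf.
rewrite prodEFin -EFinM lee_fin.
have h : \prod_j (1 - (1 - expR (- lam)) * fine (normal_prob 0 1 (S j))) <=
    expR (- ((lam - lam ^+ 2) * M)).
  rewrite /M mulr_sumr -sumrN expR_sum; apply: ler_prod => j _.
  set b := fine _.
  have b0 : 0 <= b by rewrite fine_ge0.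
  have b1 : b <= 1 by rewrite -lee_fin fineK ?fin_num_measure ?probability_le1//; exact: mS.
  have e0 := expR_ge0 (- lam).
  have e1 : expR (- lam) <= 1 by rewrite -[leRHS]expR0 ler_expR oppr_le0.
  apply/andP; split; first by nra.
  apply: (le_trans _ (expR_ge1Dx _)); rewrite lerD2l lerN2 ler_wpM2r//.
  have := expRN_quadratic_le lam0; lra.
apply: (le_trans (ler_wpM2l (expR_ge0 _) h)).
by rewrite -expRD ler_expR le_eqVlt; apply/orP; left; apply/eqP; ring.
Qed.

End alternative_representation.

(** * Exceedances forced by the drift *)

Section power.
Context {R : realType}.
Notation gauss := (@normal_prob R 0 1).

(* Values of a standard Gaussian for which the statistic with drift [a * v]
   certainly exceeds [t] in absolute value, for every [v >= A]. *)
Definition hit (a A t : R) : set R :=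
  [set x | if a == 0 then t <= `|x| else t <= Num.sg a * x + `|a| * A].

Lemma hit_exceeds (a A t v x : R) : A <= v -> hit a A t x -> t <= `|x + a * v|.
Proof.
move=> Av; rewrite /hit /=; case: eqVneq => [->|a0] h; first by rewrite mul0r addr0.
apply: (le_trans h); apply: (@le_trans _ _ (Num.sg a * (x + a * v))).
  by rewrite mulrDr lerD2l mulrA -normrEsg ler_wpM2l.
by rewrite (le_trans (ler_norm _))// normrM normr_sg a0 mul1r.
Qed.

Lemma measurable_upper (y : R) : measurable [set x : R | y <= x].
Proof.
have -> : [set x : R | y <= x] = `[y, +oo[%classic; last exact: measurable_itv.
by apply/seteqP; split => x /=; rewrite in_itv/= andbT.
Qed.

Lemma sg_preimage (a : R) (D : set R) : a != 0 -> measurable D ->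
  measurable [set x | D (Num.sg a * x)] /\ gauss [set x | D (Num.sg a * x)] = gauss D.
Proof.
move=> a0 mD; have [ap|an|] := ltrgtP 0 a; last by move=> h; rewrite -h eqxx in a0.
  have -> : [set x | D (Num.sg a * x)] = D; last by [].
  by apply/seteqP; split => x /=; rewrite gtr0_sg// mul1r.
have -> : [set x | D (Num.sg a * x)] = [set x | D (- x)].
  by apply/seteqP; split => x /=; rewrite ltr0_sg// mulN1r.
split; last exact: gauss_opp.
by rewrite -[X in measurable X]setTI; exact: (@oppr_measurable R setT).
Qed.

Lemma hit_upper (a A t : R) : a != 0 ->
  hit a A t = [set x | [set y | t - `|a| * A <= y] (Num.sg a * x)].
Proof.
by move=> a0; apply/seteqP; split => x; rewrite /hit /= (negbTE a0) lerBlDr.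
Qed.

Lemma measurable_hit (a A t : R) : measurable (hit a A t).
Proof.
have [a0|a0] := eqVneq a 0.
  have -> : hit a A t = [set x | t <= `|x|]; last exact: measurable_abs_ge.
  by apply/seteqP; split => x; rewrite /hit /= a0 eqxx.
by rewrite hit_upper//; have [] := sg_preimage a0 (measurable_upper (t - `|a| * A)).
Qed.

Lemma hit0_prob (A t : R) : fine (gauss (hit 0 A t)) = gtail t.
Proof.
have -> : hit 0 A t = [set x | t <= `|x|].
  by apply/seteqP; split => x; rewrite /hit /= eqxx.
by rewrite gauss_abs_ge.
Qed.

(** Keeping only the interval from [y] to [y + 1] costs a linear term in the exponent, harmless at
    the scale of use. *)
Lemma hit_prob_ge (a A t y : R) : a != 0 -> 0 <= y -> t - `|a| * A <= y ->
  normal_peak 1 * expR (- ((y + 1) ^+ 2 / 2)) <= fine (gauss (hit a A t)).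
Proof.
move=> a0 y0 ty; rewrite hit_upper// (sg_preimage a0 (measurable_upper _)).2.
rewrite -lee_fin fineK; last by rewrite fin_num_measure//; exact: measurable_upper.
have y01 : 0 <= y <= y + 1 by rewrite y0 lerDl ler01.
apply: (@le_trans _ _ (gauss `]y, y + 1]%classic)); last first.
  apply: le_measure; rewrite ?inE//; first exact: measurable_upper.
  by move=> x /=; rewrite in_itv/= => /andP[yx _]; rewrite (le_trans ty)// ltW.
by apply: le_trans (gauss_itv_ge y01); rewrite lee_fin addrAC subrr add0r mulr1.
Qed.

Lemma miss_prob_le (a A t g : R) : a != 0 -> 0 <= g -> t + g <= `|a| * A ->
  (gauss (~` hit a A t) <= (expR (- (g ^+ 2 / 2)))%:E)%E.
Proof.
move=> a0 g0 tg; apply: le_trans (gauss_upper_tail_le g0).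
have mU : measurable [set z : R | g < z].
  have -> : [set z : R | g < z] = `]g, +oo[%classic; last exact: measurable_itv.
  by apply/seteqP; split => x /=; rewrite in_itv/= andbT.
have a0' : - a != 0 by rewrite oppr_eq0.
have [mS e] := sg_preimage a0' mU.
rewrite -e; apply: le_measure; rewrite ?inE//.
  by apply: measurableC; exact: measurable_hit.
by move=> x; rewrite /hit /= (negbTE a0) => /negP; rewrite -ltNge sgrN mulNr; lra.
Qed.

Context {d : measure_display} {T : measurableType d}.
Variable P : probability T R.

(** Acceptance implies one of three bad events: a short [zeta], a large projection of [z] on [u], or
    too few hits. Outside the first two the drift is at least [A]; the factor 2 before [kappa]
    bounds [1 + sg^-1]. *)
Lemma type2_split (n p : nat) (X : 'I_n -> 'I_p -> {RV P >-> R}) (xi : 'I_n -> {RV P >-> R})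
    (theta : 'cV[R]_p) (a c kappa t A e1 e2 : R) :
  gaussian_design X -> gaussian_noise X xi -> (0 < n)%N -> 0 < norm2 theta ->
  let tau := norm2 theta in
  let thr := (1 + a) * Num.sqrt (2 * ln (ln p%:R)) in
  0 <= thr -> 0 <= c -> 0 <= kappa -> gtail t <= 2^-1 ->
  A + 2 * kappa <= tau / Num.sqrt (1 + tau ^+ 2) * Num.sqrt c ->
  (forall zeta, @iidN _ _ _ P 'I_n zeta -> pbound P [set w | \sum_i zeta i w ^+ 2 <= c] e1) ->
  (forall z, @iidN _ _ _ P 'I_p z ->
    pbound P [set w | \sum_j (\1_(hit (theta j 0 / tau) A t) (z j w) : R) <=
      p%:R * gtail t + thr * Num.sqrt (p%:R * gtail t)] e2) ->
  (Etheta X xi theta (fun x y => (1 - psi_HC a x y)%R) <= (e1 + gtail kappa + e2)%R%:E)%E.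
Proof.
move=> gX gxi n0 tau0 tau thr thr0 c0 k0 tq hA h1 h2.
have [z [zeta [iz izeta yE]]] := ystat_representation gX gxi n0 tau0.
pose u j := theta j 0 / tau.
set sg := Num.sqrt (1 + tau ^+ 2) in hA yE.
have tau2 : 0 < tau ^+ 2 by rewrite exprn_gt0.
have sg1 : 1 <= sg.
  by rewrite -[leLHS]sqrtr1 ler_wsqrtr// lerDl ltW.
have sg0 : 0 < sg by exact: lt_le_trans sg1.
have u1 : \sum_j u j ^+ 2 = 1.
  rewrite /u; under eq_bigr do rewrite expr_div_n.
  rewrite -mulr_suml; have -> : \sum_j theta j 0 ^+ 2 = tau ^+ 2.
    rewrite /tau /norm2 sqr_sqrtr; last by apply: sumr_ge0 => j _; rewrite -expr2 sqr_ge0.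
    by apply: eq_bigr => j _; rewrite expr2.
  by rewrite divff// gt_eqF.
have p2 : pbound P [set w | kappa <= `|\sum_j u j * z j w|] (gtail kappa).
  have inj : injective (fun kj : unit * 'I_p => kj.2) by move=> [[] j] [[] j'] /= ->.
  have iu := iidN_unit_comb u1 (iidN_reindex inj iz).
  exists [set w | kappa <= `|\sum_j u j * z j w|]; split => //.
    have := iu.1 tt measurableT _ (measurable_abs_ge kappa).
    by rewrite setTI.
  have := iidN_marginal tt iu (measurable_abs_ge kappa).
  by rewrite gauss_abs_ge /= => ->.
apply: (expectation_le_pbound _ _ (pboundU (pboundU (h1 _ izeta) p2) (h2 _ iz))).
  by move=> w; rewrite /psi_HC; case: (_ < _)%E; rewrite /= ?subrr ?subr0 ?lexx ?ler01.
move=> w nbad.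
have nb1 : c < \sum_i zeta i w ^+ 2.
  by rewrite ltNge; apply/negP => h; apply: nbad; left; left.
have nb2 : `|\sum_j u j * z j w| < kappa.
  by rewrite ltNge; apply/negP => h; apply: nbad; left; right.
have nb3 : p%:R * gtail t + thr * Num.sqrt (p%:R * gtail t) <
    \sum_j (\1_(hit (u j) A t) (z j w) : R).
  by rewrite ltNge; apply/negP => h; apply: nbad; right.
have S0 : \sum_i zeta i w ^+ 2 != 0 by rewrite gt_eqF// (le_lt_trans c0).
have yE' := yE w S0.
set V := _ - _ in yE'.
have AV : A <= V.
  rewrite /V lerBrDr; apply: (@le_trans _ _ (A + 2 * kappa)).
    rewrite lerD2l.
    apply: (@le_trans _ _ (2 * `|\sum_j u j * z j w|)); last by rewrite ler_pM2l// ltW.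
    apply: (@le_trans _ _ (`|1 + sg^-1| * `|\sum_j u j * z j w|)).
      by rewrite -normrM ler_norm.
    rewrite ler_wpM2r// ger0_norm ?addr_ge0 ?invr_ge0 ?(ltW sg0)//.
    have : sg^-1 <= 1 by rewrite invf_le1.
    by lra.
  apply: (le_trans hA); rewrite ler_wpM2l ?divr_ge0 ?(ltW sg0) ?(ltW tau0)//.
  by rewrite ler_wsqrtr// ltW.
rewrite /psi_HC (_ : (_ < _)%E = true) ?subrr//.
apply: (@t_HC_lt _ _ _ _ _ _ (gtail t)) => //; first exact: gtail_gt0.
apply: (lt_le_trans nb3).
rewrite /pcount -sum1_card natr_sum [leRHS]big_mkcond/=; apply: ler_sum => j _.
rewrite indicE inE yE'; have [/set_mem/(hit_exceeds AV) h|_] := boolP (_ \in hit _ _ _).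
  by rewrite (gtail_le h).
by case: ifP.
Qed.

End power.

Section power_cases.
Context {R : realType}.
Notation gauss := (@normal_prob R 0 1).

Lemma chi2_lower_tail_small (eta eps : R) : 0 < eta < 1 -> 0 < eps -> exists n0 : nat,
  forall (n : nat) (d : measure_display) (T : measurableType d) (P : probability T R)
    (zeta : 'I_n -> T -> R), (n0 <= n)%N -> iidN P zeta ->
  pbound P [set w | \sum_i zeta i w ^+ 2 <= (1 - eta) * n%:R] eps.
Proof.
(* The chi-square bound is the [n]-th power of [r], and [r < 1] as soon as 2 l (1 - eta) < eta. *)
move=> /andP[eta0 eta1] eps0; pose l := eta / 4.
have l0 : 0 < l by rewrite divr_gt0.
have l2 : 0 < 1 + 2 * l by lra.
pose r := expR (l * (1 - eta)) * (Num.sqrt (1 + 2 * l))^-1.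
have r0 : 0 <= r by rewrite mulr_ge0 ?expR_ge0// invr_ge0 sqrtr_ge0.
have r1 : r < 1.
  rewrite -(@ltr_pXn2r _ 2)// ?nnegrE// expr1n exprMn exprVn sqr_sqrtr ?(ltW l2)//.
  rewrite ltr_pdivrMr// mul1r -expRM_natl.
  have x1 : 0 < 1 - 2%:R * (l * (1 - eta)) by rewrite /l; nra.
  have := expR_ge1Dx (- (2%:R * (l * (1 - eta)))); rewrite expRN => h.
  have e0 := expR_gt0 (2%:R * (l * (1 - eta)) : R).
  apply: (@le_lt_trans _ _ (1 - 2%:R * (l * (1 - eta)))^-1).
    by rewrite -[leLHS]invrK lef_pV2 ?posrE// invr_gt0.
  by rewrite invf_plt ?posrE// -div1r ltr_pdivrMr//; rewrite /l in x1 *; nra.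
have [n0 _ hn] : \forall n \near \oo, r ^+ n <= eps.
  have rn : `|r| < 1 by rewrite ger0_norm.
  have /cvgrPdist_le/(_ _ eps0) := cvg_expr rn; apply: filterS => n.
  by rewrite sub0r normrN ger0_norm// exprn_ge0.
exists n0 => n d T P zeta nn0 iz.
exists [set w | \sum_i zeta i w ^+ 2 <= (1 - eta) * n%:R]; split => //.
  have mS : measurable_fun [set: T] (fun w => \sum_i zeta i w ^+ 2).
    by apply: measurable_sum => k; apply: measurable_funX; exact: iz.1.
  have := mS measurableT `]-oo, (1 - eta) * n%:R]%classic (measurable_itv _).
  by rewrite setTI; congr measurable; apply/seteqP; split => w /=; rewrite in_itv.
apply: (le_trans (chi2_lower_tail _ iz (ltW l0))); rewrite lee_fin card_ord.
by rewrite mulrA expRM_natr -exprMn; exact: hn.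
Qed.

Context {d : measure_display} {T : measurableType d}.
Variable P : probability T R.

(** A count below 1 has no hit at all, in particular none at [j0]. *)
Lemma hits_strong (J : finType) (z : J -> T -> R) (u : J -> R) (A t g x : R) (j0 : J) :
  iidN P z -> u j0 != 0 -> 0 <= g -> t + g <= `|u j0| * A -> x < 1 ->
  pbound P [set w | \sum_j (\1_(hit (u j) A t) (z j w) : R) <= x] (expR (- (g ^+ 2 / 2))).
Proof.
move=> iz u0 g0 tg x1.
have mC : measurable (~` hit (u j0) A t) by apply: measurableC; exact: measurable_hit.
exists [set w | (~` hit (u j0) A t) (z j0 w)]; split.
- by have := iz.1 j0 measurableT _ mC; rewrite setTI.
- move=> w /= sx h; have := le_lt_trans sx x1.
  rewrite (bigD1 j0)//= indicE mem_set//= ltNge lerDl sumr_ge0//.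
- apply: le_trans (miss_prob_le u0 g0 tg); have := iidN_marginal j0 iz mC.
  by move=> <-.
Qed.

(** At most [k] null coordinates are lost to the signal, a loss of [k * gtail t] in the mean. This
    loss and the threshold term each take at most a quarter of the signal mean [S], so the mean
    exceeds the target by [S / 2]. *)
Lemma hits_weak (J : finType) (z : J -> T -> R) (u : J -> R) (A t thr k b c : R) (B : pred J) :
  iidN P z -> 0 <= b ->
  (forall j, B j -> u j != 0 /\ b <= fine (gauss (hit (u j) A t))) ->
  #|[pred j | u j != 0]|%:R <= k ->
  let S0 := #|[pred j | B j]|%:R * b in
  4 * (k * gtail t) <= S0 -> 4 * (thr * Num.sqrt (#|J|%:R * gtail t)) <= S0 ->
  0 < c -> c <= thr -> 2 * c ^+ 2 <= S0 ->
  pbound P [set w | \sum_j (\1_(hit (u j) A t) (z j w) : R) <=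
    #|J|%:R * gtail t + thr * Num.sqrt (#|J|%:R * gtail t)] (expR (1 - c / 2)).
Proof.
move=> iz b0 hB hk S0 h1 h2 c0 ct h3; set q := gtail t in h1 h2 *; set p : R := #|J|%:R in h2 *.
have q0 : 0 <= q by exact: gtail_ge0.
pose bb j := fine (gauss (hit (u j) A t)).
have bb0 j : 0 <= bb j by rewrite fine_ge0.
pose S := \sum_(j | u j != 0) bb j.
have SS0 : S0 <= S.
  rewrite /S (bigID B)/= -[leLHS]addr0 lerD ?sumr_ge0//.
  rewrite /S0 mulr_natl -sumr_const [leLHS](eq_bigl (fun j => (u j != 0) && B j)).
    by apply: ler_sum => j /andP[_ Bj]; have [_] := hB j Bj.
  move=> j; rewrite !inE; apply/idP/andP => [Bj|[]//].
  by have [-> _] := hB j Bj.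
have c2 : 0 < c ^+ 2 by rewrite exprn_gt0.
have S0p : 0 < S0 by lra.
have Sp : 0 < S by exact: lt_le_trans S0p SS0.
pose K : R := #|[pred j | u j == 0]|%:R.
have Mq : \sum_j bb j = K * q + S.
  rewrite (bigID (fun j => u j == 0))/=; congr (_ + _).
  rewrite (eq_bigr (fun=> q)); last by move=> j /eqP uj; rewrite /bb uj hit0_prob.
  by rewrite sumr_const mulr_natl.
have pK : p <= K + k.
  apply: (@le_trans _ _ (K + #|[pred j | u j != 0]|%:R)); last by rewrite lerD2l.
  by rewrite /p /K -natrD ler_nat -(cardC [pred j | u j == 0]) leqnn.
have Kp : K <= p by rewrite ler_nat max_card.
(* The linear gain is then at least [c / 2], while the quadratic term is at most 1/16 from the null
   coordinates and 1/2 from the signal, hence below 1. *)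
pose lam := c / S.
have lam0 : 0 <= lam by rewrite divr_ge0// ltW.
have mh j : measurable (hit (u j) A t) by exact: measurable_hit.
apply: pbound_sub (chernoff_lower_tail (p * q + thr * Num.sqrt (p * q)) iz mh lam0) => //.
rewrite ler_expR -[\sum_j _]/(\sum_j bb j) Mq.
set r := Num.sqrt (p * q) in h2 *.
have r0 : 0 <= r by exact: sqrtr_ge0.
have r2 : r * r = p * q by rewrite -expr2 sqr_sqrtr// mulr_ge0.
have g1 : S / 2 <= K * q + S - (p * q + thr * r).
  have : p * q <= (K + k) * q by rewrite ler_wpM2r.
  by rewrite mulrDl; lra.
have g2 : lam * (S / 2) <= lam * (K * q + S - (p * q + thr * r)) by rewrite ler_wpM2l.
have lS : lam * S = c by rewrite /lam divfK// gt_eqF.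
have g3 : lam ^+ 2 * (K * q + S) <= 16^-1 + 2^-1.
  apply: (@le_trans _ _ (lam ^+ 2 * (p * q) + lam * c)).
    rewrite mulrDr lerD//; last by rewrite expr2 -mulrA lS.
    by rewrite ler_wpM2l ?sqr_ge0// ler_wpM2r.
  apply: lerD.
    rewrite -r2 expr2.
    have : lam * r * 4 <= 1.
      have : lam * (4 * (thr * r)) <= lam * S by rewrite ler_wpM2l// (le_trans h2).
      rewrite lS => h.
      have : c * (lam * r * 4) <= thr * (lam * r * 4) by rewrite ler_wpM2r ?(mulr_ge0 (mulr_ge0 lam0 r0)).
      move=> h'; rewrite -(ler_pM2l c0) mulr1; apply: (le_trans h').
      by apply: le_trans h; rewrite le_eqVlt; apply/orP; left; apply/eqP; ring.
    have lr0 : 0 <= lam * r by rewrite mulr_ge0.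
    by nra.
  rewrite -(ler_pM2r Sp) mulrAC lS -expr2; lra.
by lra.
Qed.

(** Pigeonhole on the total energy [A ^+ 2]: weak coordinates carry at most [k * (v ^+ 2 * l)], each
    strong one at most [9 * l]. *)
Lemma card_strong_coordinates (J : finType) (u : J -> R) (A k l v : R) :
  \sum_j u j ^+ 2 = 1 -> 0 < l -> 0 <= v -> #|[pred j | u j != 0]|%:R <= k ->
  (forall j, (`|u j| * A) ^+ 2 <= 9 * l) ->
  (A ^+ 2 - k * (v ^+ 2 * l)) / (9 * l) <= #|[pred j | (u j != 0) && (v ^+ 2 * l <= (`|u j| * A) ^+ 2)]|%:R.
Proof.
move=> u1 l0 v0 hk hu; rewrite ler_pdivrMr ?mulr_gt0// lerBlDr.
have -> : A ^+ 2 = \sum_(j | u j != 0) (`|u j| * A) ^+ 2.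
  rewrite -[LHS]mul1r -u1 mulr_suml (bigID (fun j => u j != 0))/= [X in _ + X]big1.
    by rewrite addr0; apply: eq_bigr => j _; rewrite exprMn real_normK// num_real.
  by move=> j; rewrite negbK => /eqP->; rewrite expr0n mul0r.
rewrite (bigID (fun j => v ^+ 2 * l <= (`|u j| * A) ^+ 2))/=; apply: lerD.
  set C := 9 * l in hu *.
  by rewrite mulr_natl -sumr_const; apply: ler_sum => j _; exact: hu.
apply: (@le_trans _ _ (\sum_(j | u j != 0) v ^+ 2 * l)).
  rewrite [leRHS](bigID (fun j => v ^+ 2 * l <= (`|u j| * A) ^+ 2))/=.
  rewrite -[leLHS]add0r lerD//; last by apply: ler_sum => j /andP[_]; rewrite -ltNge => /ltW.
  by apply: sumr_ge0 => j _; rewrite mulr_ge0 ?sqr_ge0// ltW.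
by rewrite sumr_const -mulr_natl ler_wpM2r// mulr_ge0 ?sqr_ge0// ltW.
Qed.

End power_cases.

(** * Exponents of the detection boundary *)

Section power_calculus.
Context {R : realType}.

(** With [s ^+ 2 = ln p], it says that a positive power of [p] beats factors exp(m s) and factors
    linear in [s]. *)
Lemma expR_sqr_dominates (g m C : R) : 0 < g -> 0 <= C -> exists s0, forall s, s0 <= s ->
  C * (1 + s) <= expR (g * s ^+ 2 - m * s).
Proof.
move=> g0 C0; exists (Num.max 1 ((m + 2 * C) / g)) => s; rewrite ge_max => /andP[s1].
rewrite ler_pdivrMr// => h; apply: le_trans (expR_ge1Dx _); nra.
Qed.

Lemma phi_bounds (beta : R) : 2^-1 < beta < 1 -> 0 < phi beta.
Proof.
move=> /andP[b1 b2]; rewrite /phi; case: ifP => b3; first by rewrite sqrtr_gt0; lra.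
rewrite mulr_gt0 ?sqrtr_gt0// subr_gt0 -[ltRHS]sqrtr1 ltr_sqrt//; lra.
Qed.

(* P-values are counted at the threshold [w * sqrt (ln p)], and a coordinate is
   strong when its drift is at least [v * sqrt (ln p)]. The last inequality says
   that the expected number of strong coordinates above the threshold,
   [p ^ (1 - beta - (w - v) ^ 2 / 2)], dominates the null standard deviation
   [p ^ ((1 - w ^ 2 / 2) / 2)]. *)
Lemma power_exponents (beta c : R) : 2^-1 < beta < 1 -> 0 < c -> exists v w : R,
  [/\ 0 < v, v < phi beta + c, v <= w, w ^+ 2 <= 2 &
   0 < 1 - beta - (w - v) ^+ 2 / 2 - (1 - w ^+ 2 / 2) / 2].
Proof.
move=> /andP[b1 b2] c0; have phi0 : 0 < phi beta by apply: phi_bounds; rewrite b1.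
have between (m : R) : phi beta < m ->
    exists v, [/\ phi beta < v, v < phi beta + c & v < m].
  move=> pm; exists ((phi beta + Num.min (phi beta + c) m) / 2).
  by case: (leP (phi beta + c) m) => h; split; lra.
have [b3|b3] := ltP beta (3 / 4).
- have phi2 : phi beta ^+ 2 = 2 * beta - 1.
    by rewrite /phi (ltW b3) sqr_sqrtr//; lra.
  have h2 : (Num.sqrt 2^-1 : R) ^+ 2 = 2^-1 by rewrite sqr_sqrtr.
  have [|v [v1 v2 v3]] := between (Num.sqrt 2^-1).
    rewrite -(@ltr_pXn2r _ 2)// ?nnegrE ?sqrtr_ge0 ?(ltW phi0)// phi2 h2; lra.
  have v0 : 0 < v by lra.
  have vv : phi beta ^+ 2 < v ^+ 2 by rewrite ltr_pXn2r ?nnegrE ?(ltW v0) ?(ltW phi0).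
  have vw : v ^+ 2 < 2^-1 by rewrite -h2 ltr_pXn2r ?nnegrE ?sqrtr_ge0 ?(ltW v0).
  (* [w = 2 v] maximizes the gap, with value 1/2 - beta + v^2 / 2, positive as v^2 > 2 beta - 1. It
     is admissible because v^2 < 1/2. *)
  by exists v, (2 * v); split => //; nra.
- have phiE : phi beta = Num.sqrt 2 * (1 - Num.sqrt (1 - beta)).
    (* At the junction 3/4 the first branch is the one selected, and the two formulas coincide. *)
    rewrite /phi; case: ifP => // b4; have -> : beta = 3 / 4 by lra.
    have -> : 2 * (3 / 4) - 1 = 2 * (2^-1 ^+ 2) :> R by field.
    have -> : 1 - 3 / 4 = 2^-1 ^+ 2 :> R by field.
    by rewrite sqrtrM// sqrtr_sqr ger0_norm//; field.
  have h2 : (Num.sqrt 2 : R) ^+ 2 = 2 by rewrite sqr_sqrtr.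
  have s20 : 0 < Num.sqrt 2 :> R by rewrite sqrtr_gt0.
  have hb : Num.sqrt (1 - beta) ^+ 2 = 1 - beta by rewrite sqr_sqrtr//; lra.
  have sb0 : 0 < Num.sqrt (1 - beta) by rewrite sqrtr_gt0; lra.
  have [|v [v1 v2 v3]] := between (Num.sqrt 2).
    by rewrite phiE gtr_pMr// ltrBlDr ltrDl.
  (* Here the constraint [w ^+ 2 <= 2] is saturated: the null exponent vanishes and the gap reduces
     to 1 - beta - (w - v)^2 / 2. *)
  exists v, (Num.sqrt 2); split; rewrite ?h2//; [lra|exact: ltW|].
  have : (Num.sqrt 2 - v) ^+ 2 < (Num.sqrt 2 * Num.sqrt (1 - beta)) ^+ 2.
    by rewrite ltr_pXn2r ?nnegrE ?mulr_ge0 ?subr_ge0 ?(ltW v3) ?(ltW s20) ?(ltW sb0)//; lra.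
  by rewrite exprMn h2 hb; lra.
Qed.

End power_calculus.

Section hits_power.
Context {R : realType}.

Lemma sqrt_gtail_le (x t y : R) : 0 <= t -> x - t ^+ 2 / 2 = y * 2 ->
  Num.sqrt (expR x * gtail t) <= 2 * expR y.
Proof.
move=> t0 xy; rewrite -[leRHS]ger0_norm ?mulr_ge0 ?expR_ge0// -sqrtr_sqr ler_wsqrtr//.
apply: (@le_trans _ _ (expR x * (2 * expR (- (t ^+ 2 / 2))))).
  by rewrite ler_wpM2l ?expR_ge0// gtail_le_expR.
by rewrite mulrCA -expRD xy exprMn -expRM_natr; have := expR_ge0 (y * 2); lra.
Qed.

(** For [s ^+ 2 = ln p] this is the threshold of the test. It exceeds any constant, and a linear
    upper bound is enough against gains that are powers of [p]. *)
Lemma thr_bounds (a c : R) : 0 < a -> exists s0, forall s, s0 <= s ->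
  c <= (1 + a) * Num.sqrt (2 * ln (s ^+ 2)) <= 2 * (1 + a) * s.
Proof.
move=> a0; exists (expR (c ^+ 2)) => s hs.
have s1 : 1 <= s by apply: le_trans hs; rewrite -expR0 ler_expR sqr_ge0.
have s0 : 0 < s by lra.
have lnC : c ^+ 2 <= ln (s ^+ 2).
  rewrite lnXn// mulr2n; have : c ^+ 2 <= ln s by rewrite -[leLHS]expRK ler_ln ?posrE ?expR_gt0.
  by have := sqr_ge0 c; lra.
have lnS : ln (s ^+ 2) <= s ^+ 2.
  by have := @ln_sublinear R (s ^+ 2); rewrite exprn_gt0// => /(_ isT)/ltW.
apply/andP; split.
  apply: (@le_trans _ _ (Num.sqrt (2 * ln (s ^+ 2)))).
    apply: (le_trans (ler_norm _)); rewrite -sqrtr_sqr ler_wsqrtr//.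
    by have := sqr_ge0 c; lra.
  by rewrite ler_peMl ?sqrtr_ge0//; lra.
rewrite -mulrA mulrCA ler_pM2l; last by lra.
rewrite -[leRHS]ger0_norm; last by lra.
by rewrite -sqrtr_sqr ler_wsqrtr// exprMn; have := sqr_ge0 s; lra.
Qed.

(* One coordinate with drift [3 s] already defeats the null count at [2 s], which
   vanishes in probability since [p * gtail (2 s)] is of order [1 / p]. *)
Lemma strong_hits_power (a eps : R) : 0 < a -> 0 < eps ->
  exists s0, forall s, s0 <= s -> gtail (2 * s) <= 2^-1 /\
  forall (d : measure_display) (T : measurableType d) (P : probability T R)
    (J : finType) (z : J -> T -> R) (u : J -> R) (A thr : R) (j0 : J),
  iidN P z -> #|J|%:R = expR (s ^+ 2) -> 0 <= thr <= 2 * (1 + a) * s ->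
  u j0 != 0 -> 3 * s <= `|u j0| * A ->
  pbound P [set w | \sum_j (\1_(hit (u j) A (2 * s)) (z j w) : R) <=
    #|J|%:R * gtail (2 * s) + thr * Num.sqrt (#|J|%:R * gtail (2 * s))] eps.
Proof.
move=> a0 eps0; have ie0 : 0 < eps^-1 by rewrite invr_gt0.
(* Makes [E], the exponential of - s^2 / 2, at most [eps], which controls the miss, and small enough
   against 8 (1 + a) s + 8 to bring the required count below 1. *)
have [||s0 h] := @expR_sqr_dominates R 2^-1 0 (8 * (1 + a) + eps^-1); first by [].
  by lra.
exists (Num.max 1 s0) => s; rewrite ge_max => /andP[s1 /h {h}].
rewrite mul0r subr0 [2^-1 * _]mulrC => hE; pose E := expR (- (s ^+ 2 / 2)).
have E0 : 0 < E by exact: expR_gt0.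
have {}hE : E * ((8 * (1 + a) + eps^-1) * (1 + s)) <= 1.
  by rewrite /E expRN mulrC ler_pdivrMr ?expR_gt0// mul1r.
have es0 : 0 <= eps^-1 * s by rewrite mulr_ge0 ?(ltW ie0)//; lra.
have as0 : 0 <= a * s by rewrite mulr_ge0 ?(ltW a0)//; lra.
have E1 : E * (8 * (1 + a) * s + 8) <= 1.
  by apply: le_trans hE; rewrite ler_pM2l//; lra.
have Eeps : E <= eps.
  have : E * eps^-1 <= E * ((8 * (1 + a) + eps^-1) * (1 + s)) by rewrite ler_pM2l//; lra.
  by move=> /le_trans/(_ hE); rewrite ler_pdivrMr// mul1r.
have Es : 0 <= E * (1 + a) * s by rewrite mulr_ge0 ?mulr_ge0 ?(ltW E0)//; lra.
split.
  apply: (le_trans (@gtail_le _ s _ _)); first by lra.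
  by apply: (le_trans (gtail_le_expR _)); rewrite -?/E; lra.
move=> d T P J z u A thr j0 iz hJ /andP[thr0 thr1] uj0 uA.
apply: (pbound_sub _ Eeps (hits_strong (t := 2 * s) (g := s) (A := A)
  (x := #|J|%:R * gtail (2 * s) + thr * Num.sqrt (#|J|%:R * gtail (2 * s))) iz uj0 _ _ _)) => //.
- by lra.
- by lra.
rewrite hJ; have hs : Num.sqrt (expR (s ^+ 2) * gtail (2 * s)) <= 2 * E.
  by apply: sqrt_gtail_le; [lra|field].
have r2 : Num.sqrt (expR (s ^+ 2) * gtail (2 * s)) ^+ 2 = expR (s ^+ 2) * gtail (2 * s).
  by rewrite sqr_sqrtr// mulr_ge0 ?expR_ge0 ?gtail_ge0.
have := sqrtr_ge0 (expR (s ^+ 2) * gtail (2 * s)).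
rewrite -[X in X + _ < _]r2; move: hs; move: (Num.sqrt _) => r hs r0.
have : thr * r <= 2 * (1 + a) * s * (2 * E) by apply: ler_pM.
have : r ^+ 2 <= (2 * E) ^+ 2 by rewrite ler_pXn2r ?nnegrE//; lra.
have : E * E <= E * 8^-1 by rewrite ler_pM2l//; lra.
by rewrite exprMn; lra.
Qed.

(** With all drifts at most [3 * s], at least [c3 * rootk ^+ 2] coordinates have drift [v * s] or
    more, and each hits with probability about exp(- (w - v)^2 s^2 / 2). [hits_weak] then applies at
    threshold [w * s]. *)
Lemma weak_hits_power (a beta c1 eps : R) : 0 < a -> 2^-1 < beta < 1 -> 0 < c1 -> 0 < eps ->
  exists c w s0, 0 < c /\ forall s, s0 <= s -> gtail (w * s) <= 2^-1 /\
  forall (d : measure_display) (T : measurableType d) (P : probability T R)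
    (J : finType) (z : J -> T -> R) (u : J -> R) (thr : R),
  let rootk := expR ((1 - beta) * s ^+ 2 / 2) in
  let A := (phi beta + c1) * rootk * s in
  iidN P z -> #|J|%:R = expR (s ^+ 2) -> c <= thr <= 2 * (1 + a) * s ->
  \sum_j u j ^+ 2 = 1 -> #|[pred j | u j != 0]|%:R <= rootk ^+ 2 ->
  (forall j, `|u j| * A <= 3 * s) ->
  pbound P [set w0 | \sum_j (\1_(hit (u j) A (w * s)) (z j w0) : R) <=
    #|J|%:R * gtail (w * s) + thr * Num.sqrt (#|J|%:R * gtail (w * s))] eps.
Proof.
move=> a0 hb c10 eps0.
have [v [w [v0 vphi vw w2 gap]]] := power_exponents hb c10.
have phi0 := phi_bounds hb; have /andP[b1 b2] := hb.
(* Solves exp(1 - c / 2) <= eps while keeping [c] positive. *)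
pose c := 2 * (1 + Num.max 0 (- ln eps)).
have c0 : 0 < c by rewrite /c mulr_gt0// ltr_pwDl// le_max lexx.
have ceps : expR (1 - c / 2) <= eps.
  rewrite -[leRHS](lnK eps0) ler_expR /c mulrC mulKf//.
  by rewrite opprD addrA subrr sub0r lerNl le_max lexx orbT.
have [dl dlE] : exists dl, dl = w - v by exists (w - v).
have dl0 : 0 <= dl by rewrite dlE subr_ge0.
have w0 : 0 < w by lra.
(* [w ^+ 2 <= 2] makes the null exponent nonnegative, so the positive gap also forces the expected
   number of hits to diverge. *)
have g0 : 0 < 1 - beta - dl ^+ 2 / 2 by move: gap; rewrite -dlE; lra.
have g1 : 0 < (w ^+ 2 - dl ^+ 2) / 2 by rewrite dlE; nra.
have [c3 c3E] : exists c3, c3 = ((phi beta + c1) ^+ 2 - v ^+ 2) / 9 by eexists.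
have c30 : 0 < c3 by rewrite c3E divr_gt0// subr_gt0 ltr_pXn2r ?nnegrE//; lra.
have [c4 c4E] : exists c4, c4 = c3 * (normal_peak 1 * expR (- 2^-1)) by eexists.
have c40 : 0 < c4 by rewrite c4E (mulr_gt0 c30)// mulr_gt0 ?expR_gt0 ?normal_peak_gt0 ?oner_eq0.
rewrite -dlE in gap.
(* In order, the four conditions make the signal mean exceed [2 * c ^+ 2], dominate the lost null
   mean, dominate the threshold term, and put the level below 1/2. *)
have [|s4 h4] := @expR_sqr_dominates R _ dl (2 * c ^+ 2 / c4) g0.
- by rewrite divr_ge0 ?(ltW c40)//; have := sqr_ge0 c; lra.
have [|s5 h5] := @expR_sqr_dominates R _ dl (8 / c4) g1.
- by rewrite divr_ge0 ?(ltW c40).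
have [|s6 h6] := @expR_sqr_dominates R _ dl (16 * (1 + a) / c4) gap.
- by rewrite divr_ge0 ?(ltW c40)//; lra.
have [||s3 h3] := @expR_sqr_dominates R (w ^+ 2 / 2) 0 4.
- by rewrite divr_gt0// exprn_gt0.
- by [].
exists c, w, (Num.max 1 (Num.max s3 (Num.max s4 (Num.max s5 s6)))); split=> // s.
rewrite !ge_max => /andP[s1 /andP[/h3 {}h3 /andP[/h4 {}h4 /andP[/h5 {}h5 /h6 {}h6]]]].
have s0 : 0 < s by exact: lt_le_trans s1.
split.
  apply: (le_trans (gtail_le_expR _)); first by rewrite mulr_ge0 ?ltW.
  rewrite expRN ler_pdivrMr ?expR_gt0//; move: h3; rewrite mul0r subr0 exprMn mulrAC.
  by lra.
have const_le (x y : R) : x * (1 + s) <= y -> 0 <= x -> x <= y.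
  by move=> xy x0; apply: le_trans xy; rewrite ler_peMr// lerDl ltW.
move=> d T P J z u thr rootk A iz hJ /andP[thr1 thr2] u1 hk hA.
have rk2 : rootk ^+ 2 = expR ((1 - beta) * s ^+ 2) by rewrite -expRM_natr divfK.
have A0 : 0 <= A.
  by rewrite /A mulr_ge0 ?(ltW s0)// mulr_ge0 ?expR_ge0// addr_ge0// ltW.
pose b := normal_peak 1 * expR (- ((dl * s + 1) ^+ 2 / 2)) : R.
have b0 : 0 <= b by rewrite mulr_ge0 ?expR_ge0 ?normal_peak_ge0.
pose B := [pred j | (u j != 0) && (v ^+ 2 * s ^+ 2 <= (`|u j| * A) ^+ 2)].
have cardB : c3 * rootk ^+ 2 <= #|[pred j | B j]|%:R.
  apply: le_trans (card_strong_coordinates (A := A) (l := s ^+ 2) (v := v) u1 _ _ hk _).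
  - rewrite /A c3E !exprMn le_eqVlt; apply/orP; left; apply/eqP; field.
    by rewrite gt_eqF.
  - by rewrite exprn_gt0.
  - exact: ltW.
  - move=> j; have -> : 9 * s ^+ 2 = (3 * s) ^+ 2 by ring.
    by rewrite ler_pXn2r ?nnegrE ?(mulr_ge0 _ (ltW s0)) ?(mulr_ge0 _ A0).
have S0ge : c4 * expR ((1 - beta - dl ^+ 2 / 2) * s ^+ 2 - dl * s) <= #|[pred j | B j]|%:R * b.
  apply: (@le_trans _ _ (c3 * rootk ^+ 2 * b)); last by rewrite ler_wpM2r.
  rewrite rk2 /b c4E.
  have -> : (1 - beta - dl ^+ 2 / 2) * s ^+ 2 - dl * s =
     (1 - beta) * s ^+ 2 + (2^-1 + - ((dl * s + 1) ^+ 2 / 2)) by field.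
  rewrite !expRD.
  have e1 : expR (- 2^-1) * expR (2^-1) = 1 :> R by rewrite -expRD addNr expR0.
  rewrite le_eqVlt; apply/orP; left; apply/eqP.
  transitivity (c3 * normal_peak 1 * expR ((1 - beta) * s ^+ 2) * expR (- ((dl * s + 1) ^+ 2 / 2)) * (expR (- 2^-1) * expR (2^-1))).
    by ring.
  by rewrite e1; ring.
apply: (pbound_sub _ ceps (hits_weak (u := u) (A := A) (t := w * s) (B := B) (b := b) (c := c) (k := rootk ^+ 2) (thr := thr) iz b0 _ hk _ _ c0 thr1 _)) => //.
- move=> j; rewrite /B /= => /andP[uj0 vu]; split => //; apply: hit_prob_ge => //.
    by rewrite mulr_ge0// ltW.
  have : v * s <= `|u j| * A.
    by rewrite -(@ler_pXn2r _ 2)// ?nnegrE ?(mulr_ge0 (ltW v0) (ltW s0)) ?(mulr_ge0 _ A0)// exprMn.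
  by rewrite dlE; lra.
- apply: le_trans S0ge.
  have -> : (1 - beta - dl ^+ 2 / 2) * s ^+ 2 - dl * s =
    (1 - beta) * s ^+ 2 - (w * s) ^+ 2 / 2 + ((w ^+ 2 - dl ^+ 2) / 2 * s ^+ 2 - dl * s) by field.
  rewrite expRD [leRHS]mulrCA.
  apply: (@le_trans _ _ (expR ((1 - beta) * s ^+ 2 - (w * s) ^+ 2 / 2) * 8)).
    have := gtail_le_expR (mulr_ge0 (ltW w0) (ltW s0)).
    rewrite rk2 expRD -(ler_pM2l (expR_gt0 ((1 - beta) * s ^+ 2))).
    by rewrite mulrCA; lra.
  by rewrite ler_pM2l ?expR_gt0// mulrC -ler_pdivrMr// (const_le _ _ h5)// divr_ge0// ltW.
- apply: le_trans S0ge.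
  have -> : (1 - beta - dl ^+ 2 / 2) * s ^+ 2 - dl * s =
    (1 - w ^+ 2 / 2) / 2 * s ^+ 2 +
    ((1 - beta - dl ^+ 2 / 2 - (1 - w ^+ 2 / 2) / 2) * s ^+ 2 - dl * s) by field.
  rewrite expRD [leRHS]mulrCA.
  have := @sqrt_gtail_le (s ^+ 2) (w * s) ((1 - w ^+ 2 / 2) / 2 * s ^+ 2) (ltac:(by rewrite mulr_ge0 ?ltW)) (ltac:(field)).
  rewrite hJ; set y := expR (_ * s ^+ 2); set r := Num.sqrt _ => hr.
  have y0 : 0 < y by exact: expR_gt0.
  apply: (@le_trans _ _ (y * (16 * (1 + a) * s))).
    have : thr * r <= 2 * (1 + a) * s * (2 * y).
      have r0 : 0 <= r by exact: sqrtr_ge0.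
      by apply: ler_pM => //; lra.
    by lra.
  rewrite ler_pM2l// [leRHS]mulrC -ler_pdivrMr//; apply: le_trans h6.
  by rewrite mulrAC ler_wpM2l ?lerDr// divr_ge0 ?(ltW c40)//; lra.
- apply: le_trans S0ge; rewrite [leRHS]mulrC -ler_pdivrMr// (const_le _ _ h4)//.
  by rewrite divr_ge0 ?(ltW c40)//; have := sqr_ge0 c; lra.
Qed.

(** The level may depend on the unknown [u], because the statistic scans all levels: the dichotomy
    between one strong coordinate and many weak ones is thus free. *)
Lemma hits_power (a beta c1 eps : R) : 0 < a -> 2^-1 < beta < 1 -> 0 < c1 -> 0 < eps ->
  exists s0, forall s, s0 <= s ->
  forall (d : measure_display) (T : measurableType d) (P : probability T R)
    (J : finType) (u : J -> R),
  #|J|%:R = expR (s ^+ 2) -> \sum_j u j ^+ 2 = 1 ->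
  let rootk := expR ((1 - beta) * s ^+ 2 / 2) in
  #|[pred j | u j != 0]|%:R <= rootk ^+ 2 ->
  let A := (phi beta + c1) * rootk * s in
  let thr := (1 + a) * Num.sqrt (2 * ln (s ^+ 2)) in
  exists2 t, gtail t <= 2^-1 & forall z, iidN P z ->
    pbound P [set w | \sum_j (\1_(hit (u j) A t) (z j w) : R) <=
      #|J|%:R * gtail t + thr * Num.sqrt (#|J|%:R * gtail t)] eps.
Proof.
move=> a0 hb c10 eps0.
have [s1 h1] := strong_hits_power a0 eps0.
have [c [w [s2 [c0 h2]]]] := weak_hits_power a0 hb c10 eps0.
have [s3 h3] := thr_bounds c a0.
exists (Num.max 1 (Num.max s1 (Num.max s2 s3))) => s.
rewrite !ge_max => /andP[s0 /andP[/h1[t1 {}h1] /andP[/h2[t2 {}h2] /h3/andP[c_thr thr_s]]]].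
move=> d T P J u hJ u1 rootk hk A thr.
have thr0 : 0 <= thr by exact: le_trans (ltW c0) c_thr.
have [/existsP[j0 hj0]|/existsPn hweak] := boolP [exists j, 3 * s <= `|u j| * A].
  exists (2 * s) => // z iz; apply: (h1 _ _ _ _ z u A thr j0) => //; first by rewrite thr0.
  by apply: contraTneq hj0 => ->; rewrite normr0 mul0r -ltNge; lra.
exists (w * s) => // z iz; apply: h2 => //; first by rewrite c_thr.
by move=> j; have := hweak j; rewrite -ltNge => /ltW.
Qed.

End hits_power.

Section type2.
Context {R : realType}.

(** The signal increases with [tau], so the radius [r] is the worst case. One factor [1 - eta] pays
    for the saturation at [r ^+ 2 <= eta], the other for the fluctuation of the response norm. *)
Lemma projection_signal_ge (n : nat) (r tau eta : R) : 0 < eta < 1 -> 0 < r -> r ^+ 2 <= eta ->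
  r <= tau ->
  (1 - eta) ^+ 2 * (r * Num.sqrt n%:R) <=
  tau / Num.sqrt (1 + tau ^+ 2) * Num.sqrt ((1 - eta) * n%:R).
Proof.
move=> /andP[eta0 eta1] r0 r2 rt; have e0 : 0 <= 1 - eta by lra.
have tau0 : 0 < tau by exact: lt_le_trans rt.
have st0 : 0 < Num.sqrt (1 + tau ^+ 2).
  by rewrite sqrtr_gt0; have := sqr_ge0 tau; lra.
have -> : (1 - eta) ^+ 2 * (r * Num.sqrt n%:R) = ((1 - eta) * r) * ((1 - eta) * Num.sqrt n%:R).
  by ring.
apply: ler_pM; rewrite ?mulr_ge0 ?sqrtr_ge0 ?(ltW r0)//.
  rewrite ler_pdivlMr// -(@ler_pXn2r _ 2)// ?nnegrE ?mulr_ge0 ?(ltW r0) ?(ltW st0) ?(ltW tau0)//.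
  rewrite !exprMn sqr_sqrtr; last by have := sqr_ge0 tau; lra.
  have rt2 : r ^+ 2 <= tau ^+ 2 by rewrite ler_pXn2r ?nnegrE ?(ltW r0) ?(ltW tau0).
  have rt3 : r ^+ 2 * tau ^+ 2 <= eta * tau ^+ 2 by rewrite ler_wpM2r ?sqr_ge0.
  have t2 := sqr_ge0 tau.
  apply: (@le_trans _ _ ((1 - eta) ^+ 2 * ((1 + eta) * tau ^+ 2))).
    by rewrite -mulrA ler_wpM2l ?sqr_ge0//; lra.
  rewrite mulrA -[leRHS]mul1r ler_wpM2r//; nra.
rewrite sqrtrM// ler_wpM2r ?sqrtr_ge0// -[leLHS]ger0_norm// -sqrtr_sqr ler_wsqrtr//; nra.
Qed.

Lemma type2_error_small (a beta c0 eps : R) : 0 < a -> 2^-1 < beta < 1 -> 0 < c0 -> 0 < eps ->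
  exists (A : R) (n0 : nat) (om : R), 0 < om /\
  forall (n p : nat) (d : measure_display) (T : measurableType d) (P : probability T R)
    (X : 'I_n -> 'I_p -> {RV P >-> R}) (xi : 'I_n -> {RV P >-> R}) (theta : 'cV[R]_p),
  gaussian_design X -> gaussian_noise X xi -> (n0 <= n)%N -> A <= ln p%:R ->
  p%:R `^ (1 - beta) * ln p%:R / n%:R <= om -> sparse (p%:R `^ (1 - beta)) theta ->
  (phi beta + c0) * Num.sqrt (p%:R `^ (1 - beta) * ln p%:R / n%:R) <= norm2 theta ->
  (Etheta X xi theta (fun x y => (1 - psi_HC a x y)%R) <= eps%:E)%E.
Proof.
move=> a0 hb c00 eps0; have phi0 := phi_bounds hb; have /andP[b1 b2] := hb.
have pc0 : 0 < phi beta + c0 by lra.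
(* The two factors [1 - eta] then leave at least [phi beta + 3 * (c0 / 4)]; a further [c0 / 4] of
   the drift is reserved for [2 * kappa], and [c0 / 2] remains as the margin. *)
have [eta etaE] : exists eta, eta = c0 / (8 * (phi beta + c0)) by eexists.
have e8 : eta * (phi beta + c0) = c0 / 8 by rewrite etaE; field; rewrite gt_eqF.
have eta0 : 0 < eta by rewrite etaE divr_gt0//; lra.
have eta1 : eta < 1 by rewrite etaE ltr_pdivrMr; lra.
have eps4 : 0 < eps / 4 by rewrite divr_gt0.
have eta01 : 0 < eta < 1 by rewrite eta0.
have [n0 hn0] := chi2_lower_tail_small eta01 eps4.
have [s1 h1] := hits_power a0 hb (ltac:(lra) : 0 < c0 / 2) eps4.
have [||s2 h2] := @expR_sqr_dominates R 2^-1 0 (4 / eps); first by [].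
  by rewrite divr_ge0 ?ltW.
have [||s3 h3] := @expR_sqr_dominates R ((1 - beta) / 2) 0 (8 / c0); first by lra.
  by rewrite divr_ge0 ?ltW.
pose S := Num.max 1 (Num.max s1 (Num.max s2 s3)).
have S1 : 1 <= S by rewrite le_max lexx.
(* The last constant is the one for which the squared radius is at most [eta], so that the signal is
   not saturated. *)
exists (S ^+ 2), (maxn 1 n0), (eta / (phi beta + c0) ^+ 2).
split; first by rewrite divr_gt0// exprn_gt0.
move=> n p d T P X xi theta gX gxi; rewrite geq_max => /andP[n_gt0 /hn0 {}hn0] hp hom hk hr.
pose s := Num.sqrt (ln p%:R : R).
have Ss : S <= s.
  by rewrite -[leLHS]ger0_norm -?sqrtr_sqr ?ler_wsqrtr//; lra.
have s2E : s ^+ 2 = ln p%:R.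
  by rewrite sqr_sqrtr//; apply: le_trans hp; rewrite sqr_ge0.
move: Ss; rewrite !ge_max => /andP[s_ge1 /andP[/h1 {}h1 /andP[/h2 {}h2 /h3 {}h3]]].
have s0 : 0 < s by lra.
have p0 : 0 < p%:R :> R.
  rewrite ltr0n lt0n; apply: contraTneq s0 => p0.
  by rewrite /s p0 ln0// sqrtr0 ltxx.
have pE : p%:R = expR (s ^+ 2) :> R by rewrite s2E lnK.
pose rootk := expR ((1 - beta) * s ^+ 2 / 2).
have rk0 : 0 < rootk by exact: expR_gt0.
have rk2 : p%:R `^ (1 - beta) = rootk ^+ 2.
  by rewrite /powR gt_eqF// -expRM_natr divfK// s2E.
have nr0 : 0 < n%:R :> R by rewrite ltr0n.
have rE : Num.sqrt (p%:R `^ (1 - beta) * ln p%:R / n%:R) * Num.sqrt n%:R = rootk * s.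
  rewrite -sqrtrM; last by rewrite divr_ge0 ?mulr_ge0 ?powR_ge0 -?s2E ?sqr_ge0.
  by rewrite divfK ?gt_eqF// rk2 -s2E -exprMn sqrtr_sqr ger0_norm// ltW// mulr_gt0.
move: hom hr rE; set q := _ / n%:R => hom hr rE.
have q0 : 0 < q.
  by rewrite /q divr_gt0// mulr_gt0 -?s2E ?exprn_gt0// rk2 exprn_gt0.
have r0 : 0 < (phi beta + c0) * Num.sqrt q by rewrite mulr_gt0// sqrtr_gt0.
have r2 : ((phi beta + c0) * Num.sqrt q) ^+ 2 <= eta.
  by rewrite exprMn sqr_sqrtr ?(ltW q0)// mulrC -ler_pdivlMr// exprn_gt0.
have tau0 : 0 < norm2 theta by exact: lt_le_trans hr.
have signal := projection_signal_ge n eta01 r0 r2 hr.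
have const_le (x y : R) : 0 < x -> x * (1 + s) <= y -> x <= y.
  by move=> x0 xy; apply: le_trans xy; rewrite ler_peMr ?(ltW x0)// lerDl ltW.
have hc : 8 / c0 <= rootk.
  have -> : rootk = expR ((1 - beta) / 2 * s ^+ 2 - 0 * s).
    by rewrite mul0r subr0 mulrAC.
  by apply: const_le h3; rewrite divr_gt0.
have heps : gtail s <= eps / 2.
  apply: (le_trans (gtail_le_expR (ltW s0))).
  rewrite expRN ler_pdivrMr ?expR_gt0// mulrAC ler_pdivlMr// -ler_pdivrMl//.
  have : 4 / eps <= expR (s ^+ 2 / 2).
    apply: const_le; first by rewrite divr_gt0.
    by move: h2; rewrite mul0r subr0 [2^-1 * _]mulrC.
  by rewrite [eps^-1 * _]mulrC; lra.
pose u j := theta j 0 / norm2 theta.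
have u0 j : (u j != 0) = (theta j 0 != 0).
  by rewrite /u mulf_eq0 invr_eq0 (gt_eqF tau0) orbF.
have [|||t t2 ht] := h1 d T P 'I_p u.
- by rewrite card_ord.
- under eq_bigr do rewrite expr_div_n.
  rewrite -mulr_suml sqr_sqrtr; last by apply: sumr_ge0 => j _; rewrite -expr2 sqr_ge0.
  under eq_bigr do rewrite expr2.
  by rewrite divff// gt_eqF// -sqrtr_gt0.
- rewrite -/rootk -rk2; apply: le_trans hk; rewrite ler_nat subset_leq_card//.
  by apply/fintype.subsetP => j; rewrite !inE u0.
rewrite card_ord -/rootk s2E in ht.
(* [kappa = s] has a vanishing tail, at most [eps / 2], yet is negligible against the drift
   [rootk * s] because [rootk] is at least [8 / c0]. *)
have := type2_split gX gxi n_gt0 tau0 (a := a) (c := (1 - eta) * n%:R) (kappa := s) (t := t)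
  (A := (phi beta + c0 / 2) * rootk * s) (e1 := eps / 4) (e2 := eps / 4) _ _ (ltW s0) t2 _ (hn0 d T P) ht.
move=> h; apply: (le_trans (h _ _ _)).
- by rewrite mulr_ge0 ?sqrtr_ge0//; lra.
- by rewrite mulr_ge0 ?(ltW nr0)//; lra.
- apply: le_trans signal; rewrite -[_ * Num.sqrt q * _]mulrA rE.
  have rs0 : 0 < rootk * s by rewrite mulr_gt0.
  have : 8 <= rootk * c0 by rewrite -ler_pdivrMr.
  rewrite -(ler_pM2r s0) => h8.
  have : (phi beta + 3 * (c0 / 4)) * (rootk * s) <= (1 - eta) ^+ 2 * (phi beta + c0) * (rootk * s).
    rewrite ler_pM2r//; have := mulr_ge0 (sqr_ge0 eta) (ltW pc0); lra.
  by lra.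
- by rewrite lee_fin; lra.
Qed.

End type2.

(** * Passage to the limit *)

Section limits.
Context {R : realType}.

Lemma cvge_0 (f : nat -> \bar R) : (\forall m \near \oo, (0 <= f m)%E) ->
  (forall eps : R, 0 < eps -> \forall m \near \oo, (f m <= eps%:E)%E) ->
  f @ \oo --> (0 : \bar R).
Proof.
move=> f0 fe; apply/fine_cvgP; split.
  near=> m; apply: (@fin_real _ (f m)); apply/andP; split.
    by apply: (@lt_le_trans _ _ 0%E); [rewrite ltNy0|near: m].
  by apply: (@le_lt_trans _ _ 1%:E); [near: m; exact: fe|rewrite ltry].
apply/cvgrPdist_le => eps eps0; near=> m; rewrite sub0r normrN /=.
have fm0 : (0 <= f m)%E by near: m.
have : (f m <= eps%:E)%E by near: m; exact: fe.
rewrite ger0_norm ?fine_ge0//; case: (f m) fm0 => //= y _.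
Unshelve. all: by end_near. Qed.

Lemma ln_natr_near (p : nat -> nat) (A : R) : p @ \oo --> \oo ->
  \forall m \near \oo, A <= ln (p m)%:R.
Proof.
move=> /cvgnyPge/(_ (Num.bound (expR A))); apply: filterS => m pm.
have e0 := expR_gt0 A.
have h : expR A <= (p m)%:R.
  by apply: (le_trans (ltW (archi_boundP (ltW e0)))); rewrite ler_nat.
by rewrite -[leLHS]expRK ler_ln ?posrE// (lt_le_trans e0).
Qed.

Lemma limn_einf_gt0_near (u : nat -> R) : (0 < limn_einf (fun m => (u m)%:E))%E ->
  exists2 c, 0 < c & \forall m \near \oo, c <= u m.
Proof.
rewrite limn_einf_lim; have -> := cvg_lim (@ereal_hausdorff R) (@cvg_einfs_sup R (fun m => (u m)%:E)).
move=> /ereal_sup_gt[_ [N _ <-]] h.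
have hN m : (N <= m)%N -> (einfs (fun m => (u m)%:E) N <= (u m)%:E)%E.
  by move=> Nm; apply: ereal_inf_lbound; exists m.
move: h hN; case: (einfs _ N) => [c| |] // c0 hN.
  by exists c; [rewrite -lte_fin|exists N => // m /= /hN; rewrite lee_fin].
by exists 1 => //; exists N => // m /= /hN; rewrite leye_eq.
Qed.

Lemma Etheta_ge0 d (T : measurableType d) (P : probability T R) (n p : nat)
  (X : 'I_n -> 'I_p -> {RV P >-> R}) (xi : 'I_n -> {RV P >-> R}) theta
  (f : test R n p) : (forall x y, 0 <= f x y) -> (0 <= Etheta X xi theta f)%E.
Proof. by move=> f0; rewrite /Etheta unlock; apply: integral_ge0 => w _; rewrite lee_fin. Qed.

(** The supremum over an empty set would be [-oo]; a vector with one large coordinate makes the type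
    II error nonnegative. *)
Lemma Theta_neq0 (p : nat) (k r : R) : (0 < p)%N -> 1 <= k -> @Theta R p k r !=set0.
Proof.
move=> p0 k1; pose j0 := Ordinal p0; pose M := Num.max r 0.
exists (\col_j (if j == j0 then M else 0)); split.
  apply: le_trans k1; rewrite -[1]/(1%:R) ler_nat.
  apply: leq_trans (_ : #|pred1 j0| <= 1)%N; last by rewrite card1.
  by apply: subset_leq_card; apply/fintype.subsetP => j; rewrite !inE mxE; case: ifP => // _; rewrite eqxx.
rewrite /norm2 /dotp (bigD1 j0)//= big1; last first.
  by move=> j /negbTE h; rewrite !mxE h mul0r.
by rewrite !mxE eqxx addr0 -expr2 sqrtr_sqr (le_trans _ (ler_norm _))// le_max lexx.
Qed.

End limits.

Theorem theorem4p4 (R : realType)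
  (n p : nat -> nat)
  (n_oo : n @ \oo --> \oo) (p_oo : p @ \oo --> \oo)
  (d : nat -> measure_display)
  (T : forall m : nat, measurableType (d m))
  (P : forall m : nat, probability (T m) R)
  (X : forall m : nat, 'I_(n m) -> 'I_(p m) -> {RV (P m) >-> R})
  (xi : forall m : nat, 'I_(n m) -> {RV (P m) >-> R})
  (X_gaussian : forall m : nat, gaussian_design (X m))
  (xi_gaussian : forall m : nat, gaussian_noise (X m) (xi m))
  (a : R) (a_gt0 : 0 < a) :
  ((fun m => type1_error (X m) (xi m) (psi_HC a)) @ \oo --> (0 : \bar R)) /\
  (forall (beta : R) (k x r : nat -> R),
     2^-1 < beta -> beta < 1 ->
     (forall m, k m = (p m)%:R `^ (1 - beta)) ->
     (fun m => k m * ln (p m)%:R / (n m)%:R) @ \oo --> (0 : R) ->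
     (forall m, r m = x m * Num.sqrt (k m * ln (p m)%:R / (n m)%:R)) ->
     (0 < limn_einf (fun m => (x m - phi beta)%:E))%E ->
     (fun m => type2_error (X m) (xi m) (psi_HC a) (Theta (k m) (r m)))
       @ \oo --> (0 : \bar R)).
Proof.
have n_ge N : \forall m \near \oo, (N <= n m)%N by move/cvgnyPge: n_oo.
have p_ge N : \forall m \near \oo, (N <= p m)%N by move/cvgnyPge: p_oo.
have lnp_ge A := ln_natr_near A p_oo.
split.
  apply: cvge_0 => [|eps eps0].
    by near=> m; apply: Etheta_ge0 => *; rewrite ler0n.
  have [A hA] := type1_error_small a_gt0 eps0; near=> m.
  by apply: hA => //; near: m.
move=> beta k x r b1 b2 kE k0 rE /limn_einf_gt0_near[c c0 xc].
have hb : 2^-1 < beta < 1 by rewrite b1.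
apply: cvge_0 => [|eps eps0].
  near=> m; have pm0 : (0 < p m)%N by near: m.
  have k1 : 1 <= k m.
    rewrite kE /powR gt_eqF ?ltr0n// -[leLHS]expR0 ler_expR mulr_ge0 ?ln_ge0 ?ler1n//.
    by rewrite subr_ge0 ltW.
  have [theta htheta] := Theta_neq0 (r m) pm0 k1.
  apply: (@le_trans _ _ (Etheta (X m) (xi m) theta (fun x y => 1 - psi_HC a x y))).
    by apply: Etheta_ge0 => M y; rewrite subr_ge0 /psi_HC lern1 leq_b1.
  by apply: ereal_sup_ubound; exists theta.
have [A [n0 [om [om0 h]]]] := type2_error_small a_gt0 hb c0 eps0.
(* The constants were fixed before [theta], so the pointwise bound passes to the supremum. *)
near=> m; apply: ge_ereal_sup => _ [theta [sp rt] <-].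
have km : k m * ln (p m)%:R / (n m)%:R <= om.
  apply: le_trans (ler_norm _) _; rewrite -normrN -sub0r; near: m.
  by move/cvgrPdist_le: k0; apply.
apply: (h (n m) (p m) _ _ _ _ _ theta (X_gaussian m) (xi_gaussian m)); rewrite -?kE//.
- by near: m.
- by near: m.
- apply: le_trans rt; rewrite rE ler_wpM2r ?sqrtr_ge0// -lerBrDl.
  by near: m.
Unshelve. all: by end_near. Qed.
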